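(* Let $1<p,q<\infty$ with $\frac1p+\frac1q=1$. If $f,g\in\mathcal L_{\mathcal H}(X,\nu)$, then $$\sup_{s\in\mathcal S(\mathcal H)}\left\|\left\|s^{1/2}\Big(\frac{d\nu}{d\nu_\rho}\Big)^{1/2}f\Big(\frac{d\nu}{d\nu_\rho}\Big)^{1/2}s\Big(\frac{d\nu}{d\nu_\rho}\Big)^{1/2}g\Big(\frac{d\nu}{d\nu_\rho}\Big)^{1/2}s^{1/2}\right\|_{S^1}\right\|_{L^1}\le\|f\|_{S^p,L^p}\,\|g\|_{S^q,L^q}.$$
   Context: Setting. $\mathcal H$ is a finite-dimensional or separable Hilbert space, $X$ is a locally compact Hausdorff space, and $\mathcal O(X)$ is the Borel $\sigma$-algebra of $X$. $\mathcal S(\mathcal H)$ is the set of positive trace-one operators in $\mathcal B(\mathcal H)$. $\nu:\mathcal O(X)\to\mathcal B(\mathcal H)$ is a positive operator-valued measure (POVM): $\nu(E)\ge 0$ for all $E$, and $\nu$ is countably additive on disjoint Borel sets in the ultraweak topology ($A_n\to A$ ultraweakly iff $\operatorname{Tr}(sA_n)\to\operatorname{Tr}(sA)$ for all $s\in\mathcal S(\mathcal H)$). Fix a full-rank (trivial null space) $\rho\in\mathcal S(\mathcal H)$ and put $\nu_\rho(E)=\operatorname{Tr}(\rho\,\nu(E))$, a finite positive measure mutually absolutely continuous with $\nu$. For an orthonormal basis $\{e_i\}$ put $\nu_{ij}(E)=\langle\nu(E)e_j,e_i\rangle$ and $\frac{d\nu}{d\nu_\rho}=\big[\frac{d\nu_{ij}}{d\nu_\rho}\big]_{i,j}$,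 assumed to be a bounded operator a.e.; it is then positive a.e. A quantum random variable is a function $f:X\to\mathcal B(\mathcal H)$ such that $x\mapsto\operatorname{Tr}(sf(x))$ is Borel measurable for every $s\in\mathcal S(\mathcal H)$. $\mathcal L_{\mathcal H}(X,\nu)$ is the linear span of the positive quantum random variables. $\|A\|_{S^p}=\operatorname{Tr}(|A|^p)^{1/p}$ is the Schatten $p$-norm, and $\|\cdot\|_{L^q}$ is the norm of $L^q(X,\nu_\rho)$ (applied to the function of $x$ obtained after taking the Schatten norm pointwise). For $f\in\mathcal L_{\mathcal H}(X,\nu)$, $$\|f\|_{S^p,L^q}=\sup_{s\in\mathcal S(\mathcal H)}\left\|\left\|s^{1/2}\Big(\frac{d\nu}{d\nu_\rho}\Big)^{1/2}f\Big(\frac{d\nu}{d\nu_\rho}\Big)^{1/2}s^{1/2}\right\|_{S^p}\right\|_{L^q}\in[0,\infty].$$ *)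

(* Defs.v *)
From HB Require Import structures.
From mathcomp Require Import all_boot all_order all_algebra.
From mathcomp Require Import sesquilinear.
From mathcomp Require Import complex.
From mathcomp Require Import all_classical all_reals all_analysis.
From mathcomp Require summability.

Set Implicit Arguments.
Unset Strict Implicit.
Unset Printing Implicit Defensive.

Import Order.TTheory GRing.Theory Num.Theory.
Import numFieldNormedType.Exports.

Local Open Scope classical_set_scope.
Local Open Scope complex_scope.
Local Open Scope ring_scope.

(* The Borel sigma-algebra O(X). *)
Notation borel X := (g_sigma_algebraType (@open X)).

Section Operators.
Context {R : realType} {H : completeNormedModType R[i]}.
Implicit Types (A B T : H -> H) (dot : {dot H for (@Num.conj R[i])}).

Definition separable := exists2 S : set H, countable S & dense S.

(* A completeNormedModType R[i] is a Hilbert space when its norm comes from an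
   inner product; [dot] is linear in its first argument. *)
Definition hilbert_dot dot := forall x : H, `|x| ^+ 2 = dot x x.

Definition orthonormal_basis dot (I : countType) (e : I -> H) :=
  (forall i j, dot (e i) (e j) = (i == j)%:R) /\
  (forall x, summability.partial_sum (fun i => dot x (e i) *: e i)
               @ summability.totally --> x).

(* B(H), as a set of functions; the product is [\o]. *)
Definition bounded_op A :=
  linear A /\ exists M : R, forall x, `|A x| <= M%:C * `|x|.

Definition opnorm A : R :=
  inf [set M : R | 0 <= M /\ forall x, `|A x| <= M%:C * `|x|].

(* The order of R[i] makes [0 <= z] say that z is real and nonnegative. *)
Definition positive_op dot A :=
  bounded_op A /\ forall x, 0 <= dot (A x) x.

(* The adjoint, and the positive square root of a positive operator: in both
   cases the element of the set is unique, and it exists for every bounded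
   (resp. positive) A. *)
Definition adjoint dot A : H -> H :=
  xget (cst 0)
    [set B | bounded_op B /\ forall x y, dot (A x) y = dot x (B y)].

Definition sqrt_op dot A : H -> H :=
  xget (cst 0) [set B | positive_op dot B /\ B \o B = A].

Definition abs_op dot A := sqrt_op dot (adjoint dot A \o A).

Definition poly_op (q : {poly R}) A : H -> H :=
  fun x => \sum_(k < size q) (q`_k)%:C *: iter k A x.

(* A^r for a positive A and r > 0, by continuous functional calculus: the norm
   limit of q_n(A), where the polynomials q_n tend to t |-> t^r uniformly on
   [0, ||A||], an interval that contains the spectrum of A. The limit does not
   depend on (q_n). *)
Definition power_op A (r : R) : H -> H :=
  xget (cst 0)
    [set B | bounded_op B /\ exists q : nat -> {poly R},
       {uniform `[0, opnorm A],
          (fun n (t : R) => (q n).[t]) @ \oo --> (fun t : R => t `^ r)} /\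
       opnorm (poly_op (q n) A \- B) @[n --> \oo] --> (0 : R)].

Section Trace.
Variables (dot : {dot H for (@Num.conj R[i])}) (I : countType) (e : I -> H).

Definition has_trace T (t : R[i]) :=
  summability.partial_sum (fun i => dot (T (e i)) (e i) : R[i]^o)
    @ summability.totally --> (t : R[i]^o).

(* Meaningful for trace-class T, for which the sum over the orthonormal basis e
   converges unconditionally and does not depend on e. *)
Definition trace T : R[i] :=
  summability.sum (fun i => dot (T (e i)) (e i) : R[i]^o).

(* The trace of a positive T, in [0, +oo]. *)
Definition pos_trace T : \bar R :=
  \esum_(i in [set: I]) (complex.Re (dot (T (e i)) (e i)))%:E.

Definition schatten (p : R) T : \bar R :=
  ((pos_trace (power_op (abs_op dot T) p)) `^ p^-1)%E.

Definition state : set (H -> H) :=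
  [set s | positive_op dot s /\ has_trace s 1].

Definition ultraweak_cvg (A : nat -> H -> H) (B : H -> H) :=
  forall s, state s ->
    (trace (s \o A n) : R[i]^o) @[n --> \oo] --> (trace (s \o B) : R[i]^o).

Definition full_rank A := forall x, A x = 0 -> x = 0.

Context {X : ptopologicalType}.

Definition povm (nu : set (borel X) -> H -> H) :=
  (forall E, measurable E -> positive_op dot (nu E)) /\
  (forall F : nat -> set (borel X),
     (forall k, measurable (F k)) -> trivIset [set: nat] F ->
     ultraweak_cvg (fun n => \sum_(k < n) nu (F k)) (nu (\bigcup_k F k))).

(* mu is nu_rho; the trace of rho nu(E) is real. *)
Definition induced_measure (nu : set (borel X) -> H -> H) (rho : H -> H)
    (mu : {measure set (borel X) -> \bar R}) :=
  forall E, measurable E -> mu E = (complex.Re (trace (rho \o nu E)))%:E.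

(* h is the Radon-Nikodym derivative, with respect to mu, of the complex
   measure lambda. *)
Definition complex_RN_derivative (lambda : set (borel X) -> R[i])
    (mu : {measure set (borel X) -> \bar R}) (h : borel X -> R[i]) :=
  [/\ mu.-integrable [set: borel X] (EFin \o (fun x => complex.Re (h x))),
      mu.-integrable [set: borel X] (EFin \o (fun x => complex.Im (h x))) &
      forall E, measurable E ->
        lambda E = (\int[mu]_(x in E) complex.Re (h x))
                     +i* (\int[mu]_(x in E) complex.Im (h x))].

(* D is d nu / d mu: entry (i, j) of the matrix of D x in the basis e is
   <D x e_j, e_i>. *)
Definition op_RN_derivative (nu : set (borel X) -> H -> H)
    (mu : {measure set (borel X) -> \bar R}) (D : borel X -> H -> H) :=
  (forall i j, complex_RN_derivative (fun E => dot (nu E (e j)) (e i)) mu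
                 (fun x => dot (D x (e j)) (e i))) /\
  {ae mu, forall x, bounded_op (D x)}.

Definition quantum_rv (f : borel X -> H -> H) :=
  (forall x, bounded_op (f x)) /\
  (forall s, state s ->
     measurable_fun [set: borel X] (fun x => complex.Re (trace (s \o f x))) /\
     measurable_fun [set: borel X] (fun x => complex.Im (trace (s \o f x)))).

Definition positive_quantum_rv (f : borel X -> H -> H) :=
  quantum_rv f /\ forall x, positive_op dot (f x).

(* L_H(X, nu), the complex linear span of the positive quantum random
   variables. *)
Definition LH (f : borel X -> H -> H) :=
  exists (n : nat) (c : 'I_n -> R[i]) (h : 'I_n -> borel X -> H -> H),
    (forall k, positive_quantum_rv (h k)) /\
    (forall x v, f x v = \sum_(k < n) c k *: h k x v).

Definition SL_norm (mu : {measure set (borel X) -> \bar R})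
    (D : borel X -> H -> H) (p q : R) (f : borel X -> H -> H) : \bar R :=
  ereal_sup
    [set 'N[mu]_(q%:E)[(fun x =>
            schatten p (sqrt_op dot s \o sqrt_op dot (D x) \o f x
                          \o sqrt_op dot (D x) \o sqrt_op dot s))]%E
       | s in state].

End Trace.

End Operators.

Arguments separable {R} H.

(* Main.v *)
(* Fix a state [s] and put [W(k) = s^{1/2} D^{1/2} k D^{1/2} s^{1/2}]. The operator in the
   statement is [W(f) W(g)], so everything follows from the Hoelder inequality for Schatten
   norms at each point, Hoelder's inequality for [mu], and the measurability of the two
   Schatten norms. Both [W(f)] and [W(g)] are of trace class, being sandwiched between two
   copies of the Hilbert-Schmidt operator [s^{1/2}].

   The Schatten inequality is proved without any spectral theorem. The continuous functional
   calculus of a positive operator is obtained from polynomials, because a polynomial that is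
   nonnegative on [[0, M]] is nonnegative at [A] when [0 <= A <= M]. The heart is the bound
     Tr (S Z T Z^* ) <= l^p / p Tr S^p + l^{-q} / q Tr T^q          (Z a contraction)
   for positive [S] and [T]: the Bernstein polynomials [beta_j] of [T] are positive, have sum
   [1], and satisfy [T = sum_j b_j beta_j(T)] at the nodes [b_j], so that the scalar Young
   inequality [b_j t <= (l t)^p / p + (b_j / l)^q / q], applied to [S] for each fixed [j], gives
   the bound with [sum_j b_j^q beta_j(T)], which tends to [T^q]. Polar decompositions
   [A ~ V |A|], [B ~ W |B|] and the cyclicity of the trace reduce [Tr |A B|] to it, and one
   optimises over [l]. *)
Require Import Defs.
From HB Require Import structures.
From mathcomp Require Import all_boot all_order all_algebra.
From mathcomp Require Import finmap sesquilinear complex.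
From mathcomp Require Import all_classical all_reals all_analysis.
From mathcomp Require Import measurable_realfun.
From mathcomp Require Import ring lra.
From mathcomp Require summability.
Set Implicit Arguments.
Unset Strict Implicit.
Unset Printing Implicit Defensive.
Import Order.TTheory GRing.Theory Num.Theory.
Import numFieldNormedType.Exports.
Local Open Scope classical_set_scope.
Local Open Scope complex_scope.
Local Open Scope ring_scope.

(** The obstacle is convergence: the trace of a non-positive operator is a series that need not
    converge, so its terms cannot be rearranged freely. Cyclicity is therefore always derived from
    the invariance of the Hilbert-Schmidt norm under adjunction, an identity in [[0, +oo]] that
    exchanges two nonnegative sums. Traces of positive operators are bounded through their partial
    sums over a finite set of basis vectors; this also makes approximate polar decompositions
    harmless, since an error [d] per vector is only multiplied by a finite number.

    [sqrt_op], [adjoint] and [power_op] are defined by choice, so each is first pinned down by a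
    testable property: closeness to polynomials for roots and powers, an explicitly given second
    operator for adjoints. As the approximating polynomials can be taken independent of the point of
    [X], the same property shows that roots and powers of a measurable field of positive operators
    are measurable. Where the density is not positive or not bounded it is replaced by [0], and
    norms are compared off a null set, so that measurability of the original integrands is never
    asked for. *)

(** * The real inner product [Re <x, y>] and its norm *)

Section RealInnerProduct.
Context {R : realType} {H : completeNormedModType R[i]}.
Variable dot : {dot H for (@Num.conj R[i])}.

(** Inequalities take place in [R]. Nothing is lost: [Im <x, y> = Re <x, i y>], so the real form
    determines [dot]. *)
Definition rdot (x y : H) : R := complex.Re (dot x y).

Lemma dotC x y : dot x y = (dot y x)^*.
Proof. by rewrite hermC /= expr0 mul1r. Qed.

Lemma ReD (a b : R[i]) : complex.Re (a + b) = complex.Re a + complex.Re b.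
Proof. by case: a b => ? ? [? ?]. Qed.

Lemma ImD (a b : R[i]) : complex.Im (a + b) = complex.Im a + complex.Im b.
Proof. by case: a b => ? ? [? ?]. Qed.

Lemma ReN (a : R[i]) : complex.Re (- a) = - complex.Re a.
Proof. by case: a. Qed.

Lemma ImN (a : R[i]) : complex.Im (- a) = - complex.Im a.
Proof. by case: a. Qed.

Lemma ReM (a b : R[i]) : complex.Re (a * b) =
  complex.Re a * complex.Re b - complex.Im a * complex.Im b.
Proof. by case: a b => ? ? [? ?]. Qed.

Lemma ImM (a b : R[i]) : complex.Im (a * b) =
  complex.Re a * complex.Im b + complex.Im a * complex.Re b.
Proof. by case: a b => ? ? [? ?]. Qed.

Lemma complex_ext (a b : R[i]) :
  complex.Re a = complex.Re b -> complex.Im a = complex.Im b -> a = b.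
Proof. by case: a b => ? ? [? ?] /= -> ->. Qed.

Lemma rdotC x y : rdot x y = rdot y x.
Proof. by rewrite /rdot dotC; case: (dot y x). Qed.

Lemma rdotDl x y z : rdot (x + y) z = rdot x z + rdot y z.
Proof. by rewrite /rdot linearDl ReD. Qed.

Lemma rdotDr x y z : rdot x (y + z) = rdot x y + rdot x z.
Proof. by rewrite rdotC rdotDl !(rdotC x). Qed.

Lemma rdotNl x y : rdot (- x) y = - rdot x y.
Proof. by rewrite /rdot linearNl ReN. Qed.

Lemma rdotNr x y : rdot x (- y) = - rdot x y.
Proof. by rewrite rdotC rdotNl rdotC. Qed.

Lemma rdotBl x y z : rdot (x - y) z = rdot x z - rdot y z.
Proof. by rewrite rdotDl rdotNl. Qed.

Lemma rdotBr x y z : rdot x (y - z) = rdot x y - rdot x z.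
Proof. by rewrite rdotDr rdotNr. Qed.

Lemma rdotZl (c : R) x y : rdot (c%:C *: x) y = c * rdot x y.
Proof. by rewrite /rdot linearZl_LR ReM /= mul0r subr0. Qed.

Lemma rdotZr (c : R) x y : rdot x (c%:C *: y) = c * rdot x y.
Proof. by rewrite rdotC rdotZl rdotC. Qed.

Lemma rdot0l x : rdot 0 x = 0.
Proof. by rewrite /rdot linear0l. Qed.

Lemma rdot0r x : rdot x 0 = 0.
Proof. by rewrite rdotC rdot0l. Qed.

Lemma rdot_suml (J : Type) (r : seq J) (P : pred J) (F : J -> H) y :
  rdot (\sum_(j <- r | P j) F j) y = \sum_(j <- r | P j) rdot (F j) y.
Proof.
by apply: (big_morph (fun x => rdot x y)) => [a b|]; rewrite ?rdotDl ?rdot0l.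
Qed.

Lemma rdot_sumr (J : Type) (r : seq J) (P : pred J) (F : J -> H) y :
  rdot y (\sum_(j <- r | P j) F j) = \sum_(j <- r | P j) rdot y (F j).
Proof. by rewrite rdotC rdot_suml; apply: eq_bigr => j _; rewrite rdotC. Qed.

Lemma dotxxE x : dot x x = (rdot x x)%:C.
Proof.
have := dnorm_ge0 dot x; rewrite /rdot; case: (dot x x) => a b /=.
by rewrite lecE /= => /andP[/eqP -> _].
Qed.

Lemma Im_dot x y : complex.Im (dot x y) = rdot x ('i%C *: y).
Proof.
by rewrite /rdot linearZr_LR/= ReM /=; ring.
Qed.

Lemma dot_rdotE x y : dot x y = rdot x y +i* rdot x ('i%C *: y).
Proof. by apply: complex_ext => //=; rewrite Im_dot. Qed.

Definition nsq x := rdot x x.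

Lemma nsq_ge0 x : 0 <= nsq x.
Proof. by rewrite /nsq -ler0c -dotxxE dnorm_ge0. Qed.

Lemma nsq_eq0 x : nsq x = 0 -> x = 0.
Proof.
by move=> x0; apply/eqP; rewrite -(dnorm_eq0 dot) dotxxE; apply/eqP; rewrite -/(nsq x) x0.
Qed.

Lemma nsqD x y : nsq (x + y) = nsq x + nsq y + 2 * rdot x y.
Proof. by rewrite /nsq rdotDl !rdotDr (rdotC y x); ring. Qed.

Lemma nsqB x y : nsq (x - y) = nsq x + nsq y - 2 * rdot x y.
Proof. by rewrite /nsq rdotBl !rdotBr (rdotC y x); ring. Qed.

Lemma nsqN x : nsq (- x) = nsq x.
Proof. by rewrite /nsq rdotNl rdotNr opprK. Qed.

Lemma nsqZ (c : R) x : nsq (c%:C *: x) = c ^+ 2 * nsq x.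
Proof. by rewrite /nsq rdotZl rdotZr mulrA expr2. Qed.

Lemma nsq0 : nsq 0 = 0.
Proof. by rewrite /nsq rdot0l. Qed.

Lemma rdot_young x y : rdot x y <= 2^-1 * (nsq x + nsq y).
Proof. by have := nsq_ge0 (x - y); rewrite nsqB; lra. Qed.

Lemma rdot_CS x y : rdot x y ^+ 2 <= nsq x * nsq y.
Proof.
have [y0|y0] := eqVneq (nsq y) 0.
  by rewrite (nsq_eq0 y0) rdot0r nsq0 mulr0 expr0n.
have yp : 0 < nsq y by rewrite lt_neqAle eq_sym y0 nsq_ge0.
(* This vector is [nsq y] times the component of [x] orthogonal to [y] for the real inner
   product. *)
have := nsq_ge0 ((nsq y)%:C *: x - (rdot x y)%:C *: y).
rewrite nsqB !nsqZ rdotZl rdotZr => h.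
rewrite -(ler_pM2l yp); lra.
Qed.

Definition nrm (x : H) : R := Num.sqrt (nsq x).

Lemma nrm_ge0 x : 0 <= nrm x. Proof. exact: sqrtr_ge0. Qed.

Lemma nrm_sq x : nrm x ^+ 2 = nsq x.
Proof. by rewrite sqr_sqrtr ?nsq_ge0. Qed.

Lemma rdot_le x y : `|rdot x y| <= nrm x * nrm y.
Proof.
rewrite -(@ler_pXn2r _ 2)// ?nnegrE ?mulr_ge0 ?nrm_ge0//.
by rewrite real_normK ?num_real// exprMn !nrm_sq rdot_CS.
Qed.

Lemma nrm_le_sq x y (c : R) : 0 <= c -> nsq x <= c ^+ 2 * nsq y ->
  nrm x <= c * nrm y.
Proof.
move=> c0 h; rewrite -(@ler_pXn2r _ 2)// ?nnegrE ?mulr_ge0 ?nrm_ge0//.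
by rewrite exprMn !nrm_sq.
Qed.

Lemma nsq_le_nrm x y (c : R) : nrm x <= c * nrm y -> nsq x <= c ^+ 2 * nsq y.
Proof.
move=> h; rewrite -!nrm_sq -exprMn; apply: lerXn2r => //; rewrite nnegrE ?nrm_ge0//.
by rewrite (le_trans _ h)// nrm_ge0.
Qed.

Lemma nrmD x y : nrm (x + y) <= nrm x + nrm y.
Proof.
rewrite -(@ler_pXn2r _ 2)// ?nnegrE ?addr_ge0 ?nrm_ge0//.
rewrite sqrrD !nrm_sq nsqD.
have := ler_norm (rdot x y); have := rdot_le x y; lra.
Qed.

Lemma nrmN x : nrm (- x) = nrm x.
Proof. by rewrite /nrm nsqN. Qed.

Lemma nrmBC x y : nrm (x - y) = nrm (y - x).
Proof. by rewrite -nrmN opprB. Qed.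

Lemma nrm_triangle y x z : nrm (x - z) <= nrm (x - y) + nrm (y - z).
Proof. by have := nrmD (x - y) (y - z); rewrite addrA subrK. Qed.

Lemma nrm0 : nrm 0 = 0.
Proof. by rewrite /nrm nsq0 sqrtr0. Qed.

Lemma nrm_eq0 x : nrm x = 0 -> x = 0.
Proof. by move=> h; apply: nsq_eq0; rewrite -nrm_sq h expr0n. Qed.

Lemma nrm_small x : (forall eps, 0 < eps -> nrm x <= eps) -> x = 0.
Proof.
move=> h; apply: nrm_eq0; apply/eqP; rewrite eq_le nrm_ge0 andbT.
by apply/ler_addgt0Pr => eps e0; rewrite add0r h.
Qed.

Lemma rdot_eqr x y : (forall z, rdot z x = rdot z y) -> x = y.
Proof.
move=> h; apply/eqP; rewrite -subr_eq0; apply/eqP/nsq_eq0.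
by rewrite /nsq rdotBr h subrr.
Qed.

Section Hilbert.
Hypothesis hH : hilbert_dot dot.

Lemma normE x : `|x| = (nrm x)%:C.
Proof.
apply/eqP; rewrite -(@eqrXn2 _ 2)// ?normr_ge0 ?ler0c ?nrm_ge0//.
by rewrite hH dotxxE -/(nsq x) -nrm_sq rmorphXn.
Qed.

End Hilbert.
End RealInnerProduct.

(** * Polynomials in a self-adjoint operator and their positivity *)

Section PolynomialCalculus.
Context {R : realType} {H : completeNormedModType R[i]}.
Variable dot : {dot H for (@Num.conj R[i])}.
Local Notation "<< x , y >>" := (rdot dot x y).
Local Notation nsq := (nsq dot).
Local Notation nrm := (nrm dot).
Implicit Types (A B C : H -> H) (p q : {poly R}).

Lemma linear_ex A : linear A -> exists L : {linear H -> H}, A = L :> (H -> H).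
Proof.
move=> lA.
pose L := HB.pack_for {linear H -> H} A (GRing.isLinear.Build _ _ _ _ A lA).
by exists L.
Qed.

Section LinearFacts.
Variable A : H -> H.
Hypothesis lA : linear A.

Lemma lin0 : A 0 = 0.
Proof. by have [L ->] := linear_ex lA; rewrite linear0. Qed.

Lemma linD x y : A (x + y) = A x + A y.
Proof. by have [L ->] := linear_ex lA; rewrite linearD. Qed.

Lemma linB x y : A (x - y) = A x - A y.
Proof. by have [L ->] := linear_ex lA; rewrite linearB. Qed.

Lemma linZ c x : A (c *: x) = c *: A x.
Proof. by have [L ->] := linear_ex lA; rewrite linearZ. Qed.

Lemma lin_sum (J : Type) (r : seq J) (P : pred J) (F : J -> H) :
  A (\sum_(j <- r | P j) F j) = \sum_(j <- r | P j) A (F j).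
Proof. by have [L ->] := linear_ex lA; rewrite linear_sum. Qed.

End LinearFacts.

Lemma lin_comp A B : linear A -> linear B -> linear (A \o B).
Proof. by move=> lA lB a u v /=; rewrite lB lA. Qed.

(** Adjointness as a relation: adjoints are always exhibited, so none has to be constructed
    abstractly. Real parts suffice, since [adj_dot] recovers the complex relation when [B] is
    bounded. *)
Definition adj A B := forall x y, << A x, y >> = << x, B y >>.

Lemma adjC A B : adj A B -> adj B A.
Proof. by move=> h x y; rewrite rdotC -h rdotC. Qed.

Lemma adj_comp A A' B B' : adj A A' -> adj B B' -> adj (A \o B) (B' \o A').
Proof. by move=> hA hB x y /=; rewrite hA hB. Qed.

Lemma adj_uniq A B C : adj A B -> adj A C -> B = C.
Proof. by move=> hB hC; apply/funext => y; apply: (rdot_eqr (dot := dot)) => z; rewrite -hB hC. Qed.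

Section PolyOp.
Variable A : H -> H.
Hypothesis lA : linear A.

Lemma poly_opE n q x : (size q <= n)%N ->
  poly_op q A x = \sum_(k < n) (q`_k)%:C *: iter k A x.
Proof.
move=> sn; rewrite /poly_op (big_ord_widen n (fun k => (q`_k)%:C *: iter k A x))//.
rewrite big_mkcond; apply: eq_bigr => k _.
by case: ltnP => // h; rewrite nth_default// scale0r.
Qed.

Lemma poly_opD p q x : poly_op (p + q) A x = poly_op p A x + poly_op q A x.
Proof.
pose n := maxn (size p) (size q).
rewrite (@poly_opE n) ?size_polyD// (@poly_opE n p) ?leq_maxl//.
rewrite (@poly_opE n q) ?leq_maxr// -big_split/=; apply: eq_bigr => k _.
by rewrite coefD rmorphD scalerDl.
Qed.

Lemma poly_opZ c q x : poly_op (c *: q) A x = c%:C *: poly_op q A x.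
Proof.
rewrite (@poly_opE (size q)) ?size_scale_leq// scaler_sumr; apply: eq_bigr => k _.
by rewrite coefZ rmorphM scalerA.
Qed.

Lemma poly_opN q x : poly_op (- q) A x = - poly_op q A x.
Proof. by rewrite -scaleN1r poly_opZ rmorphN1 scaleN1r. Qed.

Lemma poly_opB p q x : poly_op (p - q) A x = poly_op p A x - poly_op q A x.
Proof. by rewrite poly_opD poly_opN. Qed.

Lemma poly_op0 x : poly_op 0 A x = 0.
Proof. by rewrite /poly_op size_poly0 big_ord0. Qed.

Lemma poly_opC c x : poly_op c%:P A x = c%:C *: x.
Proof. by rewrite (@poly_opE 1) ?size_polyC_leq1// big_ord1 coefC. Qed.

Lemma poly_op1 x : poly_op 1 A x = x.
Proof. by rewrite poly_opC rmorph1 scale1r. Qed.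

Lemma poly_opMX q x : poly_op (q * 'X) A x = A (poly_op q A x).
Proof.
rewrite (@poly_opE (size q).+1); last first.
  by rewrite (leq_trans (size_polyMleq _ _))// size_polyX addn2.
rewrite big_ord_recl coefMX eqxx/= scale0r add0r /poly_op lin_sum//.
by apply: eq_bigr => k _; rewrite coefMX /= linZ.
Qed.

Lemma poly_opX x : poly_op 'X A x = A x.
Proof. by rewrite -(mul1r 'X) poly_opMX poly_op1. Qed.

Lemma poly_opM p q x : poly_op (p * q) A x = poly_op p A (poly_op q A x).
Proof.
elim/poly_ind: p => [|p c IH]; first by rewrite mul0r !poly_op0.
rewrite mulrDl -mulrA (mulrC 'X) mulrA !poly_opD !poly_opMX IH.
by rewrite mul_polyC poly_opZ poly_opC.
Qed.

Lemma lin_poly_op q : linear (poly_op q A).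
Proof.
move=> a u v; elim/poly_ind: q => [|p c IH].
  by rewrite !poly_op0 scaler0 addr0.
rewrite !poly_opD !poly_opMX IH !poly_opC lA !scalerDr !scalerA (mulrC c%:C).
by rewrite addrACA.
Qed.

Lemma poly_op_sum (J : Type) (r : seq J) (P : pred J) (F : J -> {poly R}) x :
  poly_op (\sum_(j <- r | P j) F j) A x = \sum_(j <- r | P j) poly_op (F j) A x.
Proof.
by apply: (big_morph (fun q => poly_op q A x)) => [a b|]; rewrite ?poly_opD ?poly_op0.
Qed.

Lemma adj_poly_op q : adj A A -> adj (poly_op q A) (poly_op q A).
Proof.
move=> sA; elim/poly_ind: q => [|p c IH] x y.
  by rewrite !poly_op0 rdot0l rdot0r.
rewrite !poly_opD !poly_opMX !poly_opC rdotDl rdotDr rdotZl rdotZr; congr (_ + _).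
by rewrite -poly_opMX poly_opM poly_opX IH sA.
Qed.

End PolyOp.

Lemma poly_op_comp p q A x : linear A ->
  poly_op (p \Po q) A x = poly_op p (poly_op q A) x.
Proof.
move=> lA; elim/poly_ind: p => [|p c IH]; first by rewrite comp_poly0 !poly_op0.
rewrite comp_polyD comp_polyM comp_polyX comp_polyC !poly_opD !poly_opC.
rewrite poly_opMX; last exact: lin_poly_op.
by rewrite mulrC poly_opM// IH.
Qed.

(** Dividing a nonnegative polynomial by a linear factor loses the sign at the root itself;
    continuity restores it. *)
Lemma poly_edge_ge0 (q : {poly R}) (a b : R) : a < b ->
  (forall t, a < t -> t < b -> 0 <= q.[t]) -> 0 <= q.[a] /\ 0 <= q.[b].
Proof.
move=> ab q0.
have near_neg s : q.[s] < 0 -> exists2 d, 0 < d & forall t, `|s - t| < d -> q.[t] < 0.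
  move=> s0; have /cvgrPdist_lt cq := @continuous_horner _ q s.
  have e0 : 0 < - q.[s] by rewrite oppr_gt0.
  have /nbhs_ballP[d /= d0 hd] := cq _ e0.
  exists d => // t st; have := hd t st; rewrite /= ltr_norml => /andP[]; lra.
split; rewrite leNgt; apply/negP => /near_neg[d d0 hd].
- pose t := Num.min ((a + b) / 2) (a + d / 2).
  have ta : a < t by rewrite /t lt_min; apply/andP; split; lra.
  have tb : t < b by rewrite /t gt_min; apply/orP; left; lra.
  have td : t <= a + d / 2 by rewrite /t ge_min lexx orbT.
  have := q0 t ta tb; rewrite leNgt hd// ler0_norm; lra.
- pose t := Num.max ((a + b) / 2) (b - d / 2).
  have ta : t < b by rewrite /t gt_max; apply/andP; split; lra.
  have tb : a < t by rewrite /t lt_max; apply/orP; left; lra.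
  have td : b - d / 2 <= t by rewrite /t le_max lexx orbT.
  have := q0 t tb ta; rewrite leNgt hd// ger0_norm; lra.
Qed.

Section Positivity.
Variables (A : H -> H) (M : R).
Hypotheses (lA : linear A) (sA : adj A A).
Hypotheses (A0 : forall x, 0 <= << A x, x >>) (AM : forall x, << A x, x >> <= M * nsq x).

Let pos q := forall x, 0 <= << poly_op q A x, x >>.

Let pos_sq p q : pos q -> pos (p * p * q).
Proof.
move=> h x; have -> : p * p * q = p * (q * p) by ring.
by rewrite !poly_opM// adj_poly_op.
Qed.

Let posD p q : pos p -> pos q -> pos (p + q).
Proof. by move=> hp hq x; rewrite poly_opD rdotDl addr_ge0 ?hp ?hq. Qed.

Let posZ c q : 0 <= c -> pos q -> pos (c *: q).
Proof. by move=> c0 hq x; rewrite poly_opZ rdotZl mulr_ge0 ?hq. Qed.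

Let Y := (M%:P - 'X : {poly R}).

(** Positivity of [q(A)] alone is not visibly stable under multiplication by ['X] or [Y]. Positivity
    of these four products together is: another factor ['X] or [Y] only creates products already in
    the list, or a square times one of them. *)
Let cone q := [/\ pos q, pos ('X * q), pos (Y * q) & pos ('X * Y * q)].

Let coneD p q : cone p -> cone q -> cone (p + q).
Proof.
move=> [p1 p2 p3 p4] [q1 q2 q3 q4]; split; rewrite ?(mulrDr _ p q);
  exact: posD.
Qed.

Let coneX q : cone q -> cone ('X * q).
Proof.
move=> [q1 q2 q3 q4]; split=> //.
- by rewrite mulrA; apply: pos_sq.
- by rewrite mulrA (mulrC Y).
- have -> : 'X * Y * ('X * q) = 'X * 'X * (Y * q) by ring.
  exact: pos_sq.
Qed.

Let coneY q : cone q -> cone (Y * q).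
Proof.
move=> [q1 q2 q3 q4]; split=> //.
- by rewrite mulrA.
- by rewrite mulrA; apply: pos_sq.
- have -> : 'X * Y * (Y * q) = Y * Y * ('X * q) by ring.
  exact: pos_sq.
Qed.

Let cone_sq p q : cone q -> cone (p * p * q).
Proof.
move=> [q1 q2 q3 q4]; split.
- exact: pos_sq.
- by rewrite mulrCA; apply: pos_sq.
- by rewrite mulrCA; apply: pos_sq.
- by rewrite mulrCA; apply: pos_sq.
Qed.

Let cone_const c : 0 < M -> 0 <= c -> cone c%:P.
Proof.
move=> M0 c0.
have p1 : pos 1 by move=> x; rewrite poly_op1 nsq_ge0.
have pX : pos 'X by move=> x; rewrite poly_opX.
have pY : pos Y.
  by move=> x; rewrite poly_opB poly_opC poly_opX// rdotBl rdotZl subr_ge0.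
have pXY : pos ('X * Y).
  (* Since ['X + Y = M], the product of the two positive elements is a combination of squares times
     ['X] and [Y]. *)
  have -> : 'X * Y = M^-1 *: (Y * Y * 'X + 'X * 'X * Y).
    apply: (scalerI (lt0r_neq0 M0)).
    rewrite scalerA divff ?lt0r_neq0// scale1r -!mul_polyC /Y; ring.
  by apply: posZ; [rewrite invr_ge0 ltW|apply: posD; apply: pos_sq].
split; rewrite -?(mulrC c%:P) ?mul_polyC; do ?exact: posZ.
by rewrite -alg_polyC; apply: posZ.
Qed.

(** Induction on the degree. Minus its minimum over [[0, M]], [q] vanishes at a minimiser, which
    contributes a factor ['X] at [0], a factor [Y] at [M], and a square in the interior; the
    cofactor is again nonnegative on [[0, M]]. *)
Let cone_nonneg n q : 0 < M -> (size q <= n)%N ->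
  (forall t, 0 <= t -> t <= M -> 0 <= q.[t]) -> cone q.
Proof.
move=> M0; elim: n q => [|n IH] q sq q0.
  move: sq; rewrite leqn0 size_poly_eq0 => /eqP ->.
  by rewrite -polyC0; apply: cone_const.
have cq : {within `[0, M], continuous (horner q)}.
  by apply: continuous_subspaceT => x; exact: continuous_horner.
have [t0] := EVT_min (ltW M0) cq.
rewrite in_itv/= => /andP[t00 t0M] qmin.
have rt : root (q - q.[t0]%:P) t0 by rewrite rootE !hornerE subrr.
have [h hE] := factor_theorem _ _ rt.
have qE : q = q.[t0]%:P + h * ('X - t0%:P) by rewrite -hE addrC subrK.
rewrite qE; apply: coneD; first by apply: cone_const => //; apply: q0.
have hge t : 0 <= t -> t <= M -> 0 <= h.[t] * (t - t0).
  move=> t1 t2; have := qmin t; rewrite in_itv/= t1 t2 => /(_ isT).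
  by rewrite {2}qE !hornerE lerDl.
have [h0|h0] := eqVneq h 0.
  by rewrite h0 mul0r -polyC0; apply: cone_const.
have sh : (size h <= n)%N.
  have h1 : size (h * ('X - t0%:P)) = (size h).+1.
    by rewrite size_Mmonic ?monicXsubC// size_XsubC addn2.
  have h2 : (size (q - q.[t0]%:P)%R <= n.+1)%N.
    rewrite (leq_trans (size_polyD _ _))// geq_max sq size_polyN.
    by rewrite (leq_trans (size_polyC_leq1 _)).
  by move: h2; rewrite hE h1.
have [t0E|t0n0] := eqVneq t0 0.
  rewrite t0E polyC0 subr0 mulrC; apply: coneX; apply: IH => //.
  have hpos t : 0 < t -> t < M -> 0 <= h.[t].
    by move=> t1 t2; have := hge t (ltW t1) (ltW t2); rewrite t0E subr0 pmulr_lge0.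
  have [e1 e2] := poly_edge_ge0 M0 hpos.
  move=> t; rewrite le_eqVlt => /predU1P[<-//|t1].
  by rewrite le_eqVlt => /predU1P[->//|]; exact: hpos.
have [t0E|t0nM] := eqVneq t0 M.
  have -> : h * ('X - t0%:P) = Y * (- h) by rewrite t0E /Y; ring.
  apply: coneY; apply: IH; first by rewrite size_polyN.
  have hpos t : 0 < t -> t < M -> 0 <= (- h).[t].
    move=> t1 t2; have := hge t (ltW t1) (ltW t2).
    by rewrite t0E hornerN -mulrNN pmulr_lge0// opprB subr_gt0.
  have [e1 e2] := poly_edge_ge0 M0 hpos.
  move=> t; rewrite le_eqVlt => /predU1P[<-//|t1].
  by rewrite le_eqVlt => /predU1P[->//|]; exact: hpos.
have t0pos : 0 < t0 by rewrite lt_neqAle eq_sym t0n0.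
have t0ltM : t0 < M by rewrite lt_neqAle t0nM.
(* [h] is nonpositive to the left of [t0] and nonnegative to the right, so [t0] is a double root of
   [q - q.[t0]]. *)
have rh : root h t0.
  rewrite rootE eq_le; apply/andP; split.
    have hn t : 0 < t -> t < t0 -> 0 <= (- h).[t].
      move=> t1 t2; have := hge t (ltW t1) (ltW (lt_trans t2 t0ltM)).
      by rewrite hornerN -mulrNN pmulr_lge0// opprB subr_gt0.
    by have [_] := poly_edge_ge0 t0pos hn; rewrite hornerN oppr_ge0.
  have hn t : t0 < t -> t < M -> 0 <= h.[t].
    move=> t1 t2; have := hge t (ltW (lt_trans t0pos t1)) (ltW t2).
    by rewrite pmulr_lge0// subr_gt0.
  by have [] := poly_edge_ge0 t0ltM hn.
have [k kE] := factor_theorem _ _ rh.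
have -> : h * ('X - t0%:P) = ('X - t0%:P) * ('X - t0%:P) * k by rewrite kE; ring.
apply: cone_sq; apply: IH.
  apply: leq_trans sh; have [->|k0] := eqVneq k 0; first by rewrite size_poly0.
  by rewrite kE size_Mmonic ?monicXsubC// size_XsubC addn2/= leqnSn.
have kpos t : 0 <= t -> t <= M -> t != t0 -> 0 <= k.[t].
  move=> t1 t2 tn; have := hge t t1 t2; rewrite kE !hornerE -mulrA -expr2.
  by rewrite pmulr_lge0// lt_neqAle sqr_ge0 eq_sym sqrf_eq0 subr_eq0 tn.
move=> t t1 t2; have [->|tn] := eqVneq t t0; last exact: kpos.
have [|] := @poly_edge_ge0 k t0 M t0ltM => // s s1 s2.
by apply: kpos; rewrite ?gt_eqF ?ltW// (lt_trans t0pos).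
Qed.

Theorem poly_op_ge0 q : 0 <= M ->
  (forall t, 0 <= t -> t <= M -> 0 <= q.[t]) ->
  forall x, 0 <= << poly_op q A x, x >>.
Proof.
rewrite le_eqVlt => /predU1P[M0|M0] q0; last first.
  by have [] := @cone_nonneg (size q) q M0 (leqnn _) q0.
(* When [M = 0] the quadratic form of [A] vanishes; at [x + A x] this says [nsq (A x) = 0]. *)
have AA0 x : A x = 0.
  have A1 y : << A y, y >> = 0.
    by apply/eqP; rewrite eq_le A0 andbT (le_trans (AM y))// -M0 mul0r.
  apply: (nsq_eq0 (dot := dot)).
  have := A1 (x + A x); rewrite linD// rdotDl !rdotDr !A1 (sA (A x)) -/(nsq _) -/(nsq _).
  by rewrite /nsq; lra.
move=> x; have [r ->] : exists r, q = r * 'X + q.[0]%:P.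
  have [|r rE] := factor_theorem (q - q.[0]%:P) 0 _.
    by rewrite rootE !hornerE subrr.
  by exists r; rewrite -(subr0 'X) -polyC0 -rE subrK.
rewrite poly_opD poly_opMX// AA0 add0r poly_opC rdotZl mulr_ge0 ?nsq_ge0//.
by apply: q0; rewrite -?M0.
Qed.

Lemma poly_op_le p q : 0 <= M ->
  (forall t, 0 <= t -> t <= M -> p.[t] <= q.[t]) ->
  forall x, << poly_op p A x, x >> <= << poly_op q A x, x >>.
Proof.
move=> M0 pq x; rewrite -subr_ge0 -rdotBl -poly_opB; apply: poly_op_ge0 => // t t1 t2.
by rewrite !hornerE subr_ge0 pq.
Qed.

(** By self-adjointness [nsq (q(A) x) = <q(A)^2 x, x>], and [q^2 <= c^2] on [[0, M]]. *)
Lemma poly_op_bound q c : 0 <= M -> 0 <= c ->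
  (forall t, 0 <= t -> t <= M -> `|q.[t]| <= c) ->
  forall x, nrm (poly_op q A x) <= c * nrm x.
Proof.
move=> M0 c0 qc x; apply: nrm_le_sq => //.
rewrite {1}/nsq (adj_poly_op lA q sA) -poly_opM// rdotC.
apply: (@le_trans _ _ << poly_op (c ^+ 2)%:P A x, x >>); last first.
  by rewrite poly_opC rdotZl.
apply: poly_op_le => // t t1 t2; rewrite !hornerE -expr2 -real_normK ?num_real//.
by apply: lerXn2r; rewrite ?nnegrE// qc.
Qed.

End Positivity.
End PolynomialCalculus.

(** * Bernstein polynomials on [[0, M]] and quantitative Weierstrass approximation *)

Section Bernstein.

Section BinomialMoments.
Variables (C : comNzRingType) (u v : C).

(** The ring is general because the identity is used both for polynomials (mean of the nodes) and
    for real numbers (their variance). *)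
Lemma binomial_moment1 n :
  \sum_(l < n.+2) (l * 'C(n.+1, l))%:R * (u ^+ l * v ^+ (n.+1 - l)) =
  n.+1%:R * u * (u + v) ^+ n.
Proof.
rewrite big_ord_recl mul0n mul0r add0r addrC exprDn mulr_sumr.
apply: eq_bigr => i _; rewrite lift0 -mul_bin_diag/= subSS exprS.
by rewrite -mulr_natr natrM; ring.
Qed.

Lemma binomial_moment2 n :
  \sum_(l < n.+3) (l * l.-1 * 'C(n.+2, l))%:R * (u ^+ l * v ^+ (n.+2 - l)) =
  n.+2%:R * n.+1%:R * u ^+ 2 * (u + v) ^+ n.
Proof.
rewrite big_ord_recl mul0n mul0r add0r.
have -> : n.+2%:R * n.+1%:R * u ^+ 2 * (u + v) ^+ n =
  n.+2%:R * u * (n.+1%:R * u * (u + v) ^+ n) by ring.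
rewrite -binomial_moment1 mulr_sumr; apply: eq_bigr => i _.
rewrite lift0 subSS exprS mulnAC -mul_bin_diag/= !natrM.
ring.
Qed.

End BinomialMoments.

Context {R : realType}.
Implicit Types (M t : R) (phi : R -> R).

Definition bern M n l : {poly R} :=
  'C(n, l)%:R * ((M^-1 *: 'X) ^+ l * (1 - M^-1 *: 'X) ^+ (n - l)).

Lemma bernE M n l t : (bern M n l).[t] =
  'C(n, l)%:R * ((M^-1 * t) ^+ l * (1 - M^-1 * t) ^+ (n - l)).
Proof.
by rewrite /bern -polyC_natr !(hornerM, horner_exp, hornerD, hornerN, hornerZ, hornerX, hornerC).
Qed.

Lemma bern_ge0 M n l t : 0 < M -> 0 <= t -> t <= M -> 0 <= (bern M n l).[t].
Proof.
move=> M0 t0 tM; have u0 : 0 <= M^-1 * t by rewrite mulr_ge0 ?invr_ge0 ?(ltW M0).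
have u1 : 0 <= 1 - M^-1 * t by rewrite subr_ge0 mulrC ler_pdivrMr// mul1r.
by rewrite bernE !mulr_ge0 ?exprn_ge0.
Qed.

Lemma sum_bern M n : \sum_(l < n.+1) bern M n l = 1.
Proof.
rewrite (_ : 1 = ((1 - M^-1 *: 'X) + (M^-1 *: 'X)) ^+ n); last first.
  by rewrite subrK expr1n.
rewrite exprDn; apply: eq_bigr => i _.
by rewrite -[RHS]mulr_natl /bern (mulrC ((_ *: _) ^+ _)).
Qed.

Definition bnode M n l : R := M * l%:R / n%:R.

Lemma sum_bern_node M n : 0 < M ->
  \sum_(l < n.+2) bnode M n.+1 l *: bern M n.+1 l = 'X.
Proof.
move=> M0; have := binomial_moment1 (M^-1 *: 'X) (1 - M^-1 *: 'X : {poly R}) n.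
rewrite subrKC expr1n mulr1 => h.
apply: (@scalerI _ _ (n.+1%:R / M)); first by rewrite mulf_neq0 ?invr_eq0 ?gt_eqF.
have -> : (n.+1%:R / M) *: 'X = n.+1%:R * (M^-1 *: 'X) :> {poly R}.
  by rewrite -scalerA scaler_nat mulr_natl.
rewrite -h scaler_sumr; apply: eq_bigr => i _; rewrite scalerA /bnode.
have -> : n.+1%:R / M * (M * i%:R / n.+1%:R) = i%:R :> R.
  have : n.+1%:R != 0 :> R by rewrite pnatr_eq0.
  by move: (n.+1%:R : R) => N N0; field; rewrite N0 gt_eqF.
by rewrite scaler_nat /bern natrM -mulrA [RHS]mulr_natl.
Qed.

(** The variance of the rescaled binomial law; its decay in [n] is the rate of convergence of
    Bernstein polynomials. *)
Lemma sum_bern_var M n t : 0 < M ->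
  \sum_(l < n.+3) (bnode M n.+2 l - t) ^+ 2 * (bern M n.+2 l).[t] =
  t * (M - t) / n.+2%:R.
Proof.
move=> M0; set u := M^-1 * t.
have bE l : (bern M n.+2 l).[t] = 'C(n.+2, l)%:R * (u ^+ l * (1 - u) ^+ (n.+2 - l)).
  exact: bernE.
have m1 := binomial_moment1 u (1 - u) n.+1.
have m2 := binomial_moment2 u (1 - u) n.
have m0 : \sum_(l < n.+3) 'C(n.+2, l)%:R * (u ^+ l * (1 - u) ^+ (n.+2 - l)) = 1.
  transitivity (((1 - u) + u) ^+ n.+2); last by rewrite subrK expr1n.
  by rewrite exprDn; apply: eq_bigr => i _; rewrite -[RHS]mulr_natl (mulrC (u ^+ _)).
rewrite subrKC expr1n mulr1 in m1.
rewrite subrKC expr1n mulr1 in m2.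
pose N : R := n.+2%:R.
have N0 : N != 0 by rewrite pnatr_eq0.
have M1 : M != 0 by rewrite gt_eqF.
pose w (i : 'I_n.+3) := u ^+ i * (1 - u) ^+ (n.+2 - i).
rewrite (eq_bigr (fun i : 'I_n.+3 => M ^+ 2 / N ^+ 2 *
  ((i * i.-1 * 'C(n.+2, i))%:R * w i + (i * 'C(n.+2, i))%:R * w i -
   2 * N * u * ((i * 'C(n.+2, i))%:R * w i) +
   N ^+ 2 * u ^+ 2 * ('C(n.+2, i)%:R * w i)))); last first.
  move=> i _; rewrite bE /bnode -/(w i) -/N.
  have -> : t = M * u by rewrite /u mulrA divff// mul1r.
  rewrite !natrM.
  have -> : i%:R * (i.-1)%:R = i%:R * (i%:R - 1) :> R.
    by case: (i : nat) => [|k]; rewrite ?mul0r// -[k.+1%:R]natr1 addrK.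
  by field.
rewrite -mulr_sumr big_split/= sumrB big_split/= -!mulr_sumr m2 m1 m0.
rewrite /u /N -(natr1 n.+1); field.
by rewrite nat1r natr1 M1 N0.
Qed.

Definition bern_poly M phi n : {poly R} :=
  \sum_(l < n.+1) phi (bnode M n l) *: bern M n l.

(** A modulus of continuity shaped to be averaged against the Bernstein weights: the constant stays
    [eps] and the square becomes the variance. *)
Definition quad_modulus M phi := forall eps, 0 < eps -> exists2 c, 0 <= c &
  forall x y, 0 <= x -> x <= M -> 0 <= y -> y <= M ->
    `|phi x - phi y| <= eps + c * (x - y) ^+ 2.

Lemma bnode_itv M n l : 0 < M -> (l <= n)%N -> 0 <= bnode M n l <= M.
Proof.
move=> M0 ln; rewrite /bnode divr_ge0 ?mulr_ge0 ?(ltW M0)//=.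
case: n ln => [|n] ln; first by rewrite invr0 mulr0 ltW.
by rewrite ler_pdivrMr// ler_pM2l// ler_nat.
Qed.

Lemma bern_poly_approx M phi eps : 0 < M -> quad_modulus M phi -> 0 < eps ->
  exists N, forall n t, (N <= n)%N -> 0 <= t -> t <= M ->
    `|(bern_poly M phi n).[t] - phi t| <= eps.
Proof.
move=> M0 hphi e0; have [|c c0 hc] := hphi (eps / 2); first by rewrite divr_gt0.
(* For [n >= K] the variance term is at most [c M^2 / n <= eps / 2]. *)
pose K := c * M ^+ 2 / (eps / 2).
have K0 : 0 <= K by rewrite divr_ge0 ?mulr_ge0 ?sqr_ge0// ltW// divr_gt0.
exists (Num.Def.truncn K).+2 => n t; case: n => [//|[//|n]] Nn t0 tM.
have Kn : K <= n.+2%:R.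
  rewrite (le_trans (ltW (truncnS_gt K)))// ler_nat.
  exact: leq_trans Nn.
have -> : phi t = \sum_(l < n.+3) phi t * (bern M n.+2 l).[t].
  by rewrite -mulr_sumr -horner_sum sum_bern hornerE mulr1.
rewrite /bern_poly horner_sum -sumrB (le_trans (ler_norm_sum _ _ _))//.
apply: (@le_trans _ _ (\sum_(l < n.+3) (eps / 2 * (bern M n.+2 l).[t] +
   c * ((bnode M n.+2 l - t) ^+ 2 * (bern M n.+2 l).[t])))).
  apply: ler_sum => i _; rewrite hornerE -mulrBl normrM.
  have b0 := bern_ge0 n.+2 i M0 t0 tM.
  have /andP[i0 i1] : 0 <= bnode M n.+2 i <= M by apply: bnode_itv => //; rewrite -ltnS.
  by rewrite (ger0_norm b0) mulrA -mulrDl ler_wpM2r// hc.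
rewrite big_split -!mulr_sumr sum_bern_var// -horner_sum sum_bern hornerE mulr1/=.
have N0 : 0 < n.+2%:R :> R by [].
have : c * (t * (M - t) / n.+2%:R) <= eps / 2.
  rewrite mulrA ler_pdivrMr// (@le_trans _ _ (c * M ^+ 2))//.
    by apply: ler_wpM2l => //; rewrite expr2; apply: ler_pM => //; rewrite ?subr_ge0// gerBl.
  by rewrite [leRHS]mulrC -ler_pdivrMr// divr_gt0.
by move=> h; rewrite [leRHS]splitr lerD2l.
Qed.

Lemma quad_modulus_lipschitz M phi L : 0 <= L ->
  (forall x y, 0 <= x -> x <= M -> 0 <= y -> y <= M -> `|phi x - phi y| <= L * `|x - y|) ->
  quad_modulus M phi.
Proof.
move=> L0 h eps e0; exists (L ^+ 2 / eps); first by rewrite divr_ge0 ?sqr_ge0// ltW.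
move=> x y x0 xM y0 yM; apply: le_trans (h _ _ x0 xM y0 yM) _.
rewrite -(real_normK (num_real (x - y))); set d := `|x - y|.
rewrite -subr_ge0.
have -> : eps + L ^+ 2 / eps * d ^+ 2 - L * d =
  ((L * d - eps / 2) ^+ 2 + 3 / 4 * eps ^+ 2) / eps by field; rewrite gt_eqF.
apply: divr_ge0 (ltW e0); apply: addr_ge0; first exact: sqr_ge0.
by apply: mulr_ge0; rewrite ?sqr_ge0 ?divr_ge0 ?ler0n.
Qed.

(** The root is not Lipschitz at [0], but [d = |sqrt x - sqrt y|] satisfies [d^2 <= |x - y|]. So
    either [d <= eps], or [d <= d^4 / eps^3 <= (x - y)^2 / eps^3]. *)
Lemma quad_modulus_sqrt M : quad_modulus M (@Num.sqrt R).
Proof.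
move=> eps e0; exists (eps ^- 3); first by rewrite invr_ge0 exprn_ge0// ltW.
move=> x y x0 _ y0 _; set d := `|_ - _|.
have d0 : 0 <= d by exact: normr_ge0.
have [de|/ltW ed] := leP d eps.
  by rewrite (le_trans de)// lerDl mulr_ge0 ?sqr_ge0// invr_ge0 exprn_ge0// ltW.
have d4 : d ^+ 4 <= (x - y) ^+ 2.
  have -> : x - y = (Num.sqrt x - Num.sqrt y) * (Num.sqrt x + Num.sqrt y).
    by rewrite -subr_sqr !sqr_sqrtr.
  rewrite exprMn (exprM d 2 2) real_normK ?num_real// expr2.
  apply: ler_wpM2l; first exact: sqr_ge0.
  have := sqrtr_ge0 x; have := sqrtr_ge0 y; move: (Num.sqrt x) (Num.sqrt y) => a b.
  by nra.
rewrite (@le_trans _ _ (eps ^- 3 * d ^+ 4))//; last first.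
  apply: (@le_trans _ _ (eps ^- 3 * (x - y) ^+ 2)); last by rewrite lerDr ltW.
  by apply: ler_wpM2l => //; rewrite invr_ge0 exprn_ge0// ltW.
rewrite mulrC ler_pdivlMr ?exprn_gt0// [d ^+ 4]exprS; apply: ler_wpM2l => //.
by apply: lerXn2r; rewrite ?nnegrE// ltW.
Qed.

(** Convexity of [t^r] without derivatives: this is Young's inequality for [y * x^(r-1)] with
    exponents [r] and [r/(r-1)]. *)
Lemma powR_tangent (r x y : R) : 1 < r -> 0 <= x -> 0 <= y ->
  x `^ r - y `^ r <= r * x `^ (r - 1) * (x - y).
Proof.
move=> r1 x0 y0; have r0 : 0 < r by apply: lt_trans r1.
have rn0 : r != 0 by rewrite gt_eqF.
have r10 : r - 1 != 0 by rewrite subr_eq0 gt_eqF.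
have := @conjugate_powR _ y (x `^ (r - 1)) r (r / (r - 1)) y0 (powR_ge0 _ _) r0.
rewrite divr_gt0 ?subr_gt0// => /(_ isT).
have -> : r^-1 + (r / (r - 1))^-1 = 1 by field; rewrite r10 rn0.
move=> /(_ erefl); rewrite -powRrM.
have -> : (r - 1) * (r / (r - 1)) = r by field.
have xr : x `^ r = x * x `^ (r - 1).
  have [->|xn0] := eqVneq x 0; first by rewrite mul0r powR0.
  by rewrite -{2}(powRr1 x0) -powRD ?xn0 ?implybT// addrC subrK.
move=> h.
have : r * (y * x `^ (r - 1)) <= r * (y `^ r / r + x `^ r / (r / (r - 1))).
  by rewrite ler_pM2l.
have -> : r * (y `^ r / r + x `^ r / (r / (r - 1))) = y `^ r + (r - 1) * x `^ r.
  by field; rewrite r10 rn0.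
rewrite xr; lra.
Qed.

Lemma quad_modulus_powR M r : 1 < r -> quad_modulus M (fun t => t `^ r).
Proof.
move=> r1; have r0 : 0 <= r by rewrite ltW// (lt_trans ltr01).
apply: (@quad_modulus_lipschitz _ _ (r * M `^ (r - 1))).
  by rewrite mulr_ge0 ?powR_ge0.
have key x y : 0 <= x -> x <= M -> 0 <= y -> x `^ r - y `^ r <= r * M `^ (r - 1) * `|x - y|.
  move=> x0 xM y0; apply: le_trans (powR_tangent r1 x0 y0) _.
  apply: (@le_trans _ _ (r * x `^ (r - 1) * `|x - y|)).
    by rewrite ler_wpM2l ?ler_norm// mulr_ge0 ?powR_ge0.
  rewrite ler_wpM2r// ler_wpM2l//.
  by rewrite ge0_ler_powR// ?nnegrE ?subr_ge0 ?(ltW r1)// (le_trans x0).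
move=> x y x0 xM y0 yM; rewrite ler_norml key// andbT lerNl opprB distrC.
exact: key.
Qed.

End Bernstein.

Lemma uniform_cvgP {R : realType} (A : set R) (F : nat -> R -> R) (f : R -> R) :
  {uniform A, F @ \oo --> f} <->
  (forall eps, 0 < eps -> exists N, forall n, (N <= n)%N ->
     forall t, A t -> `|F n t - f t| <= eps).
Proof.
split=> [h eps e0|h].
- have /h [N _ hN] : nbhs (f : {uniform` A -> R}) [set h | forall t, A t -> `|h t - f t| <= eps].
    apply/uniform_nbhs; exists [set xy | ball xy.1 eps xy.2]; split.
      exact: (entourage_ball _ (PosNum e0)).
    by move=> g /= hg t /hg /ltW; rewrite distrC.
  by exists N => n /hN.
- move=> P /= /uniform_nbhs[E [+ EP]].
  rewrite -entourage_ballE => -[eps /= e0 eE].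
  have [|N hN] := h (eps / 2) ; first by rewrite divr_gt0.
  exists N => // n /= /hN hn; apply: EP => t /= /hn ht; apply: eE => /=.
  by rewrite /ball/= distrC (le_lt_trans ht)// ltr_pdivrMr// ltr_pMr// ltr1n.
Qed.

(** * Bounded and positive operators *)

Section BoundedOperators.
Context {R : realType} {H : completeNormedModType R[i]}.
Variable dot : {dot H for (@Num.conj R[i])}.
Hypothesis hH : hilbert_dot dot.
Local Notation "<< x , y >>" := (rdot dot x y).
Local Notation nsq := (nsq dot).
Local Notation nrm := (nrm dot).
Local Notation adj := (adj dot).
Implicit Types (A B C : H -> H) (q : {poly R}) (phi : R -> R).

Lemma seq_cvgP (u : nat -> H) (l : H) : u @ \oo --> l <->
  (forall eps, 0 < eps -> exists N, forall n, (N <= n)%N -> nrm (u n - l) <= eps).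
split=> [/cvgrPdist_le h eps e0|h].
  have [|N _ hN] := h eps%:C; first by rewrite ltcR.
  by exists N => n /hN /=; rewrite (normE hH) lecR nrmBC.
(* A positive element of [R[i]] is real, so [complex.Re eps] can stand for [eps]. *)
apply/cvgrPdist_le => eps; rewrite ltcE => /andP[/= /eqP im0 re0].
have [N hN] := h _ re0; exists N => // n /= /hN.
by rewrite (normE hH) lecE/= im0 eqxx nrmBC.
Qed.
Lemma seq_complete (u : nat -> H) :
  (forall eps, 0 < eps ->
    exists N, forall m n, (N <= m)%N -> (N <= n)%N -> nrm (u m - u n) <= eps) ->
  exists l : H, u @ \oo --> l.
Proof.
move=> h; apply/cvg_ex/cauchy_cvgP/cauchy_ballP => /= eps; rewrite ltcE => /andP[/= /eqP im0 re0].
have [|N hN] := h (complex.Re eps / 2); first by rewrite divr_gt0.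
exists (u @` [set n | (N <= n)%N], u @` [set n | (N <= n)%N]) => /=.
  by split; exists N => // n /= Nn; exists n.
move=> [_ _] [/= [m Nm <-] [n Nn <-]].
rewrite -ball_normE /= (normE hH) ltcE/= im0 eqxx/= (le_lt_trans (hN _ _ Nm Nn))//.
by rewrite ltr_pdivrMr// ltr_pMr// ltr1n.
Qed.

Lemma bounded_opP A : bounded_op A <->
  linear A /\ exists2 M, 0 <= M & forall x, nrm (A x) <= M * nrm x.
Proof.
split=> -[lA]; last first.
  move=> [M M0 AM]; split=> //; exists M => x.
  by rewrite !(normE hH) -rmorphM lecR.
move=> [M AM]; split=> //; exists `|M| => // x.
have := AM x; rewrite !(normE hH) -rmorphM lecR => /le_trans; apply.
by rewrite ler_wpM2r ?nrm_ge0 ?ler_norm.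
Qed.

Lemma lin_bounded A : bounded_op A -> linear A.
Proof. by case. Qed.

Lemma opnorm_spec A : bounded_op A ->
  0 <= opnorm A /\ forall x, nrm (A x) <= opnorm A * nrm x.
Proof.
move=> /bounded_opP[lA [M M0 AM]]; rewrite /opnorm; set S := [set _ | _].
have S0 : S M by split=> // x; rewrite !(normE hH) -rmorphM lecR.
have hi : has_inf S by split; [exists M|exists 0 => y []].
split; first by apply: lb_le_inf; [exists M|move=> y []].
move=> x; have [x0|x0] := eqVneq (nrm x) 0.
  by rewrite x0 mulr0 (nrm_eq0 x0) lin0// nrm0.
have xp : 0 < nrm x by rewrite lt_neqAle eq_sym x0 nrm_ge0.
rewrite -ler_pdivrMr//; apply: lb_le_inf; first by exists M.
move=> y [y0 /(_ x)]; rewrite !(normE hH) -rmorphM lecR => h.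
by rewrite ler_pdivrMr.
Qed.

Lemma opnorm_ge0 A : bounded_op A -> 0 <= opnorm A.
Proof. by case/opnorm_spec. Qed.

Lemma opnorm_bound A x : bounded_op A -> nrm (A x) <= opnorm A * nrm x.
Proof. by case/opnorm_spec. Qed.

Lemma opnorm_le A M : 0 <= M -> (forall x, nrm (A x) <= M * nrm x) -> opnorm A <= M.
Proof.
move=> M0 AM; apply: ge_inf; first by exists 0 => y [].
by split=> // x; rewrite !(normE hH) -rmorphM lecR.
Qed.

Lemma bounded_comp A B : bounded_op A -> bounded_op B -> bounded_op (A \o B).
Proof.
move=> /bounded_opP[lA [M M0 AM]] /bounded_opP[lB [N N0 BN]]; apply/bounded_opP.
split; first exact: lin_comp.
exists (M * N) => [|x]; first exact: mulr_ge0.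
by rewrite /= -mulrA (le_trans (AM _))// ler_wpM2l.
Qed.

Lemma bounded_cst0 : bounded_op (cst 0 : H -> H).
Proof.
apply/bounded_opP; split; first by move=> a u v /=; rewrite scaler0 addr0.
by exists 0 => // x; rewrite nrm0 mul0r.
Qed.

Lemma bounded_id : bounded_op (@idfun H).
Proof. by apply/bounded_opP; split=> //; exists 1 => // x; rewrite mul1r. Qed.

Lemma nrmCZ (c : R[i]) x : nrm (c *: x) = Num.sqrt (complex.Re c ^+ 2 + complex.Im c ^+ 2) * nrm x.
Proof.
by apply: complexI; rewrite -(normE hH) normrZ normc_def (normE hH) rmorphM.
Qed.

Lemma boundedD A B : bounded_op A -> bounded_op B -> bounded_op (A \+ B).
Proof.
move=> /bounded_opP[lA [M M0 AM]] /bounded_opP[lB [N N0 BN]]; apply/bounded_opP.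
split; first by move=> a u v /=; rewrite lA lB scalerDr addrACA.
exists (M + N) => [|x]; first exact: addr_ge0.
by rewrite mulrDl (le_trans (nrmD _ _ _))// lerD.
Qed.

Lemma boundedZ (c : R[i]) A : bounded_op A -> bounded_op (c \*: A).
Proof.
move=> /bounded_opP[lA [M M0 AM]]; apply/bounded_opP.
split; first by move=> a u v /=; rewrite lA scalerDr !scalerA mulrC.
exists (Num.sqrt (complex.Re c ^+ 2 + complex.Im c ^+ 2) * M) => [|x].
  by rewrite mulr_ge0 ?sqrtr_ge0.
by rewrite /= nrmCZ -mulrA ler_wpM2l ?sqrtr_ge0.
Qed.

Lemma boundedB A B : bounded_op A -> bounded_op B -> bounded_op (A \- B).
Proof.
move=> bA bB; rewrite (_ : A \- B = A \+ (-1 \*: B)).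
  by apply: boundedD => //; exact: boundedZ.
by apply/funext => y /=; rewrite scaleN1r.
Qed.

Lemma bounded_poly_op q A : bounded_op A -> bounded_op (poly_op q A).
Proof.
move=> bA; have lA := lin_bounded bA; elim/poly_ind: q => [|q c IH].
  by rewrite (_ : poly_op 0 A = cst 0); [exact: bounded_cst0|apply/funext => x; rewrite poly_op0].
rewrite (_ : poly_op _ A = (A \o poly_op q A) \+ (c%:C \*: idfun)).
  by apply: boundedD; [exact: bounded_comp|apply: boundedZ; exact: bounded_id].
by apply/funext => x; rewrite poly_opD poly_opMX// poly_opC.
Qed.

Lemma rdotZi x y : << 'i%C *: x, y >> = - << x, 'i%C *: y >>.
Proof. by rewrite rdotC -!Im_dot dotC; case: (dot x y). Qed.

Lemma rdotii x y : << 'i%C *: x, 'i%C *: y >> = << x, y >>.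
Proof. by rewrite rdotZi scalerA -expr2 sqr_i scaleN1r rdotNr opprK. Qed.

(** Over the complex numbers a real quadratic form forces self-adjointness: the vanishing of
    [Im <A z, z>] at [z = x + i y] is the symmetry of [Re <A x, y>]. *)
Lemma positive_opP A : positive_op dot A <->
  [/\ bounded_op A, adj A A & forall x, 0 <= << A x, x >>].
Proof.
split=> [[bA A0]|[bA sA A0]].
  have lA := lin_bounded bA.
  have Im0 x : << A x, 'i%C *: x >> = 0.
    by have := A0 x; rewrite lecE => /andP[/eqP] /=; rewrite Im_dot.
  split=> // [x y|x]; last by have := A0 x; rewrite lecE => /andP[].
  have := Im0 (x + 'i%C *: y); rewrite linD// linZ// scalerDr scalerA -expr2 sqr_i.
  rewrite scaleN1r !rdotDl !rdotDr Im0 add0r !rdotNr rdotii rdotZi Im0 (rdotC _ x).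
  lra.
split=> // x; rewrite dot_rdotE lecE/= A0 andbT.
have : << A x, 'i%C *: x >> = - << A x, 'i%C *: x >>.
  by rewrite {1}sA linZ ?(rdotC _ x) ?rdotZi//; exact: lin_bounded.
lra.
Qed.

End BoundedOperators.

(** * Continuous functional calculus of a positive operator *)

Section FunctionalCalculus.
Context {R : realType} {H : completeNormedModType R[i]}.
Variable dot : {dot H for (@Num.conj R[i])}.
Hypothesis hH : hilbert_dot dot.
Local Notation "<< x , y >>" := (rdot dot x y).
Local Notation nsq := (nsq dot).
Local Notation nrm := (nrm dot).
Local Notation adj := (adj dot).
Implicit Types (A B C : H -> H) (q : {poly R}) (phi psi : R -> R).

Definition near_on M phi (eps : R) q :=
  forall t, 0 <= t -> t <= M -> `|q.[t] - phi t| <= eps.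

Definition approximable M phi := forall eps, 0 < eps -> exists q, near_on M phi eps q.

Lemma approximable_modulus M phi : 0 < M -> quad_modulus M phi -> approximable M phi.
Proof.
move=> M0 hphi eps e0; have [N hN] := bern_poly_approx M0 hphi e0.
by exists (bern_poly M phi N) => t; apply: hN.
Qed.

Lemma near_on_sub M M' phi eps q : M' <= M -> near_on M phi eps q -> near_on M' phi eps q.
Proof. by move=> MM h t t0 tM; apply: h => //; apply: le_trans MM. Qed.

Lemma approximable_sub M M' phi : M' <= M -> approximable M phi -> approximable M' phi.
Proof. by move=> MM h eps /h[q hq]; exists q; apply: near_on_sub hq. Qed.

Lemma approximable_sqrt M : approximable M (@Num.sqrt R).
Proof.
apply: (@approximable_sub (Num.max 1 M)); first by rewrite le_max lexx orbT.
by apply: approximable_modulus; [rewrite lt_max ltr01|exact: quad_modulus_sqrt].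
Qed.

Lemma approximable_powR M r : 1 < r -> approximable M (fun t => t `^ r).
Proof.
move=> r1; apply: (@approximable_sub (Num.max 1 M)); first by rewrite le_max lexx orbT.
by apply: approximable_modulus; [rewrite lt_max ltr01|exact: quad_modulus_powR].
Qed.

(* [fcalc M A phi B] says that [B = phi(A)], tested against all polynomials
   that are uniformly close to [phi] on [[0, M]]. *)
Definition fcalc M A phi B := forall eps q, 0 < eps -> near_on M phi eps q ->
  forall x, nrm (poly_op q A x - B x) <= eps * nrm x.

Lemma rdot_le_nrm A (c : R) x : nrm (A x) <= c * nrm x -> << A x, x >> <= c * nsq x.
Proof.
move=> h; rewrite -nrm_sq expr2 mulrA (le_trans (ler_norm _))//.
by rewrite (le_trans (rdot_le _ _ _))// ler_wpM2r ?nrm_ge0.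
Qed.

Lemma small_factor (eps K : R) : 0 < eps -> 0 <= K -> exists2 d, 0 < d & d * K <= eps.
Proof.
move=> e0 K0; have K1 : 0 < K + 1 by rewrite ltr_wpDl.
exists (eps / (K + 1)); first by rewrite divr_gt0.
by rewrite mulrAC ler_pdivrMr// ler_wpM2l ?lerDl// ltW.
Qed.

Lemma inv_small (eps : R) : 0 < eps ->
  exists N, forall n, (N <= n)%N -> n.+1%:R^-1 <= eps.
Proof.
move=> e0; exists (Num.Def.truncn eps^-1) => n Nn.
rewrite -[leRHS]invrK lef_pV2 ?posrE ?invr_gt0//.
by rewrite (le_trans (ltW (truncnS_gt _)))// ler_nat.
Qed.

Section SelfAdjoint.
Variables (A : H -> H) (M : R).
Hypotheses (bA : bounded_op A) (sA : adj A A) (M0 : 0 <= M).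
Hypotheses (A0 : forall x, 0 <= << A x, x >>) (AM : forall x, << A x, x >> <= M * nsq x).

Let lA := lin_bounded bA.

Lemma fcalc_poly q : fcalc M A (horner q) (poly_op q A).
Proof.
move=> eps p e0 hp x; rewrite -poly_opB.
apply: (poly_op_bound lA sA A0 AM M0 (ltW e0)) => t t0 tM.
by rewrite !hornerE; apply: hp.
Qed.

Lemma near_on_dist phi eps del p q : near_on M phi eps p -> near_on M phi del q ->
  0 <= eps + del -> forall x, nrm (poly_op p A x - poly_op q A x) <= (eps + del) * nrm x.
Proof.
move=> hp hq ed x; rewrite -poly_opB.
apply: (poly_op_bound lA sA A0 AM M0) => // t t0 tM.
rewrite !hornerE (_ : p.[t] - q.[t] = (p.[t] - phi t) - (q.[t] - phi t)).
  by rewrite (le_trans (ler_normB _ _))// lerD ?hp ?hq.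
by rewrite opprB addrA subrK.
Qed.

(** Polynomials uniformly close on [[0, M]] are close in norm at [A], so approximants within
    [1/(n+1)] give a Cauchy sequence at every vector. Any other polynomial close to [phi] is
    compared with them, which yields [fcalc]. *)
Lemma fcalc_ex phi : approximable M phi -> exists2 B, linear B & fcalc M A phi B.
Proof.
move=> happ.
have /choice[q hq] (n : nat) : exists q, near_on M phi n.+1%:R^-1 q.
  by apply: happ; rewrite invr_gt0.
have /choice[B hB] (x : H) : exists l : H, (fun n => poly_op (q n) A x) @ \oo --> l.
  apply: (seq_complete hH) => eps e0.
  have [|N hN] := @inv_small (eps / 2 / (nrm x + 1)).
    by rewrite !divr_gt0// ltr_wpDl ?nrm_ge0.
  exists N => m n Nm Nn.
  apply: le_trans (near_on_dist (hq m) (hq n) _ x) _; first by rewrite addr_ge0 ?invr_ge0.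
  have x1 : 0 < nrm x + 1 by rewrite ltr_wpDl ?nrm_ge0.
  apply: (@le_trans _ _ (eps / (nrm x + 1) * nrm x)).
    rewrite ler_wpM2r ?nrm_ge0// [X in _ <= X / _]splitr mulrDl.
    by apply: lerD; apply: hN.
  by rewrite mulrAC ler_pdivrMr// ler_wpM2l ?(ltW e0)// lerDl.
have hB' x : forall eps, 0 < eps -> exists N, forall n, (N <= n)%N ->
    nrm (poly_op (q n) A x - B x) <= eps.
  by apply/(seq_cvgP hH).
have fB : fcalc M A phi B.
  move=> eps p e0 hp x; apply/ler_addgt0Pr => d d0.
  have d20 : 0 < d / 2 by rewrite divr_gt0.
  have [N1 hN1] := hB' x _ d20.
  have [|N2 hN2] := @inv_small (d / 2 / (nrm x + 1)).
    by rewrite !divr_gt0// ltr_wpDl ?nrm_ge0.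
  pose n := maxn N1 N2.
  apply: le_trans (nrm_triangle _ (poly_op (q n) A x) _ _) _.
  have := hN1 n (leq_maxl _ _).
  have ed : 0 <= eps + n.+1%:R^-1 by rewrite addr_ge0 ?invr_ge0// ltW.
  have := near_on_dist hp (hq n) ed x.
  have : n.+1%:R^-1 * nrm x <= d / 2.
    have x1 : 0 < nrm x + 1 by rewrite ltr_wpDl ?nrm_ge0.
    apply: (@le_trans _ _ (d / 2 / (nrm x + 1) * nrm x)).
      by rewrite ler_wpM2r ?nrm_ge0// hN2// leq_maxr.
    by rewrite mulrAC ler_pdivrMr// ler_wpM2l ?(ltW d20)// lerDl.
  by rewrite mulrDl; move: (_^-1 * nrm x) => z; lra.
exists B => // a u v; apply/eqP; rewrite -subr_eq0; apply/eqP.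
apply: (nrm_small (dot := dot)) => eps e0.
(* [K] collects the errors of [p(A)] against [B] at [a u + v], [u] and [v], so that one approximant
   within [eps / K] settles linearity. *)
pose K := nrm (a *: u + v) + (`|complex.Re a| + `|complex.Im a|) * nrm u + nrm v + 1.
have K0 : 0 < K by rewrite ltr_wpDl ?addr_ge0 ?mulr_ge0 ?addr_ge0 ?nrm_ge0.
have [d eK dK] : exists2 d, 0 < d & d * K = eps.
  by exists (eps / K); rewrite ?divr_gt0// divfK// gt_eqF.
have [p hp] := happ d eK.
have h1 := fB _ _ eK hp (a *: u + v).
have h2 := fB _ _ eK hp u; have h3 := fB _ _ eK hp v.
have lp := lin_poly_op lA p.
have -> : B (a *: u + v) - (a *: B u + B v) =
  - (poly_op p A (a *: u + v) - B (a *: u + v)) +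
  (a *: (poly_op p A u - B u) + (poly_op p A v - B v)).
  by rewrite lp scalerBr opprB [X in _ = _ + X]addrACA [RHS]addrA subrK opprD.
apply: le_trans (nrmD _ _ _) _; rewrite nrmN.
apply: le_trans (lerD h1 (nrmD _ _ _)) _.
have sq : Num.sqrt (complex.Re a ^+ 2 + complex.Im a ^+ 2) <= `|complex.Re a| + `|complex.Im a|.
  rewrite -(@ler_pXn2r _ 2)// ?nnegrE ?sqrtr_ge0 ?addr_ge0// sqr_sqrtr ?addr_ge0 ?sqr_ge0//.
  rewrite sqrrD !real_normK ?num_real// lerD2r lerDl.
  by rewrite mulrn_wge0// mulr_ge0.
have : Num.sqrt (complex.Re a ^+ 2 + complex.Im a ^+ 2) * nrm (poly_op p A u - B u) <=
  (`|complex.Re a| + `|complex.Im a|) * (d * nrm u).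
  by apply: ler_pM => //; rewrite ?sqrtr_ge0 ?nrm_ge0.
rewrite -dK /K (nrmCZ hH); move: (_ * nrm (_ - B u)) => z; move: h3 eK; nra.
Qed.

Section Approximable.
Variables (phi : R -> R) (B : H -> H).
Hypotheses (aphi : approximable M phi) (fB : fcalc M A phi B).

Lemma fcalc_uniq C : fcalc M A phi C -> B = C.
Proof.
move=> fC; apply/funext => x; apply/eqP; rewrite -subr_eq0; apply/eqP.
apply: (nrm_small (dot := dot)) => eps e0.
have [d d0 dK] : exists2 d, 0 < d & d * nrm x <= eps / 2.
  by apply: small_factor; rewrite ?divr_gt0 ?nrm_ge0.
have [p hp] := aphi d0.
apply: le_trans (nrm_triangle _ (poly_op p A x) _ _) _.
rewrite nrmBC; have h1 := fB d0 hp x; have h2 := fC _ _ d0 hp x.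
by lra.
Qed.

Lemma fcalc_linear : linear B.
Proof. by have [C lC /fcalc_uniq ->] := fcalc_ex aphi. Qed.

Lemma fcalc_bounded : bounded_op B.
Proof.
apply/(bounded_opP hH); split; first exact: fcalc_linear.
have [p hp] := aphi ltr01.
have /(bounded_opP hH)[_ [N N0 pN]] := bounded_poly_op hH p bA.
exists (1 + N) => [|x]; first by rewrite addr_ge0.
have := fB ltr01 hp x; rewrite nrmBC => h.
rewrite -[B x](subrK (poly_op p A x)) (le_trans (nrmD _ _ _))//.
by rewrite mulrDl lerD.
Qed.

Lemma fcalc_close x y eps : 0 < eps -> exists2 p, near_on M phi eps p &
  `|<< poly_op p A x, y >> - << B x, y >>| <= eps * nrm x * nrm y.
Proof.
move=> e0; have [p hp] := aphi e0; exists p => //; rewrite -rdotBl.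
by rewrite (le_trans (rdot_le _ _ _))// ler_wpM2r ?nrm_ge0// fB.
Qed.

Lemma fcalc_adj : adj B B.
Proof.
move=> x y; apply/eqP; rewrite -subr_eq0 -normr_le0; apply/ler_addgt0Pr => eps e0.
have [d d0 dK] : exists2 d, 0 < d & d * (nrm x * nrm y) <= eps / 2.
  by apply: small_factor; rewrite ?divr_gt0 ?mulr_ge0 ?nrm_ge0.
have [p hp] := aphi d0; rewrite add0r.
have h1 := fB d0 hp x; have h2 := fB d0 hp y.
have g1 : `|<< poly_op p A x - B x, y >>| <= d * nrm x * nrm y.
  by rewrite (le_trans (rdot_le _ _ _))// ler_wpM2r ?nrm_ge0.
have g2 : `|<< x, poly_op p A y - B y >>| <= nrm x * (d * nrm y).
  by rewrite (le_trans (rdot_le _ _ _))// ler_wpM2l ?nrm_ge0.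
rewrite rdotBl -mulrA in g1; rewrite rdotBr -(adj_poly_op lA p sA) mulrCA in g2.
move: g1 g2 dK; move: (d * _) => z.
by rewrite !ler_norml => /andP[? ?] /andP[? ?] ?; apply/andP; split; lra.
Qed.

End Approximable.

Lemma fcalc_le phi psi B C : approximable M phi -> approximable M psi ->
  fcalc M A phi B -> fcalc M A psi C ->
  (forall t, 0 <= t -> t <= M -> phi t <= psi t) ->
  forall x, << B x, x >> <= << C x, x >>.
Proof.
move=> aphi apsi fB fC le x; apply/ler_addgt0Pr => eps e0.
have [d d0 dK] : exists2 d, 0 < d & d * nsq x <= eps / 4.
  by apply: small_factor; rewrite ?divr_gt0 ?nsq_ge0.
have [p hp h1] := fcalc_close aphi fB x x d0.
have [q hq h2] := fcalc_close apsi fC x x d0.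
(* Polynomials within [d] of [phi <= psi] satisfy [p <= q + 2 d] on [[0, M]]. *)
have : << poly_op p A x, x >> <= << poly_op (q + (2 * d)%:P) A x, x >>.
  apply: (poly_op_le lA sA A0 AM M0) => t t0 tM; rewrite !hornerE.
  have := hp t t0 tM; have := hq t t0 tM; have := le t t0 tM.
  by rewrite !ler_norml => ? /andP[? ?] /andP[? ?]; lra.
rewrite poly_opD poly_opC rdotDl rdotZl -mulrA.
move: h1 h2 dK; rewrite -mulrA -expr2 nrm_sq -/(nsq x); move: (d * nsq x) => z.
by rewrite !ler_norml => /andP[? ?] /andP[? ?]; lra.
Qed.

Lemma fcalc_ge0 phi B : approximable M phi -> fcalc M A phi B ->
  (forall t, 0 <= t -> t <= M -> 0 <= phi t) -> forall x, 0 <= << B x, x >>.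
Proof.
move=> aphi fB phi0 x.
have a0 : approximable M (horner 0).
  by move=> eps e0; exists 0 => t _ _; rewrite subrr normr0 ltW.
have := fcalc_le a0 aphi (@fcalc_poly 0) fB _ x; rewrite poly_op0 rdot0l; apply=> t t0 tM.
by rewrite horner0 phi0.
Qed.

End SelfAdjoint.
End FunctionalCalculus.

(** * Square roots, real powers, absolute values and polar decomposition *)

Section RootsAndPowers.
Context {R : realType} {H : completeNormedModType R[i]}.
Variable dot : {dot H for (@Num.conj R[i])}.
Hypothesis hH : hilbert_dot dot.
Local Notation "<< x , y >>" := (rdot dot x y).
Local Notation nsq := (nsq dot).
Local Notation nrm := (nrm dot).
Local Notation adj := (adj dot).
Local Notation fcalc := (fcalc dot).
Local Notation positive_op := (positive_op dot).
Implicit Types (A B C : H -> H) (q : {poly R}) (phi psi : R -> R).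

Lemma positive_bounded A : positive_op A -> bounded_op A.
Proof. by case. Qed.

Lemma positive_linear A : positive_op A -> linear A.
Proof. by move=> [[]]. Qed.

Lemma positive_adj A : positive_op A -> adj A A.
Proof. by case/(positive_opP dot). Qed.

Lemma positive_ge0 A x : positive_op A -> 0 <= << A x, x >>.
Proof. by case/(positive_opP dot). Qed.

Lemma positive_opnorm A x : positive_op A -> << A x, x >> <= opnorm A * nsq x.
Proof. by move=> [bA _]; apply: rdot_le_nrm; apply: opnorm_bound. Qed.

Lemma positive_cst0 : positive_op (cst 0).
Proof. by split; [exact: (bounded_cst0 hH)|move=> x; rewrite linear0l]. Qed.

Lemma positive_gram A A' : bounded_op A -> bounded_op A' -> adj A A' ->
  positive_op (A' \o A).
Proof.
move=> bA bA' aA; apply/(positive_opP dot); split.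
- exact: bounded_comp.
- by apply: adj_comp => //; exact: adjC.
- by move=> x; rewrite /= rdotC -aA nsq_ge0.
Qed.

Lemma positive_poly_op A q : positive_op A ->
  (forall t, 0 <= t -> t <= opnorm A -> 0 <= q.[t]) -> positive_op (poly_op q A).
Proof.
move=> pA q0; have [bA sA A0] := (positive_opP dot A).1 pA.
apply/(positive_opP dot); split; first exact: bounded_poly_op.
  exact: adj_poly_op (positive_linear pA) _ sA.
apply: (poly_op_ge0 (positive_linear pA) sA A0 _ (opnorm_ge0 hH bA)) => // x.
exact: positive_opnorm.
Qed.

Lemma fcalc_ext M A phi psi B : (forall t, 0 <= t -> t <= M -> phi t = psi t) ->
  fcalc M A phi B -> fcalc M A psi B.
Proof.
move=> e fB eps q e0 hq; apply: fB => // t t0 tM.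
by rewrite e// hq.
Qed.

Lemma fcalc_positive M A phi B : positive_op A -> 0 <= M ->
  (forall x, << A x, x >> <= M * nsq x) ->
  approximable M phi -> fcalc M A phi B -> (forall t, 0 <= t -> t <= M -> 0 <= phi t) ->
  positive_op B.
Proof.
move=> pA M0 AM aphi fB phi0; have [bA sA A0] := (positive_opP dot A).1 pA.
apply/(positive_opP dot); split.
- exact: (fcalc_bounded hH bA sA M0 A0 AM aphi fB).
- exact: (fcalc_adj bA sA aphi fB).
- exact: (fcalc_ge0 bA sA M0 A0 AM aphi fB phi0).
Qed.

(** For any positive root [B], [q(A)] is [q(X^2)] evaluated at [B], and [q(t^2)] is close to [t] on
    [[0, sqrt M]]. This ties the chosen root to polynomials in [A], on which its measurability
    rests. *)
Lemma sqrt_fcalc A B M : positive_op A -> positive_op B -> B \o B = A -> 0 <= M ->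
  (forall x, << A x, x >> <= M * nsq x) -> fcalc M A Num.sqrt B.
Proof.
move=> pA pB BB M0 AM eps q e0 hq x.
have [bB sB B0] := (positive_opP dot B).1 pB; have lB := lin_bounded bB.
have BM y : nrm (B y) <= Num.sqrt M * nrm y.
  apply: nrm_le_sq; rewrite ?sqrtr_ge0// sqr_sqrtr//.
  by rewrite {1}/nsq -sB -[B (B y)]/((B \o B) y) BB.
have -> : poly_op q A x = poly_op (q \Po 'X^2) B x.
  rewrite poly_op_comp//; congr (poly_op q _ x); apply/funext => y.
  by rewrite -BB expr2 poly_opM// !poly_opX.
rewrite -[in B x](poly_opX lB) -poly_opB.
apply: (poly_op_bound lB sB B0 _ (sqrtr_ge0 M) (ltW e0)) => [y|t t0 tM].
  exact: rdot_le_nrm.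
rewrite hornerD hornerN horner_comp hornerXn hornerX.
have := hq (t ^+ 2) (sqr_ge0 t); rewrite sqrtr_sqr (ger0_norm t0); apply.
by rewrite -(sqr_sqrtr M0); apply: lerXn2r; rewrite ?nnegrE ?sqrtr_ge0.
Qed.

Lemma sqrt_op_spec A : positive_op A ->
  positive_op (sqrt_op dot A) /\ sqrt_op dot A \o sqrt_op dot A = A.
Proof.
move=> pA; rewrite /sqrt_op; apply: (@xgetPex _ _ [set B | positive_op B /\ B \o B = A]).
have [bA sA A0] := (positive_opP dot A).1 pA.
have M0 := opnorm_ge0 hH bA; have lA := lin_bounded bA.
have AM x := positive_opnorm x pA; set M := opnorm A in M0 AM.
have aS := @approximable_sqrt R M.
have [B lB fB] := fcalc_ex hH bA sA M0 A0 AM aS.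
have pB : positive_op B.
  by apply: (fcalc_positive pA M0 AM aS fB) => t _ _; exact: sqrtr_ge0.
exists B; split=> //; apply/funext => x /=.
have [N0 BN] := opnorm_spec hH (positive_bounded pB); set N := opnorm B in N0 BN.
apply/eqP; rewrite -subr_eq0; apply/eqP; apply: (nrm_small (dot := dot)) => eps e0.
have nx := nrm_ge0 dot x.
have S0 := sqrtr_ge0 M.
(* The constant adds three errors: [2 sqrt M + 1] from [p(A)^2] against [A], then [N + 1] and [N]
   from replacing each factor [p(A)] by [B]. The bound [d' <= 1] absorbs squares of [d']. *)
have [d d0 dK] : exists2 d, 0 < d & d * ((2 * N + 2 * Num.sqrt M + 2) * nrm x) <= eps.
  by apply: small_factor => //; rewrite mulr_ge0// !addr_ge0 ?mulr_ge0.
have [d' [d'0 d'd d'1]] : exists d', [/\ 0 < d', d' <= d & d' <= 1].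
  exists (Num.min d 1); split; first by rewrite lt_min d0 ltr01.
    by rewrite ge_min lexx.
  by rewrite ge_min lexx orbT.
have [p hp] := aS _ d'0.
have h0 := fB _ _ d'0 hp.
have h1 := h0 x; have h2 := h0 (poly_op p A x).
have h3 := BN (poly_op p A x - B x); rewrite linB// in h3.
have h4 : nrm (poly_op (p * p) A x - A x) <= d' * (2 * Num.sqrt M + 1) * nrm x.
  rewrite -[in A x](poly_opX lA) -poly_opB.
  apply: (poly_op_bound lA sA A0 AM M0).
    by rewrite mulr_ge0 ?(ltW d'0)// addr_ge0 ?mulr_ge0.
  move=> t t0 tM; rewrite hornerD hornerN hornerM hornerX.
  rewrite [X in _ - X](_ : t = Num.sqrt t * Num.sqrt t); last by rewrite -expr2 sqr_sqrtr.
  have sM : Num.sqrt t <= Num.sqrt M by rewrite ler_sqrt.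
  have st := sqrtr_ge0 t.
  have -> : p.[t] * p.[t] - Num.sqrt t * Num.sqrt t =
    (p.[t] - Num.sqrt t) * ((p.[t] - Num.sqrt t) + 2 * Num.sqrt t) by ring.
  rewrite normrM; apply: ler_pM => //; first exact: hp.
  have hpt := hp t t0 tM; apply: le_trans (ler_normD _ _) _.
  rewrite [X in _ + X]ger0_norm; last by rewrite mulr_ge0.
  by lra.
rewrite poly_opM// in h4.
have h5 : nrm (poly_op p A x) <= nrm (B x) + d' * nrm x.
  by rewrite -[poly_op p A x](subrK (B x)) addrC (le_trans (nrmD _ _ _))// lerD2l.
have h6 := BN x.
apply: le_trans (nrm_triangle _ (poly_op p A (poly_op p A x)) _ _) _.
rewrite nrmBC.
have h7 := nrm_triangle dot (B (poly_op p A x)) (poly_op p A (poly_op p A x)) (B (B x)).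
apply: le_trans dK.
have h8 : d' * nrm (poly_op p A x) <= d' * ((N + 1) * nrm x).
  apply: ler_wpM2l; first exact: ltW.
  by apply: le_trans h5 _; rewrite mulrDl lerD// ler_wpM2r.
have h9 : N * nrm (poly_op p A x - B x) <= N * (d' * nrm x) by apply: ler_wpM2l.
have h10 : d' * ((2 * N + 2 * Num.sqrt M + 2) * nrm x) <=
  d * ((2 * N + 2 * Num.sqrt M + 2) * nrm x).
  by apply: ler_wpM2r => //; rewrite mulr_ge0// !addr_ge0 ?mulr_ge0.
apply: le_trans h10; nra.
Qed.

Lemma sqrt_op_positive A : positive_op (sqrt_op dot A).
Proof.
rewrite /sqrt_op; case: xgetP => [B _ []//|_]; exact: positive_cst0.
Qed.

Lemma sqrt_op_junk A : ~ positive_op A -> sqrt_op dot A = cst 0.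
Proof.
rewrite /sqrt_op => nA; case: xgetP => // B _ [pB BB]; case: nA; rewrite -BB.
by apply: positive_gram; [exact: positive_bounded..|exact: positive_adj].
Qed.

Lemma sqrt_opK A : positive_op A -> forall x, sqrt_op dot A (sqrt_op dot A x) = A x.
Proof. by move=> /sqrt_op_spec[_ AA] x; rewrite -[in RHS]AA. Qed.

Lemma nsq_sqrt_op A x : positive_op A -> nsq (sqrt_op dot A x) = << A x, x >>.
Proof.
by move=> pA; rewrite /nsq -(positive_adj (sqrt_op_positive A)) sqrt_opK.
Qed.

Lemma uniform_itv_cvgP (M : R) (q : nat -> {poly R}) phi :
  {uniform `[0, M]%classic, (fun n (t : R) => (q n).[t]) @ \oo --> phi} <->
  (forall eps, 0 < eps -> exists N, forall n, (N <= n)%N -> near_on M phi eps (q n)).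
Proof.
split=> [/uniform_cvgP h eps /h[N hN]|h].
  by exists N => n /hN hn t t0 tM; apply: hn => /=; rewrite in_itv/= t0.
apply/uniform_cvgP => eps /h[N hN]; exists N => n /hN hn t /=.
by rewrite in_itv/= => /andP[t0 tM]; apply: hn.
Qed.

(** Whatever operator is chosen is a norm limit of polynomials [q_n(A)] with [q_n] tending to [t^r],
    hence passes every test of [fcalc]; a choice exists because the operator of [fcalc_ex]
    qualifies. *)
Lemma power_op_fcalc A r : positive_op A -> approximable (opnorm A) (fun t => t `^ r) ->
  fcalc (opnorm A) A (fun t => t `^ r) (power_op A r).
Proof.
move=> pA aphi; have [bA sA A0] := (positive_opP dot A).1 pA.
have M0 := opnorm_ge0 hH bA; have lA := lin_bounded bA.
have AM x := positive_opnorm x pA.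
rewrite /power_op; case: xgetP => [B _ [bB [q [/uniform_itv_cvgP hq qB]]]|/= none]; last first.
  have [B lB fB] := fcalc_ex hH bA sA M0 A0 AM aphi.
  have /choice[q hq] (n : nat) : exists q, near_on (opnorm A) (fun t => t `^ r) n.+1%:R^-1 q.
    by apply: aphi; rewrite invr_gt0.
  case: (none B); split; first exact: (fcalc_bounded hH bA sA M0 A0 AM aphi fB).
  exists q; split.
    apply/uniform_itv_cvgP => eps /inv_small[N hN]; exists N => n /hN nN t t0 tM.
    exact: le_trans (hq n t t0 tM) nN.
  apply/cvgrPdist_le => eps e0; have [N hN] := inv_small e0.
  exists N => // n /= /hN nN; rewrite sub0r normrN.
  have h : forall x, nrm ((poly_op (q n) A \- B) x) <= n.+1%:R^-1 * nrm x.
    by move=> x; apply: fB (hq n) x; rewrite invr_gt0.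
  rewrite ger0_norm; first by apply: le_trans nN; apply: (opnorm_le hH) => //; rewrite invr_ge0.
  apply: (opnorm_ge0 hH); apply/(bounded_opP hH); split; last by exists n.+1%:R^-1.
  move=> a u v /=; rewrite lB (lin_poly_op lA (q n)) scalerBr opprD.
  by rewrite addrACA.
move=> eps p e0 hp x; apply/ler_addgt0Pr => d d0.
have nx := nrm_ge0 dot x.
have [e e1 eK] : exists2 e, 0 < e & e * (2 * nrm x) <= d.
  by apply: small_factor => //; rewrite mulr_ge0.
have [N1 hN1] := hq _ e1.
have /cvgrPdist_le/(_ _ e1)[N2 _ hN2] := qB.
pose n := maxn N1 N2.
have h1 := hN1 n (leq_maxl _ _); have := hN2 n (leq_maxr _ _).
have bq : bounded_op (poly_op (q n) A \- B).
  by apply: (boundedB hH) => //; exact: bounded_poly_op.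
have := opnorm_bound hH x bq => /= h2.
rewrite sub0r normrN ger0_norm; last exact: opnorm_ge0.
move=> h3; apply: le_trans (nrm_triangle _ (poly_op (q n) A x) _ _) _.
have ee : 0 <= eps + e by rewrite addr_ge0 ?ltW.
have := near_on_dist bA sA M0 A0 AM hp h1 ee x.
have : opnorm (poly_op (q n) A \- B) * nrm x <= e * nrm x by apply: ler_wpM2r.
by lra.
Qed.

(** The exponent [1] lies outside [approximable_powR], but ['X] is an exact approximant. This
    identifies the Schatten 1-norm with the trace of [|A|]. *)
Lemma power_op1 A : positive_op A -> power_op A 1 = A.
Proof.
move=> pA; have [bA sA A0] := (positive_opP dot A).1 pA.
have M0 := opnorm_ge0 hH bA; have lA := lin_bounded bA.
have AM x := positive_opnorm x pA.
have a1 : approximable (opnorm A) (fun t => t `^ 1).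
  by move=> eps e0; exists 'X => t t0 _; rewrite hornerX powRr1// subrr normr0 ltW.
apply: (fcalc_uniq a1); first exact: power_op_fcalc.
apply: (@fcalc_ext _ _ (horner 'X)); first by move=> t t0 _; rewrite hornerX powRr1.
rewrite -[X in fcalc _ _ _ X](_ : poly_op 'X A = A); last by apply/funext => x; rewrite poly_opX.
exact: fcalc_poly.
Qed.

Lemma power_op_positive A r : positive_op A -> 1 < r -> positive_op (power_op A r).
Proof.
move=> pA r1; have := power_op_fcalc pA (@approximable_powR _ _ _ r1) => fB.
apply: (fcalc_positive pA _ _ _ fB); last by move=> t _ _; exact: powR_ge0.
- exact: opnorm_ge0 (positive_bounded pA).
- by move=> x; exact: positive_opnorm.
- exact: approximable_powR.
Qed.

Lemma adj_dot A A' : bounded_op A' -> adj A A' -> forall x y, dot (A x) y = dot x (A' y).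
Proof.
move=> bA' aA x y; rewrite !(dot_rdotE dot) !aA linZ//.
exact: lin_bounded.
Qed.

Lemma adjointE A A' : bounded_op A' -> adj A A' -> adjoint dot A = A'.
Proof.
move=> bA' aA; rewrite /adjoint; case: xgetP => [B _ [bB hB]|/= none].
  by apply: (adj_uniq (dot := dot) _ aA) => x y; rewrite /rdot hB.
by case: (none A'); split=> //; exact: adj_dot.
Qed.

Lemma abs_op_positive A : positive_op (abs_op dot A).
Proof. exact: sqrt_op_positive. Qed.

Section AbsoluteValue.
Variables (A A' : H -> H).
Hypotheses (bA : bounded_op A) (bA' : bounded_op A') (aA : adj A A').

Lemma abs_opK x : abs_op dot A (abs_op dot A x) = A' (A x).
Proof. by rewrite /abs_op (adjointE bA' aA) sqrt_opK//; exact: positive_gram. Qed.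

Lemma nsq_abs_op x : nsq (abs_op dot A x) = nsq (A x).
Proof.
by rewrite {1}/nsq -(positive_adj (abs_op_positive A)) abs_opK rdotC -aA.
Qed.

Lemma nrm_abs_op x : nrm (abs_op dot A x) = nrm (A x).
Proof. exact: (congr1 (@Num.sqrt R) (nsq_abs_op x)). Qed.

(* Approximate polar decomposition [A ~ V |A|], [|A| ~ V' A] with [V = A r(|A|)],
   where [1 - t r(t) = (1 - t / M) ^ n]; staying with polynomials avoids the
   strong limits that an exact partial isometry would require. *)
Lemma approx_polar eps : 0 < eps -> exists V V' : H -> H,
  [/\ bounded_op V, bounded_op V', adj V V', forall x, nrm (V x) <= nrm x &
   forall x, nrm (A x - V (abs_op dot A x)) <= eps * nrm x /\
             nrm (abs_op dot A x - V' (A x)) <= eps * nrm x].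
Proof.
move=> e0; set S := abs_op dot A; have pS : positive_op S := abs_op_positive A.
have [bS sS S0] := (positive_opP dot S).1 pS.
have M0 := opnorm_ge0 hH bS; have lS := lin_bounded bS.
have SM x := positive_opnorm x pS.
pose M := opnorm S + 1; have M1 : 0 < M by rewrite ltr_wpDl.
(* With this [n], [t (1 - t/M)^n <= M/n <= eps] on [[0, opnorm S]], by the Bernoulli bound at
   [u = t/M]. The [+ 1] in [M] covers [S = 0]. *)
have [n hn] : exists n, M <= eps * n%:R.
  exists (Num.Def.truncn (M / eps)).+1; rewrite mulrC -ler_pdivrMr//.
  exact: ltW (truncnS_gt _).
pose g : {poly R} := (1 - M^-1 *: 'X) ^+ n.
have gE t : g.[t] = (1 - M^-1 * t) ^+ n.
  by rewrite /g !(horner_exp, hornerD, hornerN, hornerZ, hornerX, hornerC).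
have [r rE] : exists r, 1 - g = r * ('X - 0%:P).
  by apply/factor_theorem; rewrite rootE hornerD hornerN gE hornerC mulr0 subr0 expr1n subrr.
rewrite subr0 in rE.
have u01 t : 0 <= t -> t <= opnorm S -> 0 <= M^-1 * t <= 1.
  move=> t0 tM; rewrite mulr_ge0 ?invr_ge0 ?(ltW M1)//= mulrC ler_pdivrMr// mul1r.
  by rewrite (le_trans tM)// lerDl.
have bernoulli u m : 0 <= u -> u <= 1 -> (1 + m%:R * u) * (1 - u) ^+ m <= 1 :> R.
  move=> u0 u1; elim: m => [|m IH]; first by rewrite mul0r addr0 mulr1.
  apply: le_trans IH; rewrite exprS mulrA ler_wpM2r ?exprn_ge0 ?subr_ge0//.
  by rewrite -natr1; have := ler0n R m; nra.
have gr t : 0 <= t -> t <= opnorm S -> `|(r * 'X).[t]| <= 1.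
  move=> t0 tM; rewrite -rE hornerD hornerN gE hornerC.
  have /andP[u0 u1] := u01 t t0 tM.
  have k0 : 0 <= (1 - M^-1 * t) ^+ n by rewrite exprn_ge0 ?subr_ge0.
  have k1 : (1 - M^-1 * t) ^+ n <= 1 by rewrite exprn_ile1 ?subr_ge0// gerBl.
  by rewrite ger0_norm ?subr_ge0// gerBl.
have gs t : 0 <= t -> t <= opnorm S -> `|('X * (1 - r * 'X)).[t]| <= eps.
  move=> t0 tM; rewrite -rE opprB addrCA subrr addr0 hornerM hornerX gE.
  have /andP[u0 u1] := u01 t t0 tM.
  have k0 : 0 <= (1 - M^-1 * t) ^+ n by rewrite exprn_ge0 ?subr_ge0.
  rewrite ger0_norm ?mulr_ge0//.
  have n0 : 0 < n%:R :> R.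
    by rewrite ltr0n; case: (n) hn => // ; rewrite mulr0 leNgt M1.
  have := bernoulli _ n u0 u1; move: k0; set k := (_ ^+ n) => k0 hb.
  have tE : t = M * (M^-1 * t) by rewrite mulrA divff ?gt_eqF// mul1r.
  move: hb u0; rewrite tE -tE; set u := M^-1 * t => hb u0.
  rewrite -(ler_pM2r n0) tE -/u.
  apply: le_trans hn; rewrite -[leRHS]mulr1.
  have -> : M * u * k * n%:R = M * (n%:R * u * k) by ring.
  by rewrite ler_pM2l//; apply: le_trans hb; rewrite mulrDl mul1r lerDr.
have key x : nrm (S x - poly_op r S (S (S x))) <= eps * nrm x.
  have -> : S x - poly_op r S (S (S x)) = poly_op ('X * (1 - r * 'X)) S x.
    rewrite mulrBr mulr1 mulrCA poly_opB poly_opM// poly_opM// !poly_opX//.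
  exact: (poly_op_bound lS sS S0 SM M0 (ltW e0)).
exists (A \o poly_op r S), (poly_op r S \o A'); split.
- by apply: bounded_comp => //; exact: bounded_poly_op.
- by apply: bounded_comp => //; exact: bounded_poly_op.
- by apply: adj_comp => //; apply: adj_poly_op.
- move=> x /=; rewrite -nrm_abs_op -poly_opMX// -[leRHS]mul1r.
  exact: (poly_op_bound lS sS S0 SM M0).
move=> x; split; last by rewrite /= -abs_opK; exact: key.
rewrite /= -linB; last exact: lin_bounded.
rewrite -nrm_abs_op -/S linB//.
by rewrite -poly_opMX// poly_opM// poly_opX// -?poly_opM//.
Qed.

End AbsoluteValue.
End RootsAndPowers.

(** * Unordered sums in [[0, +oo]] *)

Section NonnegativeSums.
Context {R : realType} {I : choiceType}.
Implicit Types (a b : I -> R) (K : {fset I}%fset).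

Definition tsum a : \bar R := \esum_(i in [set: I]) (a i)%:E.

Lemma fsum_EFin K a : (\sum_(i \in [set` K]) (a i)%:E)%E = (\sum_(i <- enum_fset K) a i)%:E.
Proof. by rewrite fsbig_finite//= set_fsetK sumEFin. Qed.

Lemma tsum_lub a (c : \bar R) :
  (forall K, ((\sum_(i <- enum_fset K) a i)%:E <= c)%E) -> (tsum a <= c)%E.
Proof.
move=> h; apply: ge_ereal_sup => /= _ [A [finA _] <-].
by rewrite -(fset_setK finA) fsum_EFin.
Qed.

Lemma tsum_ge K a : ((\sum_(i <- enum_fset K) a i)%:E <= tsum a)%E.
Proof.
rewrite -fsum_EFin; apply: ereal_sup_ubound; by exists [set` K].
Qed.

Lemma tsum_ge0 a : (0 <= tsum a)%E.
Proof. by rewrite (le_trans _ (tsum_ge fset0%fset a))// big_nil. Qed.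

Lemma le_tsum a b : (forall i, a i <= b i) -> (tsum a <= tsum b)%E.
Proof. by move=> h; apply: le_esum => i _; rewrite lee_fin. Qed.

Lemma eq_tsum a b : (forall i, a i = b i) -> tsum a = tsum b.
Proof. by move=> h; apply: eq_esum => i _; rewrite h. Qed.

Lemma tsumD a b : (forall i, 0 <= a i) -> (forall i, 0 <= b i) ->
  tsum (fun i => a i + b i) = (tsum a + tsum b)%E.
Proof.
by move=> a0 b0; rewrite -esumD// => i _; rewrite lee_fin.
Qed.

Lemma tsumZ a c : 0 <= c -> tsum (fun i => c * a i) = (c%:E * tsum a)%E.
Proof.
move=> c0; rewrite /tsum /esum -ereal_supZl//; last first.
  by apply/set0P; exists 0%E, set0; [exact: fsets_set0|rewrite fsbig_set0].
congr ereal_sup; apply/seteqP; split=> [_ [A [finA AT] <-]|_ [_ [A [finA AT] <-] <-]].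
  exists (\sum_(i \in A) (a i)%:E)%E; first by exists A.
  by rewrite -(fset_setK finA) !fsum_EFin -EFinM mulr_sumr.
exists A => //.
by rewrite -(fset_setK finA) !fsum_EFin -EFinM mulr_sumr.
Qed.

Lemma tsum_sum n (a : 'I_n -> I -> R) : (forall l i, 0 <= a l i) ->
  tsum (fun i => \sum_(l < n) a l i) = (\sum_(l < n) tsum (a l))%E.
Proof.
move=> a0; rewrite -esum_sum; last by move=> i l _ _; rewrite lee_fin.
by apply: eq_esum => i _; rewrite sumEFin.
Qed.

Lemma tsum_split K a : (forall i, 0 <= a i) ->
  tsum a = ((\sum_(i <- enum_fset K) a i)%:E +
            tsum (fun i => if i \in K then 0%R else a i))%E.
Proof.
move=> a0; rewrite /tsum (esumID [set` K]); last by move=> i _; rewrite lee_fin.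
rewrite setTI -fsum_EFin; congr (_ + _)%E.
  rewrite -esum_fset//.
  by move=> i _; rewrite lee_fin.
rewrite setTI esum_mkcond; apply: eq_esum => i _.
by rewrite in_setC mem_setE; case: (i \in K).
Qed.

Lemma esum_swap (s : I -> I -> R) : (forall i j, 0 <= s i j) ->
  (\esum_(i in [set: I]) tsum (s i) = \esum_(j in [set: I]) tsum (s ^~ j))%E.
Proof.
move=> s0; rewrite /tsum !esum_esum; try by move=> i j _ _; rewrite lee_fin.
rewrite (@reindex_esum _ _ _ ([set: I] `*`` (fun=> [set: I]))
   ([set: I] `*`` (fun=> [set: I])) (fun k => (k.2, k.1)))//.
split=> //.
- by move=> [i j] [i' j'] _ _ [-> ->].
- by move=> [i j] _; exists (j, i).
Qed.

End NonnegativeSums.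

(** * Parseval's identity and the Hilbert-Schmidt norm *)

Section HilbertSchmidt.
Context {R : realType} {H : completeNormedModType R[i]}.
Variable dot : {dot H for (@Num.conj R[i])}.
Hypothesis hH : hilbert_dot dot.
Variables (I : countType) (e : I -> H).
Hypothesis he : orthonormal_basis dot e.
Local Notation "<< x , y >>" := (rdot dot x y).
Local Notation nsq := (nsq dot).
Local Notation nrm := (nrm dot).
Local Notation adj := (adj dot).
Local Notation fcalc := (fcalc dot).
Local Notation positive_op := (positive_op dot).
Implicit Types (A B C : H -> H) (K : {fset I}%fset).

Definition sqn (z : R[i]) : R := complex.Re z ^+ 2 + complex.Im z ^+ 2.

Lemma sqn_ge0 z : 0 <= sqn z. Proof. by rewrite addr_ge0 ?sqr_ge0. Qed.

Lemma sqn_conj z : sqn z^* = sqn z.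
Proof. by rewrite /sqn; case: z => a b /=; rewrite sqrrN. Qed.

Definition proj K x : H := \sum_(i <- enum_fset K) dot x (e i) *: e i.

Lemma projE K x : proj K x = summability.partial_sum (fun i => dot x (e i) *: e i) K.
Proof. by rewrite /proj /summability.partial_sum big_seq_fsetE. Qed.

Lemma proj_cvg x eps : 0 < eps -> exists K0, forall K, (K0 `<=` K)%fset ->
  nrm (x - proj K x) <= eps.
Proof.
move=> e0; have e0' : 0 < eps%:C by rewrite ltcR.
have FF := @summability.totally_filter I.
have /cvgrPdist_le /(_ _ e0') [K0 _ hK] := he.2 x; exists K0 => K KK.
by have := hK K KK; rewrite /= -projE (normE hH) lecR.
Qed.

Lemma rdot_proj K x y : << x, proj K y >> =
  \sum_(i <- enum_fset K) (complex.Re (dot x (e i)) * complex.Re (dot y (e i)) +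
                        complex.Im (dot x (e i)) * complex.Im (dot y (e i))).
Proof.
rewrite /proj rdot_sumr; apply: eq_bigr => i _.
by rewrite /rdot linearZr_LR/= ReM /=; case: (dot y _) => a b /=; ring.
Qed.

Lemma dot_proj K x i : dot (proj K x) (e i) = if i \in K then dot x (e i) else 0.
Proof.
rewrite /proj linear_sumlz/=.
under eq_bigr do rewrite linearZl_LR/= he.1.
case: ifPn => iK; last first.
  rewrite big1_seq// => j /andP[_ jK]; have [ji|_] := eqVneq j i; last by rewrite mulr0.
  by move: iK; rewrite -ji jK.
rewrite (big_rem i)//= eqxx mulr1 big1_seq ?addr0// => j /andP[_].
by rewrite rem_filter ?fset_uniq// mem_filter /= => /andP[/negPf -> _]; rewrite mulr0.
Qed.

Lemma rdot_proj_self K x : << x, proj K x >> = \sum_(i <- enum_fset K) sqn (dot x (e i)).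
Proof. by rewrite rdot_proj; apply: eq_bigr => i _; rewrite -!expr2. Qed.

Lemma nsq_proj K x : nsq (proj K x) = \sum_(i <- enum_fset K) sqn (dot x (e i)).
Proof.
rewrite /nsq rdot_proj; apply: eq_big_seq => i iK.
by rewrite dot_proj iK -!expr2.
Qed.

Lemma adj_proj K : adj (proj K) (proj K).
Proof.
move=> x y; rewrite rdotC !rdot_proj; apply: eq_bigr => i _.
by congr (_ + _); exact: mulrC.
Qed.

Lemma nsqB_proj K x : nsq (x - proj K x) = nsq x - \sum_(i <- enum_fset K) sqn (dot x (e i)).
Proof. by rewrite nsqB nsq_proj rdot_proj_self; ring. Qed.

Lemma nrm_proj K x : nrm (proj K x) <= nrm x.
Proof.
rewrite -[leRHS]mul1r; apply: nrm_le_sq => //; rewrite expr1n mul1r nsq_proj.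
by have := nsq_ge0 dot (x - proj K x); rewrite nsqB_proj subr_ge0.
Qed.

Lemma lin_proj K : linear (proj K).
Proof.
move=> a u v; rewrite /proj scaler_sumr -big_split; apply: eq_bigr => i _ /=.
by rewrite linearPl/= scalerDl scalerA.
Qed.

Lemma bounded_proj K : bounded_op (proj K).
Proof.
apply/(bounded_opP hH); split; first exact: lin_proj.
by exists 1 => // x; rewrite mul1r nrm_proj.
Qed.

Lemma proj_basis K i : proj K (e i) = if i \in K then e i else 0.
Proof.
rewrite /proj; under eq_bigr do rewrite he.1.
case: ifPn => iK; last first.
  rewrite big1_seq// => j /andP[_ jK]; have [ij|_] := eqVneq i j; last by rewrite scale0r.
  by move: iK; rewrite ij jK.
rewrite (big_rem i)//= eqxx scale1r big1_seq ?addr0// => j /andP[_].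
by rewrite rem_filter ?fset_uniq// mem_filter /= eq_sym => /andP[/negPf -> _]; rewrite scale0r.
Qed.

Lemma nsq_basis i : nsq (e i) = 1.
Proof. by rewrite /nsq /rdot he.1 eqxx. Qed.

Lemma nrm_basis i : nrm (e i) = 1.
Proof. by rewrite /nrm nsq_basis sqrtr1. Qed.

Lemma parseval x : tsum (fun i => sqn (dot x (e i))) = (nsq x)%:E.
Proof.
apply/eqP; rewrite eq_le; apply/andP; split.
  apply: tsum_lub => K; rewrite lee_fin.
  by have := nsq_ge0 dot (x - proj K x); rewrite nsqB_proj subr_ge0.
apply/lee_addgt0Pr => eps e0.
have se : 0 < Num.sqrt eps by rewrite sqrtr_gt0.
have [K hK] := proj_cvg x se.
apply: le_trans (leeD2r _ (tsum_ge K _)); rewrite -EFinD lee_fin.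
have := hK K (fsubset_refl K).
rewrite -lerBlDl -nsqB_proj -nrm_sq => h; rewrite -(sqr_sqrtr (ltW e0)).
by apply: lerXn2r => //; rewrite nnegrE ?nrm_ge0 ?sqrtr_ge0.
Qed.

Definition hs (X : H -> H) : \bar R := tsum (fun i => nsq (X (e i))).

(** By Parseval both sides are the double sum of [|<X e_i, e_j>|^2], in the two orders of summation.
    Every use of cyclicity goes back to this identity, which holds even when both sides are
    infinite. *)
Lemma hs_adj X X' : bounded_op X' -> adj X X' -> hs X = hs X'.
Proof.
move=> bX' aX.
rewrite /hs /tsum; under eq_esum do rewrite -parseval.
under [RHS]eq_esum do rewrite -parseval.
rewrite esum_swap; last by move=> i j; exact: sqn_ge0.
apply: eq_esum => i _; apply: eq_tsum => j.
by rewrite (adj_dot bX' aX) dotC sqn_conj.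
Qed.

Lemma pos_traceE X : pos_trace dot e X = tsum (fun i => << X (e i), e i >>).
Proof. by []. Qed.

Lemma hs_sqrt_op X : positive_op X -> hs (sqrt_op dot X) = pos_trace dot e X.
Proof. by move=> pX; apply: eq_tsum => i; rewrite nsq_sqrt_op. Qed.

Lemma pos_trace_ge0 X : (0 <= pos_trace dot e X)%E.
Proof. exact: tsum_ge0. Qed.

(* The trace of [G Z T Z*] computed in two ways. *)
Lemma tsum_cyclic (G T Z Z' : H -> H) : positive_op G -> positive_op T ->
    bounded_op Z -> bounded_op Z' -> adj Z Z' ->
  tsum (fun i => << G (Z (sqrt_op dot T (e i))), Z (sqrt_op dot T (e i)) >>) =
  tsum (fun i => << T (Z' (sqrt_op dot G (e i))), Z' (sqrt_op dot G (e i)) >>).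
Proof.
move=> pG pT bZ bZ' aZ.
have psG := sqrt_op_positive hH G; have psT := sqrt_op_positive hH T.
transitivity (hs (sqrt_op dot G \o Z \o sqrt_op dot T)).
  by apply: eq_tsum => i /=; rewrite nsq_sqrt_op.
rewrite (@hs_adj _ (sqrt_op dot T \o Z' \o sqrt_op dot G)).
- by apply: eq_tsum => i /=; rewrite nsq_sqrt_op.
- apply: (bounded_comp hH); last exact: positive_bounded psG.
  by apply: (bounded_comp hH) => //; exact: positive_bounded psT.
- rewrite -compA; apply: adj_comp; first exact: positive_adj psG.
  by apply: adj_comp => //; exact: positive_adj psT.
Qed.

End HilbertSchmidt.

Lemma tsum_approx {R : realType} {I : choiceType} (a : I -> R) d :
  (tsum a < +oo)%E -> 0 < d -> exists K,
  (tsum a <= (\sum_(i <- enum_fset K) a i)%:E + d%:E)%E.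
Proof.
move=> afin d0; apply: contrapT => /forallNP none.
have afn : tsum a \is a fin_num by rewrite ge0_fin_numE// tsum_ge0.
have : (tsum a <= tsum a - d%:E)%E.
  apply: tsum_lub => K; rewrite leeBrDr//; apply/ltW.
  by rewrite ltNge; apply/negP => h; apply: (none K).
by rewrite leNgt => /negP; apply; rewrite lteBlDr// lteDl// lte_fin.
Qed.

(** * Young's inequality for the trace *)

Section TraceYoung.
Context {R : realType} {H : completeNormedModType R[i]}.
Variable dot : {dot H for (@Num.conj R[i])}.
Hypothesis hH : hilbert_dot dot.
Variables (I : countType) (e : I -> H).
Hypothesis he : orthonormal_basis dot e.
Local Notation "<< x , y >>" := (rdot dot x y).
Local Notation nsq := (nsq dot).
Local Notation nrm := (nrm dot).
Local Notation adj := (adj dot).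
Local Notation positive_op := (positive_op dot).
Local Notation sq := (sqrt_op dot).
Local Notation Tr := (pos_trace dot e).
Variables (p q : R).
Hypotheses (p1 : 1 < p) (q1 : 1 < q) (pq : p^-1 + q^-1 = 1).
Implicit Types (S T Z : H -> H).

Let p0 : 0 < p. Proof. exact: lt_trans p1. Qed.
Let q0 : 0 < q. Proof. exact: lt_trans q1. Qed.

(** For a fixed [b], Young's inequality puts a polynomial of degree at most [1] in [t] below [t^p],
    and the calculus of [S] preserves this order. *)
Lemma operator_young S b lam w : positive_op S -> 0 <= b -> 0 < lam ->
  b * << S w, w >> <=
  lam `^ p / p * << power_op S p w, w >> + (lam^-1) `^ q / q * (b `^ q * nsq w).
Proof.
move=> pS b0 l0; have [bS sS S0] := (positive_opP dot S).1 pS.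
have M0 := opnorm_ge0 hH bS; have lS := lin_bounded bS.
have SM x := positive_opnorm hH x pS.
have lp : 0 < lam `^ p by apply: powR_gt0.
(* [P.[t] <= t^p] is Young's inequality for the product [(lam t) (b / lam)], solved for [t^p]. *)
pose P : {poly R} := (p / lam `^ p) *: (b *: 'X - ((lam^-1) `^ q / q * b `^ q)%:P).
have aP : approximable (opnorm S) (horner P).
  by move=> eps e0; exists P => t _ _; rewrite subrr normr0 ltW.
have PE t : P.[t] = p / lam `^ p * (b * t - (lam^-1) `^ q / q * b `^ q).
  by rewrite /P !(hornerZ, hornerD, hornerN, hornerX, hornerC).
have : << poly_op P S w, w >> <= << power_op S p w, w >>.
  have fP := fcalc_poly bS sS M0 S0 SM (q := P).
  have fp := power_op_fcalc hH pS (@approximable_powR _ _ _ p1).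
  apply: (fcalc_le bS sS M0 S0 SM aP (@approximable_powR _ _ _ p1) fP fp) => t t0 tM.
  rewrite PE mulrAC ler_pdivrMr// mulrC -ler_pdivlMr// mulrAC -(@powRM _ t lam p t0 (ltW l0)).
  rewrite lerBlDr.
  have := @conjugate_powR _ (t * lam) (b / lam) p q; rewrite !mulr_ge0 ?invr_ge0 ?(ltW l0)//.
  move=> /(_ isT isT p0 q0 pq).
  have -> : t * lam * (b / lam) = b * t by field; rewrite gt_eqF.
  by rewrite (powRM _ b0) ?invr_ge0 ?(ltW l0)// (mulrC (b `^ q)).
rewrite /P poly_opZ rdotZl poly_opB poly_opZ poly_opX// poly_opC rdotBl !rdotZl => h.
have : lam `^ p / p * (p / lam `^ p * (b * << S w, w >> - lam^-1 `^ q / q * b `^ q * nsq w)) <=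
  lam `^ p / p * << power_op S p w, w >>.
  by rewrite ler_pM2l ?divr_gt0.
have -> : forall z, lam `^ p / p * (p / lam `^ p * z) = z.
  by move=> z; field; rewrite !gt_eqF.
by rewrite lerBlDr mulrA.
Qed.

Section Bound.
Variables (S T Z Z' : H -> H) (lam : R).
Hypotheses (pS : positive_op S) (pT : positive_op T).
Hypotheses (bZ : bounded_op Z) (bZ' : bounded_op Z') (aZ : adj Z Z').
Hypotheses (cZ : forall x, nrm (Z x) <= nrm x) (cZ' : forall x, nrm (Z' x) <= nrm x).
Hypothesis lam0 : 0 < lam.

Let M := opnorm T + 1.
Let oT : 0 <= opnorm T. Proof. exact: (opnorm_ge0 hH (positive_bounded pT)). Qed.
Let M0 : 0 < M. Proof. by rewrite ltr_wpDl. Qed.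
Let TM : opnorm T <= M. Proof. by rewrite lerDl. Qed.
Let lT : linear T. Proof. exact: (positive_linear pT). Qed.
Let TMx x : << T x, x >> <= M * nsq x.
Proof. by rewrite (le_trans (positive_opnorm hH x pT))// ler_wpM2r ?nsq_ge0. Qed.

Let beta n l := poly_op (bern M n l) T.

Let beta_pos n l : positive_op (beta n l).
Proof.
apply: positive_poly_op => // t t0 tM; apply: bern_ge0 => //.
exact: le_trans TM.
Qed.

Let nsq_contraction (V : H -> H) x : (forall x, nrm (V x) <= nrm x) -> nsq (V x) <= nsq x.
Proof.
by move=> cV; rewrite -!nrm_sq; apply: lerXn2r; rewrite ?nnegrE ?nrm_ge0.
Qed.

Let bernq n : {poly R} := bern_poly M (fun t => t `^ q) n.

Let c1 := lam `^ p / p.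
Let c2 := (lam^-1) `^ q / q.
Let c10 : 0 <= c1. Proof. by rewrite divr_ge0 ?powR_ge0// ltW. Qed.
Let c20 : 0 <= c2. Proof. by rewrite divr_ge0 ?powR_ge0// ltW. Qed.

(** [T] splits into positive pieces [b_l beta_l]. For each piece cyclicity turns the trace into a
    sum of [<S w, w>] over [w = Z beta_l^(1/2) e_i], where [operator_young] applies with [b = b_l];
    cyclicity then moves [S^p] back. *)
Let trace_young_bern n :
  (tsum (fun i => << T (Z' (sq S (e i))), Z' (sq S (e i)) >>) <=
   c1%:E * Tr (power_op S p) +
   c2%:E * tsum (fun i => << poly_op (bernq n.+1) T (e i), e i >>))%E.
Proof.
have pSp := power_op_positive hH pS p1.
have b0 (l : 'I_n.+2) : 0 <= bnode M n.+1 l.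
  by have /andP[] := @bnode_itv _ M n.+1 l M0 (ltn_ord l).
pose z i := Z' (sq S (e i)); pose y i := Z' (sq (power_op S p) (e i)).
have -> : tsum (fun i => << T (z i), z i >>) =
    (\sum_(l < n.+2) tsum (fun i => (bnode M n.+1 l * << beta n.+1 l (z i), z i >>)%R))%E.
  rewrite -tsum_sum; last by move=> l i; rewrite mulr_ge0// positive_ge0.
  apply: eq_tsum => i; rewrite -(poly_opX lT) -(sum_bern_node n M0) poly_op_sum.
  by rewrite rdot_suml; apply: eq_bigr => l _; rewrite poly_opZ rdotZl.
apply: (@le_trans _ _ (\sum_(l < n.+2)
   (tsum (fun i => (c1 * << beta n.+1 l (y i), y i >>)%R) +
    tsum (fun i => (c2 * ((bnode M n.+1 l) `^ q * << beta n.+1 l (e i), e i >>))%R)))%E).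
  apply: lee_sum => l _; rewrite tsumZ//.
  rewrite -(tsum_cyclic hH he pS (beta_pos n.+1 l) bZ bZ' aZ) -tsumZ//.
  set w := fun i => Z (sq (beta n.+1 l) (e i)).
  rewrite [X in (_ <= X + _)%E]tsumZ//.
  rewrite -(tsum_cyclic hH he pSp (beta_pos n.+1 l) bZ bZ' aZ) -tsumZ//.
  rewrite -tsumD; last 2 first.
  - by move=> i; apply: mulr_ge0 => //; exact: positive_ge0.
  - by move=> i; apply: mulr_ge0 => //; apply: mulr_ge0; rewrite ?powR_ge0//; exact: positive_ge0.
  apply: le_tsum => i; apply: le_trans (operator_young _ pS (b0 l) lam0) _.
  rewrite lerD2l ler_wpM2l// ler_wpM2l ?powR_ge0//.
  by rewrite (le_trans (nsq_contraction _ cZ))// nsq_sqrt_op.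
rewrite big_split/= -!tsum_sum; last 2 first.
- by move=> l i; apply: mulr_ge0 => //; apply: mulr_ge0; rewrite ?powR_ge0//; exact: positive_ge0.
- by move=> l i; apply: mulr_ge0 => //; exact: positive_ge0.
(* The pieces [beta_l] add up to the identity, which recombines the terms in [S^p]; the remaining
   [Z'] is a contraction. *)
apply: leeD.
  rewrite pos_traceE -tsumZ//; apply: le_tsum => i.
  rewrite -mulr_sumr ler_wpM2l// -rdot_suml -poly_op_sum sum_bern poly_op1.
  by rewrite -/(nsq _) (le_trans (nsq_contraction _ cZ'))// nsq_sqrt_op.
rewrite -tsumZ//; apply: le_tsum => i.
rewrite -mulr_sumr ler_wpM2l// /bernq /bern_poly poly_op_sum rdot_suml.
by apply: ler_sum => l _; rewrite poly_opZ rdotZl.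
Qed.

(** Uniform convergence does not control an infinite trace. Off a finite set [K] of basis vectors
    the trace of [T] is small and [bernq(T) <= M^(q-1) T]; on [K] uniform convergence is enough. *)
Let trace_bern_limit eps : (Tr T < +oo)%E -> 0 < eps -> exists n,
  (tsum (fun i => << poly_op (bernq n.+1) T (e i), e i >>) <=
   Tr (power_op T q) + eps%:E)%E.
Proof.
move=> Tfin e0; have [bT sT T0] := (positive_opP dot T).1 pT.
have pTq := power_op_positive hH pT q1.
have Mq0 := powR_ge0 M (q - 1).
have [d d0 dM] : exists2 d, 0 < d & d * M `^ (q - 1) <= eps / 2.
  by apply: small_factor; rewrite ?divr_gt0.
have [K hK] := tsum_approx Tfin d0.
have [eta eta0 etaK] : exists2 eta, 0 < eta & eta * (size (enum_fset K))%:R <= eps / 2.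
  by apply: small_factor; rewrite ?divr_gt0.
have [N hN] := bern_poly_approx M0 (quad_modulus_powR M q1) eta0.
exists N; set B := bernq N.+1.
have B0 i : 0 <= << poly_op B T (e i), e i >>.
  rewrite /B /bernq /bern_poly poly_op_sum rdot_suml; apply: sumr_ge0 => l _.
  rewrite poly_opZ rdotZl mulr_ge0 ?powR_ge0//.
  exact: (positive_ge0 _ (beta_pos _ _)).
(* The nodes satisfy [b^q <= M^(q-1) b], and the sum of [b_l beta_l] is ['X]. *)
have BT i : << poly_op B T (e i), e i >> <= M `^ (q - 1) * << T (e i), e i >>.
  rewrite -rdotZl -(poly_opX lT) -poly_opZ.
  apply: (poly_op_le lT sT T0 TMx (ltW M0)) => t t0 tM.
  rewrite hornerZ -(sum_bern_node N M0) /B /bernq /bern_poly !horner_sum mulr_sumr.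
  apply: ler_sum => l _; rewrite !hornerZ mulrA ler_wpM2r ?bern_ge0//.
  have /andP[b0 bM] := @bnode_itv _ M N.+1 l M0 (ltn_ord l).
  rewrite -(mulr_powRB1 b0 q0) mulrC ler_wpM2r// ge0_ler_powR ?nnegrE ?(ltW M0)//.
  by rewrite subr_ge0 ltW.
have Bq i : << poly_op B T (e i), e i >> <= << power_op T q (e i), e i >> + eta.
  rewrite -lerBlDl -rdotBl (le_trans (ler_norm _))// (le_trans (rdot_le _ _ _))//.
  rewrite (nrm_basis he) mulr1 -[leRHS]mulr1 -(nrm_basis he i).
  apply: (power_op_fcalc hH pT (@approximable_powR _ _ _ q1)) => // t t0 tM.
  by apply: hN => //; apply: le_trans TM.
rewrite (tsum_split K)//.
have -> : eps = eps / 2 + eps / 2 by rewrite -splitr.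
rewrite EFinD addeA; apply: leeD.
  apply: (@le_trans _ _
      ((\sum_(i <- enum_fset K) << power_op T q (e i), e i >>)%:E + (eps / 2)%:E)%E).
    rewrite -EFinD lee_fin (le_trans (ler_sum _ (fun i _ => Bq i)))// big_split/=.
    by rewrite lerD2l big_const_seq count_predT iter_addr_0 -[leLHS]mulr_natr.
  by apply: leeD2r; rewrite pos_traceE; exact: tsum_ge.
apply: (@le_trans _ _ (tsum (fun i => M `^ (q - 1) * (if i \in K then 0 else << T (e i), e i >>)))).
  by apply: le_tsum => i; case: ifP => _; rewrite ?mulr0.
rewrite tsumZ; last exact: powR_ge0.
apply: (@le_trans _ _ ((M `^ (q - 1))%:E * d%:E)%E); last by rewrite -EFinM lee_fin mulrC.
apply: lee_wpmul2l; first by rewrite lee_fin.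
have : (tsum (fun i => << T (e i), e i >>) <=
  (\sum_(i <- enum_fset K) << T (e i), e i >>)%:E + d%:E)%E by exact: hK.
rewrite (tsum_split K); last by move=> i; exact: positive_ge0.
by rewrite leeD2lE.
Qed.

Theorem trace_young : (Tr T < +oo)%E ->
  (tsum (fun i => << S (Z (sq T (e i))), Z (sq T (e i)) >>) <=
   (lam `^ p / p)%:E * Tr (power_op S p) + ((lam^-1) `^ q / q)%:E * Tr (power_op T q))%E.
Proof.
move=> Tfin; rewrite (tsum_cyclic hH he pS pT bZ bZ' aZ).
apply/lee_addgt0Pr => eps e0.
have [d d0 dc] : exists2 d, 0 < d & d * c2 <= eps by apply: small_factor.
have [n hn] := trace_bern_limit Tfin d0.
apply: le_trans (trace_young_bern n) _; rewrite -addeA; apply: leeD => //.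
apply: (@le_trans _ _ (c2%:E * (Tr (power_op T q) + d%:E))%E).
  by apply: lee_wpmul2l; rewrite ?lee_fin.
rewrite ge0_muleDr ?lee_fin ?(ltW d0)//; last exact: pos_trace_ge0.
by apply: leeD => //; rewrite -EFinM lee_fin mulrC.
Qed.

End Bound.
End TraceYoung.

(** * From Young's inequality to the trace of [|A B|] *)

Section TraceHoelder.
Context {R : realType} {H : completeNormedModType R[i]}.
Variable dot : {dot H for (@Num.conj R[i])}.
Hypothesis hH : hilbert_dot dot.
Variables (I : countType) (e : I -> H).
Hypothesis he : orthonormal_basis dot e.
Local Notation "<< x , y >>" := (rdot dot x y).
Local Notation nsq := (nsq dot).
Local Notation nrm := (nrm dot).
Local Notation adj := (adj dot).
Local Notation positive_op := (positive_op dot).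
Local Notation sq := (sqrt_op dot).
Local Notation abs := (abs_op dot).
Local Notation Tr := (pos_trace dot e).
Local Notation hs := (hs dot e).
Implicit Types (A B S T V Z X Y : H -> H) (F : {fset I}).

Lemma adjD A A' B B' : adj A A' -> adj B B' -> adj (A \+ B) (A' \+ B').
Proof. by move=> hA hB x y /=; rewrite rdotDl rdotDr hA hB. Qed.

Lemma adjB A A' B B' : adj A A' -> adj B B' -> adj (A \- B) (A' \- B').
Proof. by move=> hA hB x y /=; rewrite rdotBl rdotBr hA hB. Qed.

Lemma contraction_adj V V' : adj V V' -> (forall x, nrm (V x) <= nrm x) ->
  forall x, nrm (V' x) <= nrm x.
Proof.
move=> aV cV x; have [->|v0] := eqVneq (nrm (V' x)) 0; first exact: nrm_ge0.
have vp : 0 < nrm (V' x) by rewrite lt_neqAle eq_sym v0 nrm_ge0.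
rewrite -(ler_pM2l vp) -expr2 nrm_sq /nsq -aV (le_trans (ler_norm _))//.
by rewrite (le_trans (rdot_le _ _ _))// ler_wpM2r ?nrm_ge0.
Qed.

Lemma positive_form_young S x y : positive_op S ->
  << S x, y >> <= 2^-1 * (<< S x, x >> + << S y, y >>).
Proof.
move=> pS; rewrite -!(nsq_sqrt_op hH _ pS) -(sqrt_opK hH pS).
by rewrite (positive_adj (sqrt_op_positive hH S)) rdot_young.
Qed.

(* Cyclicity of the trace in the form [Re Tr (X Y) = Re Tr (X Y')], read off the polarised
   Hilbert-Schmidt norm, which adjunction preserves. *)
Lemma hs_polar_le (F : {fset I}) X Y Y' (k : R) :
    bounded_op X -> adj X X -> (hs X < +oo)%E ->
    bounded_op Y -> bounded_op Y' -> adj Y Y' ->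
    (forall i, i \notin F -> Y (e i) = 0) ->
  (forall b : I -> R, (forall i, << X (e i), Y' (e i) >> <= b i) -> (forall i, 0 <= b i) ->
     (tsum b <= k%:E)%E -> \sum_(i <- enum_fset F) << X (e i), Y (e i) >> <= k).
Proof.
move=> bX aX fX bY bY' aY Y0 b hb b0 hk.
have hD : hs (X \+ Y) = hs (X \+ Y').
  by apply: (hs_adj hH he); [exact: boundedD|exact: adjD].
have hB : hs (X \- Y) = hs (X \- Y').
  by apply: (hs_adj hH he); [exact: boundedB|exact: adjB].
(* Polarisation makes [4 <X e_i, Y' e_i>] the difference of the two terms. Only the upper bound [b]
   enters, so the series of these products need not converge. *)
have h1 : (hs (X \+ Y')%R <= hs (X \- Y')%R + 4%:E * tsum b)%E.
  rewrite -tsumZ// -tsumD; last 2 first.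
  - by move=> i; exact: nsq_ge0.
  - by move=> i; rewrite mulr_ge0.
  by apply: le_tsum => i /=; rewrite nsqD nsqB; have := hb i; lra.
(* [Y] vanishes at the basis vectors outside [F], so [X + Y] and [X - Y] share this tail, which is
   finite and cancels. *)
have [t tE] : exists t, tsum (fun i => if i \in F then 0 else nsq (X (e i))) = t%:E.
  exists (fine (tsum (fun i => if i \in F then 0 else nsq (X (e i))))).
  rewrite fineK// ge0_fin_numE ?tsum_ge0// (le_lt_trans _ fX)//.
  by apply: le_tsum => i; case: ifP => // _; exact: nsq_ge0.
have split_F Z : (forall i, i \notin F -> nsq (Z (e i)) = nsq (X (e i))) ->
    hs Z = ((\sum_(i <- enum_fset F) nsq (Z (e i)))%:E + t%:E)%E.
  move=> hZ; rewrite /hs (tsum_split F); last by move=> i; exact: nsq_ge0.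
  rewrite -tE; congr (_ + _)%E; apply: eq_tsum => i.
  by case: ifPn => // /hZ.
move: h1; rewrite -hD -hB !split_F; last 2 first.
- by move=> i /Y0 /= ->; rewrite subr0.
- by move=> i /Y0 /= ->; rewrite addr0.
have h4 : (4%:E * tsum b <= (4 * k)%:E)%E by rewrite EFinM lee_pmul2l// lte_fin.
move=> h1; have := le_trans h1 (leeD2l _ h4); rewrite -!EFinD lee_fin => h2.
suff : \sum_(i <- enum_fset F) nsq ((X \+ Y) (e i)) - \sum_(i <- enum_fset F) nsq ((X \- Y) (e i)) =
  4 * \sum_(i <- enum_fset F) << X (e i), Y (e i) >> by move=> h3; lra.
rewrite -sumrB mulr_sumr; apply: eq_bigr => i _ /=.
by rewrite nsqD nsqB; ring.
Qed.

Section Product.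
Variables (p q : R).
Hypotheses (p1 : 1 < p) (q1 : 1 < q) (pq : p^-1 + q^-1 = 1).
Variables (A A' B B' : H -> H).
Hypotheses (bA : bounded_op A) (bA' : bounded_op A') (aA : adj A A').
Hypotheses (bB : bounded_op B) (bB' : bounded_op B') (aB : adj B B').
Hypothesis trB : (Tr (abs B) < +oo)%E.

(** With [|A B| ~ U' A B], [A ~ V S], [B ~ W T] and [h = T^(1/2)], cyclicity leads to
    [<S W h e_i, V' U P h e_i>], where [P] projects onto the span of [F]. By [positive_form_young]
    this is at most the mean of two diagonal terms, of the kind bounded by [trace_young] with
    [Z = W] and [Z = V' U P]. *)
Lemma trace_abs_comp lam : 0 < lam ->
  (Tr (abs (A \o B)) <=
   (lam `^ p / p)%:E * Tr (power_op (abs A) p) +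
   ((lam^-1) `^ q / q)%:E * Tr (power_op (abs B) q))%E.
Proof.
move=> lam0; set k := (X in (_ <= X)%E).
have k0 : (0 <= k)%E.
  by rewrite adde_ge0 ?mule_ge0 ?pos_trace_ge0// lee_fin divr_ge0 ?powR_ge0//
    ltW// (lt_trans ltr01).
case kE : k => [c| |]; [|by rewrite leey|by move: k0; rewrite kE].
set S := abs A; set T := abs B; set P := abs (A \o B).
have pS : positive_op S by exact: abs_op_positive.
have pT : positive_op T by exact: abs_op_positive.
have young Z Z' : bounded_op Z -> bounded_op Z' -> adj Z Z' ->
    (forall x, nrm (Z x) <= nrm x) ->
    (tsum (fun i => << S (Z (sq T (e i))), Z (sq T (e i)) >>) <= c%:E)%E.
  move=> bZ bZ' aZ cZ; rewrite -kE.
  exact: (trace_young hH he p1 q1 pq pS pT bZ bZ' aZ cZ (contraction_adj aZ cZ) lam0 trB).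
rewrite pos_traceE; apply: tsum_lub => F; rewrite lee_fin.
apply/ler_addgt0Pr => eps eps0.
have [NB0 hNB] := opnorm_spec hH bB; set NB := opnorm B in NB0 hNB.
have bS := positive_bounded pS; have bT := positive_bounded pT.
have lS := lin_bounded bS; have lT := lin_bounded bT.
have [NS0 hNS] := opnorm_spec hH bS; set NS := opnorm S in NS0 hNS.
(* Per basis vector the three polar decompositions cost [d] for [A B], [d NB] for [A] applied to
   [B e_i], and [d NS] for [B] followed by [S]. *)
have [d d0 dK] : exists2 d, 0 < d & d * ((1 + NB + NS) * (size (enum_fset F))%:R) <= eps.
  by apply: small_factor => //; rewrite mulr_ge0 ?addr_ge0.
have [V [V' [bV bV' aV cV hV]]] := approx_polar hH bA bA' aA d0.
have [W [W' [bW bW' aW cW hW]]] := approx_polar hH bB bB' aB d0.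
have bAB : bounded_op (A \o B) by exact: bounded_comp.
have bAB' : bounded_op (B' \o A') by exact: bounded_comp.
have [U [U' [bU bU' aU cU hU]]] := approx_polar hH bAB bAB' (adj_comp aA aB) d0.
pose h := sq T; have ph : positive_op h by exact: sqrt_op_positive.
have bh := positive_bounded ph; have ah := positive_adj ph.
(* The projection leaves [L] unchanged at the vectors of [F] and kills the others, as [hs_polar_le]
   requires. *)
pose L := h \o W' \o S \o V' \o U \o proj dot e F.
pose L' := proj dot e F \o U' \o V \o S \o W \o h.
have bP := bounded_proj hH he F.
have aP := adj_proj dot e F.
have sum_c : \sum_(i <- enum_fset F) << h (e i), L (e i) >> <= c.
  pose b i := 2^-1 * (<< S (W (h (e i))), W (h (e i)) >> +
    << S ((V' \o U \o proj dot e F) (h (e i))), (V' \o U \o proj dot e F) (h (e i)) >>).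
  apply: (@hs_polar_le F h L L' c bh ah _ _ _ _ _ b) => //.
  - by rewrite hs_sqrt_op.
  - by do 5 (apply: (bounded_comp hH); last by []).
  - by do 5 (apply: (bounded_comp hH); last by []).
  - move=> x y; rewrite /L /L' /= ah (adjC aW) (positive_adj pS) (adjC aV) aU.
    by rewrite aP.
  - move=> i iF; rewrite /L /= (proj_basis he) (negbTE iF).
    rewrite (lin0 (lin_bounded bU)) (lin0 (lin_bounded bV')) (lin0 lS).
    by rewrite (lin0 (lin_bounded bW')) (lin0 (lin_bounded bh)).
  - move=> i; rewrite /L' /= -aP -aU -(adjC aV) rdotC; exact: positive_form_young.
  - by move=> i; rewrite mulr_ge0 ?invr_ge0 ?addr_ge0 ?positive_ge0.
  rewrite tsumZ ?invr_ge0// tsumD; last 2 first.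
  - by move=> i; exact: positive_ge0.
  - by move=> i; exact: positive_ge0.
  apply: (@le_trans _ _ ((2^-1)%:E * (c%:E + c%:E))%E).
    apply: lee_wpmul2l; first by rewrite lee_fin invr_ge0.
    apply: leeD; first exact: (young W W').
    apply: (young _ (proj dot e F \o U' \o V)).
    - by do 2 (apply: (bounded_comp hH); last by []).
    - by do 2 (apply: (bounded_comp hH); last by []).
    - by move=> x y /=; rewrite (adjC aV) aU aP.
    - move=> x /=; rewrite (le_trans (contraction_adj aV cV _))// (le_trans (cU _))//.
      exact: nrm_proj.
  by rewrite -EFinD -EFinM lee_fin; lra.
apply: (@le_trans _ _ (\sum_(i <- enum_fset F) (<< h (e i), L (e i) >> + d * (1 + NB + NS)))).
  rewrite big_seq [leRHS]big_seq; apply: ler_sum => i iF.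
  have n1 := nrm_basis he i.
  have e1 : << P (e i), e i >> <= << U' (A (B (e i))), e i >> + d.
    rewrite -lerBlDl -rdotBl (le_trans (ler_norm _))// (le_trans (rdot_le _ _ _))//.
    by rewrite n1 mulr1; have := (hU (e i)).2; rewrite n1 mulr1.
  have e2 : << A (B (e i)), U (e i) >> <= << V (S (W (T (e i)))), U (e i) >> + d * (NB + NS).
    rewrite -lerBlDl -rdotBl (le_trans (ler_norm _))// (le_trans (rdot_le _ _ _))//.
    rewrite -[leRHS]mulr1; apply: ler_pM; rewrite ?nrm_ge0//; last by rewrite -n1.
    apply: le_trans (nrm_triangle _ (V (S (B (e i)))) _ _) _; rewrite mulrDr; apply: lerD.
      rewrite (le_trans (hV _).1)// ler_wpM2l ?(ltW d0)// -[leRHS]mulr1 -n1; exact: hNB.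
    rewrite -linB; last exact: lin_bounded.
    rewrite -linB// (le_trans (cV _))// (le_trans (hNS _))// mulrC ler_wpM2r//.
    by have := (hW (e i)).1; rewrite n1 mulr1.
  have e3 : << V (S (W (T (e i)))), U (e i) >> = << h (e i), L (e i) >>.
    rewrite /L /= (proj_basis he) iF -ah /h sqrt_opK// -aW -(positive_adj pS).
    by rewrite -aV.
  by move: e1; rewrite (adjC aU) -/(_ \o _) => e1; lra.
rewrite big_split/= big_const_seq count_predT iter_addr_0 -[X in _ + X]mulr_natr.
by apply: lerD => //; rewrite -mulrA.
Qed.

End Product.
End TraceHoelder.

(** The two terms balance at [lam^(p+q) = b/a], and [p + q = p q]; hence [lam = (b/a)^(1/(p q))]. *)
Lemma young_optimal {R : realType} (p q a b x : R) :
  1 < p -> 1 < q -> p^-1 + q^-1 = 1 -> 0 <= a -> 0 <= b ->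
  (forall lam, 0 < lam -> x <= lam `^ p / p * a + (lam^-1) `^ q / q * b) ->
  x <= a `^ p^-1 * b `^ q^-1.
Proof.
move=> p1 q1 pq a0 b0 hx.
have p0 : 0 < p by rewrite (lt_trans ltr01).
have q0 : 0 < q by rewrite (lt_trans ltr01).
(* With [a = 0] the bound is reached in the limit of large [lam], here [lam^(-q) = d]. *)
have [aE|an0] := eqVneq a 0.
  rewrite aE powR0 ?invr_eq0 ?gt_eqF// mul0r; apply/ler_addgt0Pr => eps e0; rewrite add0r.
  have [d d0 db] : exists2 d, 0 < d & d * (b / q) <= eps.
    by apply: small_factor => //; rewrite divr_ge0// ltW.
  have l0 : 0 < (d `^ q^-1)^-1 by rewrite invr_gt0 powR_gt0.
  have := hx _ l0; rewrite aE mulr0 add0r invrK -powRrM mulVf ?gt_eqF// (powRr1 (ltW d0)).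
  by move=> /le_trans; apply; rewrite -mulrA (mulrC q^-1).
have [bE|bn0] := eqVneq b 0.
  rewrite bE (@powR0 _ q^-1) ?invr_eq0 ?gt_eqF// mulr0; apply/ler_addgt0Pr => eps e0; rewrite add0r.
  have [d d0 db] : exists2 d, 0 < d & d * (a / p) <= eps.
    by apply: small_factor => //; rewrite divr_ge0// ltW.
  have l0 : 0 < d `^ p^-1 by rewrite powR_gt0.
  have := hx _ l0; rewrite bE mulr0 addr0 -powRrM mulVf ?gt_eqF// (powRr1 (ltW d0)).
  by move=> /le_trans; apply; rewrite -mulrA (mulrC p^-1).
have ap : 0 < a by rewrite lt_neqAle eq_sym an0.
have bp : 0 < b by rewrite lt_neqAle eq_sym bn0.
pose lam := b `^ (p^-1 * q^-1) * a `^ (- (p^-1 * q^-1)).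
have l0 : 0 < lam by rewrite mulr_gt0 ?powR_gt0.
have lp : lam `^ p * a = a `^ p^-1 * b `^ q^-1.
  rewrite /lam powRM ?powR_ge0// -!powRrM.
  have -> : p^-1 * q^-1 * p = q^-1 by field; rewrite !gt_eqF.
  have -> : - (p^-1 * q^-1) * p = p^-1 - 1 by rewrite -pq; field; rewrite !gt_eqF.
  rewrite -mulrA -{2}(powRr1 a0) -powRD ?an0 ?implybT// subrK; exact: mulrC.
have lq : (lam^-1) `^ q * b = a `^ p^-1 * b `^ q^-1.
  rewrite /lam invfM -!powRN opprK powRM ?powR_ge0// -!powRrM.
  have -> : p^-1 * q^-1 * q = p^-1 by field; rewrite !gt_eqF.
  have -> : - (p^-1 * q^-1) * q = q^-1 - 1 by rewrite -pq; field; rewrite !gt_eqF.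
  rewrite mulrAC -{2}(powRr1 b0) -powRD ?bn0 ?implybT// subrK; exact: mulrC.
have := hx _ l0; rewrite (mulrAC _ p^-1) lp (mulrAC _ q^-1) lq -mulrDr pq mulr1.
exact.
Qed.

(** * Hoelder's inequality for Schatten norms *)

Section SchattenHoelder.
Context {R : realType} {H : completeNormedModType R[i]}.
Variable dot : {dot H for (@Num.conj R[i])}.
Hypothesis hH : hilbert_dot dot.
Variables (I : countType) (e : I -> H).
Hypothesis he : orthonormal_basis dot e.
Local Notation "<< x , y >>" := (rdot dot x y).
Local Notation nsq := (nsq dot).
Local Notation nrm := (nrm dot).
Local Notation adj := (adj dot).
Local Notation positive_op := (positive_op dot).
Local Notation sq := (sqrt_op dot).
Local Notation abs := (abs_op dot).
Local Notation Tr := (pos_trace dot e).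
Local Notation hs := (hs dot e).
Implicit Types (A B S T V Z X Y : H -> H) (F : {fset I}).

(** Trace class is enough because [t^p <= M^(p-1) t] on [[0, M]]. *)
Lemma trace_power_fin S p : positive_op S -> 1 < p -> (Tr S < +oo)%E ->
  (Tr (power_op S p) < +oo)%E.
Proof.
move=> pS p1 Sfin; have [bS sS S0] := (positive_opP dot S).1 pS.
have M0 := opnorm_ge0 hH bS.
have SM x := positive_opnorm hH x pS; set M := opnorm S in M0 SM.
have le i : << power_op S p (e i), e i >> <= M `^ (p - 1) * << S (e i), e i >>.
  rewrite -rdotZl -(poly_opX (positive_linear pS)) -poly_opZ.
  have ap := @approximable_powR R M p p1.
  have aP : approximable M (horner (M `^ (p - 1) *: 'X)).
    by move=> eps e0; exists (M `^ (p - 1) *: 'X) => t _ _; rewrite subrr normr0 ltW.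
  have fP := fcalc_poly bS sS M0 S0 SM (q := M `^ (p - 1) *: 'X).
  apply: (fcalc_le bS sS M0 S0 SM ap aP (power_op_fcalc hH pS ap) fP) => t t0 tM.
  rewrite hornerZ hornerX -(mulr_powRB1 t0 (lt_trans ltr01 p1)) mulrC ler_wpM2r//.
  by rewrite ge0_ler_powR ?nnegrE// subr_ge0 ltW.
rewrite pos_traceE (le_lt_trans (le_tsum le))// tsumZ ?powR_ge0//.
by rewrite lte_mul_pinfty// lee_fin powR_ge0.
Qed.

(** With [|B| ~ U' B], the diagonal terms are [<C r e_i, r U e_i>], at most half of
    [N^2 nsq (r e_i) + nsq (r U e_i)]. The second sum is that of [U' r] by adjunction, and [U'] is a
    contraction. *)
Lemma trace_class_sandwich (r C C' : H -> H) : positive_op r -> (hs r <= 1)%E ->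
  bounded_op C -> bounded_op C' -> adj C C' -> (Tr (abs (r \o C \o r)) < +oo)%E.
Proof.
move=> pr r1 bC bC' aC; set B := r \o C \o r.
have br := positive_bounded pr; have ar := positive_adj pr.
have bB : bounded_op B by do 2 apply: (bounded_comp hH) => //.
have bB' : bounded_op (r \o C' \o r) by do 2 apply: (bounded_comp hH) => //.
have aB : adj B (r \o C' \o r) by move=> x y; rewrite /B /= ar aC ar.
have [NC0 hNC] := opnorm_spec hH bC; set N := opnorm C in NC0 hNC.
(* The last [1] pays for the error of the polar decomposition over [F]. *)
pose c := 2^-1 * (N ^+ 2 + 1) + 1.
apply: (@le_lt_trans _ _ c%:E); last exact: ltry.
rewrite pos_traceE; apply: tsum_lub => F; rewrite lee_fin.
have [d d0 dK] : exists2 d : R, 0 < d & d * (size (enum_fset F))%:R <= 1.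
  exact: (small_factor ltr01 (ler0n _ _)).
have [U [U' [bU bU' aU cU hU]]] := approx_polar hH bB bB' aB d0.
pose b i := 2^-1 * (N ^+ 2 * nsq (r (e i)) + nsq (r (U (e i)))).
have hsU : (hs (r \o U) <= 1)%E.
  rewrite (@hs_adj _ _ _ hH _ _ he _ (U' \o r)).
  - apply: le_trans r1; apply: le_tsum => i /=.
    by rewrite -!nrm_sq; apply: lerXn2r; rewrite ?nnegrE ?nrm_ge0// (contraction_adj aU cU).
  - by apply: (bounded_comp hH).
  - by apply: adj_comp.
have sb : (\sum_(i <- enum_fset F) b i <= 2^-1 * (N ^+ 2 + 1)).
  rewrite -lee_fin; apply: le_trans (tsum_ge F b) _.
  rewrite tsumZ ?invr_ge0// EFinM; apply: lee_wpmul2l; first by rewrite lee_fin invr_ge0.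
  rewrite tsumD; last 2 first.
  - by move=> i; rewrite mulr_ge0 ?sqr_ge0 ?nsq_ge0.
  - by move=> i; exact: nsq_ge0.
  rewrite EFinD; apply: leeD => //.
  rewrite tsumZ ?sqr_ge0// -[leRHS]mule1; apply: lee_wpmul2l => //.
  by rewrite lee_fin sqr_ge0.
apply: (@le_trans _ _ (\sum_(i <- enum_fset F) (b i + d))).
  apply: ler_sum => i _; have n1 := nrm_basis he i.
  have e1 : << abs B (e i), e i >> <= << U' (B (e i)), e i >> + d.
    rewrite -lerBlDl -rdotBl (le_trans (ler_norm _))// (le_trans (rdot_le _ _ _))//.
    by rewrite n1 mulr1; have := (hU (e i)).2; rewrite n1 mulr1.
  apply: le_trans e1 _; rewrite lerD2r rdotC -aU rdotC /B /= ar.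
  apply: le_trans (rdot_young _ _ _) _; rewrite /b ler_wpM2l ?invr_ge0// lerD2r.
  exact: nsq_le_nrm.
rewrite big_split/= big_const_seq count_predT iter_addr_0 -[X in _ + X]mulr_natr.
by apply: lerD.
Qed.

Lemma schatten1 A : schatten dot e 1 A = Tr (abs A).
Proof.
by rewrite /schatten invr1 (power_op1 hH (abs_op_positive hH A)) poweRe1// pos_trace_ge0.
Qed.

Lemma schatten_fin p A : 1 < p -> (Tr (abs A) < +oo)%E ->
  schatten dot e p A = ((fine (Tr (power_op (abs A) p))) `^ p^-1)%:E.
Proof.
move=> p1 fA; rewrite /schatten -[Tr (power_op _ _)]fineK//.
rewrite ge0_fin_numE ?pos_trace_ge0//.
by apply: trace_power_fin => //; exact: abs_op_positive.
Qed.

Theorem schatten_hoelder (p q : R) (A A' B B' : H -> H) :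
    1 < p -> 1 < q -> p^-1 + q^-1 = 1 ->
    bounded_op A -> bounded_op A' -> adj A A' ->
    bounded_op B -> bounded_op B' -> adj B B' ->
    (Tr (abs A) < +oo)%E -> (Tr (abs B) < +oo)%E ->
  (schatten dot e 1 (A \o B) <= schatten dot e p A * schatten dot e q B)%E.
Proof.
move=> p1 q1 pq bA bA' aA bB bB' aB fA fB.
have fin S r : positive_op S -> 1 < r -> (Tr S < +oo)%E ->
    Tr (power_op S r) \is a fin_num.
  by move=> pS r1 fS; rewrite ge0_fin_numE ?pos_trace_ge0// trace_power_fin.
have pA := abs_op_positive hH A; have pB := abs_op_positive hH B.
rewrite schatten1 !schatten_fin// -EFinM.
have bound lam (l0 : 0 < lam) :=
  trace_abs_comp hH he p1 q1 pq bA bA' aA bB bB' aB fB l0.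
(* [lam = 1] already shows that the trace of [|A B|] is finite, so that the optimisation over [lam]
   takes place in [R]. *)
have fAB : Tr (abs (A \o B)) \is a fin_num.
  rewrite ge0_fin_numE ?pos_trace_ge0// (le_lt_trans (bound 1 ltr01))//.
  by rewrite -(fineK (fin _ _ pA p1 fA)) -(fineK (fin _ _ pB q1 fB)) -!EFinM -EFinD ltry.
rewrite -(fineK fAB) lee_fin; apply: young_optimal => //.
- by rewrite fine_ge0 ?pos_trace_ge0.
- by rewrite fine_ge0 ?pos_trace_ge0.
move=> lam l0; have := bound lam l0.
rewrite -(fineK (fin _ _ pA p1 fA)) -(fineK (fin _ _ pB q1 fB)) -{1}(fineK fAB).
by rewrite -!EFinM -EFinD lee_fin.
Qed.

(** The terms being nonnegative, a finite partial sum above [1] would persist in all larger ones,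
    against convergence to [1]. *)
Lemma state_hs (s : H -> H) : state dot e s -> (hs (sq s) <= 1)%E.
Proof.
move=> [ps ts]; rewrite hs_sqrt_op// pos_traceE; apply: tsum_lub => F; rewrite lee_fin.
rewrite leNgt; apply/negP => h.
set x := \sum_(i <- _) _ in h.
have FF := @summability.totally_filter I.
have d0 : 0 < (x - 1)%:C by rewrite ltcR subr_gt0.
have /cvgrPdist_lt /(_ _ d0) [K0 _ hK] := ts.
have /= := hK (K0 `|` F)%fset (fsubsetUl _ _).
set y := summability.partial_sum _ _.
have yx : x <= complex.Re y.
  have -> : y = \sum_(i <- enum_fset (K0 `|` F)%fset) dot (s (e i)) (e i).
    by rewrite /y /summability.partial_sum big_seq_fsetE.
  rewrite (big_morph (@complex.Re R) (@ReD R) erefl) -lee_fin -!sumEFin.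
  apply: lee_sum_nneg_subfset => [i|i _ _]; last by rewrite lee_fin positive_ge0.
  exact: (fsubsetP (fsubsetUr K0 F)).
rewrite distrC normc_def ltcR ReD ReN /= => h2.
have : x - 1 <= Num.sqrt ((x - 1) ^+ 2) by rewrite sqrtr_sqr ler_norm.
rewrite leNgt => /negP; apply; apply: le_lt_trans h2.
rewrite ler_sqrt ?addr_ge0 ?sqr_ge0//.
rewrite (@le_trans _ _ ((complex.Re y - 1) ^+ 2)) ?lerDl ?sqr_ge0//.
apply: lerXn2r; rewrite ?nnegrE ?subr_ge0 ?(ltW h)//; last by rewrite lerD2r.
by rewrite (le_trans (ltW h)).
Qed.

End SchattenHoelder.

(** * Measurability of complex-valued functions *)

Section ComplexMeasurable.
Context {R : realType} {d : measure_display} {X : measurableType d}.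
Implicit Types (g h : X -> R[i]).

Definition cmeas h := measurable_fun [set: X] (fun x => complex.Re (h x)) /\
  measurable_fun [set: X] (fun x => complex.Im (h x)).

Lemma cmeas_cst c : cmeas (cst c).
Proof. by split; exact: measurable_cst. Qed.

Lemma cmeasD g h : cmeas g -> cmeas h -> cmeas (fun x => g x + h x).
Proof.
move=> [g1 g2] [h1 h2]; split.
  by under eq_fun do rewrite ReD; exact: measurable_funD.
by under eq_fun do rewrite ImD; exact: measurable_funD.
Qed.

Lemma cmeasM g h : cmeas g -> cmeas h -> cmeas (fun x => g x * h x).
Proof.
move=> [g1 g2] [h1 h2]; split.
  under eq_fun do rewrite ReM.
  by apply: measurable_funB; exact: measurable_funM.
under eq_fun do rewrite ImM.
by apply: measurable_funD; exact: measurable_funM.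
Qed.

Lemma cmeasZ c h : cmeas h -> cmeas (fun x => c * h x).
Proof. by move=> mh; apply: cmeasM => //; exact: cmeas_cst. Qed.

Lemma cmeas_real (r : X -> R) : measurable_fun [set: X] r -> cmeas (fun x => (r x)%:C).
Proof. by move=> mr; split => //; exact: measurable_cst. Qed.

Lemma cmeas_sum (J : Type) (s : seq J) (h : J -> X -> R[i]) :
  (forall j, cmeas (h j)) -> cmeas (fun x => \sum_(j <- s) h j x).
Proof.
move=> mh; elim: s => [|j s IH].
  by under eq_fun do rewrite big_nil; exact: cmeas_cst.
by under eq_fun do rewrite big_cons; apply: cmeasD.
Qed.

Lemma cmeas_cvg (h_ : nat -> X -> R[i]) h : (forall n, cmeas (h_ n)) ->
  (forall x eps, 0 < eps -> exists N, forall n, (N <= n)%N ->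
     `|complex.Re (h_ n x - h x)| <= eps /\ `|complex.Im (h_ n x - h x)| <= eps) ->
  cmeas h.
Proof.
move=> mh hc; split.
  apply: (measurable_fun_cvg (h := fun n x => complex.Re (h_ n x))).
    by move=> n; case: (mh n).
  move=> x _; apply/cvgrPdist_le => eps e0; have [N hN] := hc x eps e0.
  by exists N => // n /= /hN[+ _]; rewrite distrC ReD ReN.
apply: (measurable_fun_cvg (h := fun n x => complex.Im (h_ n x))).
  by move=> n; case: (mh n).
move=> x _; apply/cvgrPdist_le => eps e0; have [N hN] := hc x eps e0.
by exists N => // n /= /hN[_ +]; rewrite distrC ImD ImN.
Qed.

End ComplexMeasurable.

(** * Measurable fields of operators *)

Section MeasurableOperators.
Context {R : realType} {H : completeNormedModType R[i]}.
Variable dot : {dot H for (@Num.conj R[i])}.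
Hypothesis hH : hilbert_dot dot.
Variables (I : countType) (e : I -> H).
Hypothesis he : orthonormal_basis dot e.
Context {d : measure_display} {X : measurableType d}.
Local Notation "<< x , y >>" := (rdot dot x y).
Local Notation nsq := (nsq dot).
Local Notation nrm := (nrm dot).
Local Notation adj := (adj dot).
Local Notation positive_op := (positive_op dot).
Local Notation proj := (proj dot e).
Local Notation Tr := (pos_trace dot e).
Implicit Types (A B : X -> H -> H) (u v : X -> H).

(** Replaces the net of finite subsets of the countable [I] by a sequence, since limits of
    measurable functions are taken along sequences. *)
Definition exhaustion n : {fset I} :=
  [fset i in pmap (@choice.unpickle I) (iota 0 n)]%fset.


Lemma exhaustion_ge (K : {fset I}) : exists N, forall n, (N <= n)%N ->
  (K `<=` exhaustion n)%fset.
Proof.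
exists (\max_(i <- enum_fset K) (choice.pickle i).+1)%N => n Kn.
apply/fsubsetP => i iK; rewrite !inE mem_pmap; apply/mapP.
exists (choice.pickle i); last by rewrite choice.pickleK.
rewrite mem_iota /= add0n; apply: leq_trans Kn.
by apply: (@leq_bigmax_seq _ _ xpredT (fun i => (choice.pickle i).+1)).
Qed.

Lemma exhaustion_cvg (x : H) eps : 0 < eps -> exists N, forall n, (N <= n)%N ->
  nrm (proj (exhaustion n) x - x) <= eps.
Proof.
move=> e0; have [K hK] := proj_cvg hH he x e0.
have [N hN] := exhaustion_ge K; exists N => n /hN /hK.
by rewrite nrmBC.
Qed.

Lemma Re_dot_le (x y : H) : `|complex.Re (dot x y)| <= nrm x * nrm y.
Proof. exact: rdot_le. Qed.

Lemma Im_dot_le (x y : H) : `|complex.Im (dot x y)| <= nrm x * nrm y.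
Proof.
by rewrite Im_dot (le_trans (rdot_le _ _ _))// ler_wpM2l ?nrm_ge0// /nrm /nsq rdotii.
Qed.

Lemma cmeas_dot_cvg (u_ : nat -> X -> H) u (w : H) :
  (forall n, cmeas (fun x => dot (u_ n x) w)) ->
  (forall x eps, 0 < eps -> exists N, forall n, (N <= n)%N -> nrm (u_ n x - u x) <= eps) ->
  cmeas (fun x => dot (u x) w).
Proof.
move=> mu hu; apply: (cmeas_cvg mu) => x eps e0.
have [del d0 dw] := small_factor e0 (nrm_ge0 dot w).
have [N hN] := hu x _ d0; exists N => n /hN h.
rewrite -linearBl; split.
  by rewrite (le_trans (Re_dot_le _ _))// (le_trans _ dw)// ler_wpM2r ?nrm_ge0.
by rewrite (le_trans (Im_dot_le _ _))// (le_trans _ dw)// ler_wpM2r ?nrm_ge0.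
Qed.

Definition mvec v := forall i, cmeas (fun x => dot (v x) (e i)).

Definition mop A := (forall x, bounded_op (A x)) /\ forall j, mvec (fun x => A x (e j)).

Lemma mop_bounded A x : mop A -> bounded_op (A x).
Proof. by case. Qed.

Lemma cmeas_dot v w : mvec v -> cmeas (fun x => dot (v x) w).
Proof.
move=> mv; apply: (@cmeas_dot_cvg (fun n x => proj (exhaustion n) (v x))).
  move=> n; under eq_fun do rewrite /proj linear_sumlz/=.
  apply: cmeas_sum => j; under eq_fun do rewrite linearZl_LR/=.
  by apply: cmeasM => //; exact: cmeas_cst.
by move=> x eps; exact: exhaustion_cvg.
Qed.

(** Expanding [v x] in the basis separates the two dependences on [x]: the entries are limits of
    finite sums of products of measurable functions. *)
Lemma mop_apply A v : mop A -> mvec v -> mvec (fun x => A x (v x)).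
Proof.
move=> [bA mA] mv i.
apply: (@cmeas_dot_cvg (fun n x => A x (proj (exhaustion n) (v x)))).
  move=> n; under eq_fun => x do rewrite /proj (lin_sum (lin_bounded (bA x))) linear_sumlz/=.
  apply: cmeas_sum => j; under eq_fun => x do
    rewrite (linZ (lin_bounded (bA x))) linearZl_LR/=.
  by apply: cmeasM; [exact: mv|exact: mA].
move=> x eps e0; have [M0 AM] := opnorm_spec hH (bA x).
have [del d0 dM] := small_factor e0 M0.
have [N hN] := exhaustion_cvg (v x) d0; exists N => n /hN h.
rewrite -linB; last exact: lin_bounded.
by rewrite (le_trans (AM _))// (le_trans _ dM)// mulrC ler_wpM2r.
Qed.

Lemma mop_comp A B : mop A -> mop B -> mop (fun x => A x \o B x).
Proof.
move=> mA mB; split; last by move=> j; apply: mop_apply => //; case: mB.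
by move=> x; apply: (bounded_comp hH); exact: mop_bounded.
Qed.

Lemma mop_cst (A : H -> H) : bounded_op A -> mop (cst A).
Proof. by move=> bA; split=> // j i; exact: (cmeas_cst (dot (A (e j)) (e i))). Qed.

Lemma mopD A B : mop A -> mop B -> mop (fun x => A x \+ B x).
Proof.
move=> [bA mA] [bB mB]; split; first by move=> x; exact: boundedD.
by move=> j i /=; under eq_fun do rewrite linearDl; apply: cmeasD; [exact: mA|exact: mB].
Qed.

Lemma mopZ (c : X -> R[i]) A : cmeas c -> mop A -> mop (fun x => c x \*: A x).
Proof.
move=> mc [bA mA]; split; first by move=> x; exact: boundedZ.
by move=> j i /=; under eq_fun do rewrite linearZl_LR/=; apply: cmeasM; [exact: mc|exact: mA].
Qed.

Lemma mop_poly_op (q : {poly R}) A : mop A -> mop (fun x => poly_op q (A x)).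
Proof.
move=> mA; elim/poly_ind: q => [|q c IH].
  rewrite (_ : (fun x => _) = cst (cst 0)); first by apply: mop_cst; exact: bounded_cst0.
  by apply/funext => x; apply/funext => y; rewrite poly_op0.
rewrite (_ : (fun x => _) = (fun x => (A x \o poly_op q (A x)) \+ (c%:C \*: idfun))).
  apply: mopD; first exact: mop_comp.
  by apply: mop_cst; apply: (boundedZ hH); exact: bounded_id.
apply/funext => x; apply/funext => y.
by rewrite poly_opD poly_opMX ?poly_opC//; exact: lin_bounded (mop_bounded x mA).
Qed.

(** The norm of [A x] may be unbounded in [x]. Polynomials within [1/(n+1)] of [phi] on the growing
    intervals [[0, n]] eventually cover [[0, opnorm (A x)]] at every [x]. *)
Lemma mop_fcalc phi A B : (forall M, approximable M phi) -> mop A ->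
  (forall x, bounded_op (B x)) ->
  (forall x, fcalc dot (opnorm (A x)) (A x) phi (B x)) -> mop B.
Proof.
move=> aphi mA bB fB; split=> // j i.
have /choice[q hq] (n : nat) : exists q, near_on n%:R phi n.+1%:R^-1 q.
  by apply: aphi; rewrite invr_gt0.
apply: (@cmeas_dot_cvg (fun n x => poly_op (q n) (A x) (e j))).
  by move=> n; have [_ m] := mop_poly_op (q n) mA; exact: m.
move=> x eps e0; have [N hN] := inv_small e0.
exists (maxn N (Num.Def.truncn (opnorm (A x))).+1) => n.
rewrite geq_max => /andP[/hN h1 h2].
apply: (@le_trans _ _ (n.+1%:R^-1 * nrm (e j))); last by rewrite nrm_basis// mulr1.
apply: fB; first by rewrite invr_gt0.
apply: near_on_sub (hq n); rewrite (le_trans (ltW (truncnS_gt _)))// ler_nat//.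
Qed.

Lemma mop_sqrt A : mop A -> (forall x, positive_op (A x)) ->
  mop (fun x => sqrt_op dot (A x)).
Proof.
move=> mA pA; apply: (mop_fcalc (fun M => @approximable_sqrt _ M) mA).
  by move=> x; apply: positive_bounded; exact: sqrt_op_positive.
move=> x; have [psA sA] := sqrt_op_spec hH (pA x).
apply: sqrt_fcalc => //; first exact: opnorm_ge0 (mop_bounded x mA).
by move=> y; exact: positive_opnorm.
Qed.

Lemma mop_power p A : 1 < p -> mop A -> (forall x, positive_op (A x)) ->
  mop (fun x => power_op (A x) p).
Proof.
move=> p1 mA pA; have ap M := @approximable_powR _ M _ p1.
apply: (mop_fcalc ap mA).
  by move=> x; apply: positive_bounded; exact: power_op_positive.
by move=> x; exact: power_op_fcalc.
Qed.

Lemma mop_abs A A' : mop A -> mop A' -> (forall x, adj (A x) (A' x)) ->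
  mop (fun x => abs_op dot (A x)).
Proof.
move=> mA mA' aA.
rewrite (_ : (fun x => _) = (fun x => sqrt_op dot (A' x \o A x))).
  apply: mop_sqrt; first exact: mop_comp.
  by move=> x; apply: positive_gram => //; exact: mop_bounded.
by apply/funext => x; rewrite /abs_op (adjointE (mop_bounded x mA') (aA x)).
Qed.

Lemma measurable_trace A : mop A -> (forall x, positive_op (A x)) ->
  (forall x, (Tr (A x) < +oo)%E) -> measurable_fun [set: X] (fun x => fine (Tr (A x))).
Proof.
move=> mA pA fA.
pose S n x := \sum_(i <- enum_fset (exhaustion n)) << A x (e i), e i >>.
apply: (measurable_fun_cvg (h := S)).
  move=> n; apply: measurable_sum => i.
  by case: mA => _ /(_ i i)[].
move=> x _; apply/cvgrPdist_le => eps e0.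
have [K hK] := tsum_approx (fA x) e0.
have [N hN] := exhaustion_ge K; exists N => // n /= /hN Kn.
have fT : Tr (A x) \is a fin_num by rewrite ge0_fin_numE ?pos_trace_ge0.
have h1 : ((S n x)%:E <= Tr (A x))%E by rewrite pos_traceE; exact: tsum_ge.
have h2 : \sum_(i <- enum_fset K) << A x (e i), e i >> <= S n x.
  rewrite -lee_fin -!sumEFin; apply: lee_sum_nneg_subfset => [|i _ _].
    exact: fsubsetP.
  by rewrite lee_fin positive_ge0.
have h3 : (Tr (A x) <= (\sum_(i <- enum_fset K) << A x (e i), e i >>)%:E + eps%:E)%E.
  exact: hK.
move: h1 h3; rewrite -(fineK fT) -EFinD !lee_fin => h1 h3.
by rewrite ger0_norm ?subr_ge0// lerBlDl (le_trans h3)// lerD2r.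
Qed.

Lemma measurable_schatten p A A' : 1 < p -> mop A -> mop A' ->
  (forall x, adj (A x) (A' x)) -> (forall x, (Tr (abs_op dot (A x)) < +oo)%E) ->
  measurable_fun [set: X]
    (fun x => (fine (Tr (power_op (abs_op dot (A x)) p))) `^ p^-1).
Proof.
move=> p1 mA mA' aA fA.
have pA x : positive_op (abs_op dot (A x)) by exact: abs_op_positive.
apply: (measurableT_comp (measurable_powR _)).
apply: measurable_trace.
- by apply: mop_power => //; exact: mop_abs mA mA' aA.
- by move=> x; exact: power_op_positive.
- by move=> x; exact: trace_power_fin.
Qed.

End MeasurableOperators.

(** * Integrals of functions compared off a null set *)

Section IntegralOffNullSet.
Import HBNNSimple.
Context {d : measure_display} {T : measurableType d} {R : realType}.
Variable mu : {measure set T -> \bar R}.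

(* [F] and [G] need not be measurable: the integral of a nonnegative function
   is a supremum over the simple functions below it. *)
Lemma le_integral_off_null (N : set T) (F G : T -> \bar R) :
  measurable N -> mu N = 0%E ->
  (forall x, (0 <= F x)%E) -> (forall x, (0 <= G x)%E) ->
  (forall x, ~ N x -> (F x <= G x)%E) ->
  (\int[mu]_x F x <= \int[mu]_x G x)%E.
Proof.
move=> mN N0 F0 G0 FG; rewrite [leLHS]ge0_integralTE// [leRHS]ge0_integralTE//.
apply: ge_ereal_sup => _ [h /= hF <-].
have mC : measurable (~` N) by exact: measurableC.
(* Cutting a simple function below [F] to the complement of [N] keeps its integral and puts it below
   [G] everywhere. *)
pose k := mul_nnsfun h (indic_nnsfun R mC).
apply: ereal_sup_ubound; exists k => /=.
  move=> x; rewrite -[X in X%:E]/(h x * \1_(~` N) x) indicE; case: (boolP (x \in ~` N)) => [|_].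
    by rewrite inE mulr1 => xN; apply: le_trans (hF x) _; exact: FG.
  by rewrite mulr0.
rewrite -!integralT_nnsfun; apply: ge0_ae_eq_integral => //.
- exact/measurable_EFinP.
- exact/measurable_EFinP.
- by move=> x _; rewrite lee_fin.
- by move=> x _; rewrite lee_fin.
exists N; split=> // x /= nx; apply: contrapT => xN; apply: nx => _.
by congr (_%:E); rewrite -[LHS]/(h x * \1_(~` N) x) indicE mem_set// mulr1.
Qed.

Lemma le_Lnorm_off_null (r : R) (N : set T) (F G : T -> \bar R) : 0 < r ->
  measurable N -> mu N = 0%E ->
  (forall x, ~ N x -> (`|F x| <= `|G x|)%E) ->
  ('N[mu]_r%:E[F] <= 'N[mu]_r%:E[G])%E.
Proof.
move=> r0 mN N0 FG; rewrite unlock /Lnorm.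
apply: gt0_ler_poweR; first by rewrite invr_ge0 ltW.
- by rewrite in_itv/= leey andbT integral_ge0// => x _; exact: poweR_ge0.
- by rewrite in_itv/= leey andbT integral_ge0// => x _; exact: poweR_ge0.
apply: (le_integral_off_null mN N0) => [x|x|x xN]; [exact: poweR_ge0..|].
apply: gt0_ler_poweR; first exact: ltW.
- by rewrite in_itv/= leey andbT abse_ge0.
- by rewrite in_itv/= leey andbT abse_ge0.
exact: FG.
Qed.

End IntegralOffNullSet.

(** * Quantum random variables as measurable fields *)

Section QuantumRandomVariables.
Context {R : realType} {H : completeNormedModType R[i]}.
Variable dot : {dot H for (@Num.conj R[i])}.
Hypothesis hH : hilbert_dot dot.
Variables (I : countType) (e : I -> H).
Hypothesis he : orthonormal_basis dot e.
Context {X : ptopologicalType}.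
Local Notation "<< x , y >>" := (rdot dot x y).
Local Notation nsq := (nsq dot).
Local Notation nrm := (nrm dot).
Local Notation adj := (adj dot).
Local Notation positive_op := (positive_op dot).

Lemma norm_complex_le (z : R[i]) c : `|complex.Re z| <= c -> `|complex.Im z| <= c ->
  `|z| <= (2 * c)%:C.
Proof.
move=> h1 h2; rewrite normc_def lecR.
have c0 : 0 <= c by rewrite (le_trans _ h1).
rewrite -(@ler_pXn2r _ 2)// ?nnegrE ?sqrtr_ge0 ?mulr_ge0// sqr_sqrtr ?addr_ge0 ?sqr_ge0//.
have : `|complex.Re z| ^+ 2 <= c ^+ 2 by apply: lerXn2r.
have : `|complex.Im z| ^+ 2 <= c ^+ 2 by apply: lerXn2r.
rewrite !real_normK ?num_real// exprMn; nra.
Qed.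

(** For a unit vector this is a pure state; testing [quantum_rv] against it gives the measurability
    of [<f(x) v, v>]. *)
Definition rank_one (v y : H) : H := dot y v *: v.

(** The partial sum over [K] equals [<C (proj K v), v>], so convergence follows from the continuity
    of [C]. *)
Lemma trace_rank_one_cvg (C : H -> H) v : bounded_op C ->
  summability.partial_sum (fun i => dot (rank_one v (C (e i))) (e i) : R[i]^o)
    @ summability.totally --> (dot (C v) v : R[i]^o).
Proof.
move=> bC; have FF := @summability.totally_filter I.
have [C0 hC] := opnorm_spec hH bC.
apply/cvgrPdist_le => eps; rewrite ltcE => /andP[/= /eqP im0 re0].
have [del d0 dK] := small_factor re0
  (mulr_ge0 (ler0n R 2) (mulr_ge0 C0 (nrm_ge0 dot v))).
have [K0 hK] := proj_cvg hH he v d0; exists K0 => // K /= /hK h.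
have -> : summability.partial_sum (fun i => dot (rank_one v (C (e i))) (e i) : R[i]^o) K =
    dot (C (proj dot e K v)) v.
  rewrite /summability.partial_sum
    -(big_seq_fsetE _ _ xpredT (fun i => dot (rank_one v (C (e i))) (e i))).
  rewrite /proj (lin_sum (lin_bounded bC)) linear_sumlz/=; apply: eq_bigr => i _.
  by rewrite /rank_one (linZ (lin_bounded bC)) !linearZl_LR/= mulrC.
rewrite -linearBl -linB; last exact: lin_bounded.
have hle : nrm (C (v - proj dot e K v)) * nrm v <= del * (opnorm C * nrm v).
  rewrite mulrCA mulrA ler_wpM2r ?nrm_ge0// (le_trans (hC _))//.
  by rewrite ler_wpM2l.
apply: le_trans (norm_complex_le (le_trans (Re_dot_le _ _ _) hle)
                               (le_trans (Im_dot_le _ _ _) hle)) _.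
by rewrite lecE/= im0 eqxx/= mulrCA.
Qed.

Lemma bounded_rank_one v : bounded_op (rank_one v).
Proof.
apply/(bounded_opP hH); split.
  by move=> a x y; rewrite /rank_one linearPl/= scalerDl scalerA.
exists (2 * nrm v * nrm v) => [|x]; first by rewrite !mulr_ge0 ?nrm_ge0.
rewrite /rank_one -lecR -(normE hH) normrZ (normE hH).
apply: le_trans (ler_wpM2r _ (norm_complex_le (Re_dot_le dot x v) (Im_dot_le dot x v))) _.
  by rewrite ler0c nrm_ge0.
by rewrite -rmorphM lecR le_eqVlt; apply/orP; left; apply/eqP; ring.
Qed.

Lemma rank_one_state v : nsq v = 1 -> state dot e (rank_one v).
Proof.
move=> v1; split.
  split; first exact: bounded_rank_one.
  by move=> x; rewrite /rank_one linearZl_LR/= (dotC _ v) mulcJ_ge0.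
rewrite /has_trace; have := trace_rank_one_cvg (v := v) (bounded_id hH).
by rewrite /= dotxxE -/(nsq v) v1.
Qed.

Lemma trace_rank_one (C : H -> H) v : bounded_op C ->
  trace dot e (rank_one v \o C) = dot (C v) v.
Proof.
move=> bC; have FF := @summability.totally_filter I.
have h := @trace_rank_one_cvg C v bC.
exact: (@cvg_lim _ (@norm_hausdorff _ _) _ _ FF _ _ h).
Qed.

Lemma quantum_rv_cmeas (f : borel X -> H -> H) v : quantum_rv dot e f ->
  cmeas (fun x => dot (f x v) v).
Proof.
move=> [bf mf]; have [v0|vn0] := eqVneq (nrm v) 0.
  rewrite (nrm_eq0 v0); under eq_fun => x do rewrite linear0r.
  exact: cmeas_cst.
pose u := (nrm v)^-1%:C *: v.
have u1 : nsq u = 1 by rewrite /u nsqZ -nrm_sq -exprMn mulVf// expr1n.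
have vu : v = (nrm v)%:C *: u by rewrite /u scalerA -rmorphM mulfV// scale1r.
have [m1 m2] := mf _ (rank_one_state u1).
have mu : cmeas (fun x => dot (f x u) u).
  by split; [under eq_fun => x do rewrite -(trace_rank_one u (bf x))|
             under eq_fun => x do rewrite -(trace_rank_one u (bf x))].
rewrite vu; under eq_fun => x do
  rewrite (linZ (lin_bounded (bf x))) linearZl_LR linearZr_LR/=.
by do 2 apply: cmeasZ.
Qed.

Lemma dot_polar (A : H -> H) a b : linear A -> dot (A a) b = (4^-1 : R)%:C *
  ((dot (A (a + b)) (a + b) + (-1 : R)%:C * dot (A (a - b)) (a - b)) +
   'i%C * (dot (A (a + 'i%C *: b)) (a + 'i%C *: b) +
           (-1 : R)%:C * dot (A (a - 'i%C *: b)) (a - 'i%C *: b))).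
Proof.
move=> lA.
have Q z : dot (A (a + z)) (a + z) = dot (A a) a + dot (A a) z + dot (A z) a + dot (A z) z.
  by rewrite (linD lA) linearDl/= !linearDr/= addrA.
have AN z : A (- z) = - A z by rewrite -scaleN1r (linZ lA) scaleN1r.
have dNl x y : dot (- x) y = - dot x y by rewrite linearNl.
have dNr x y : dot x (- y) = - dot x y by rewrite linearNr.
have dZl c x y : dot (c *: x) y = c * dot x y by rewrite linearZl_LR.
have dZr c x y : dot x (c *: y) = c^* * dot x y by rewrite linearZr_LR.
rewrite !Q !AN !(dNl, dNr) !(linZ lA) !(dZl, dZr).
move: (dot (A a) a) (dot (A b) b) (dot (A a) b) (dot (A b) a) => [? ?] [? ?] [? ?] [? ?].
by apply: complex_ext => /=; field.
Qed.

(** Pure states only see the forms [<f(x) v, v>]; complex polarisation recovers the matrix entries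
    from them. *)
Lemma quantum_rv_mop (f : borel X -> H -> H) : quantum_rv dot e f -> mop dot e f.
Proof.
move=> qf; have mQ := quantum_rv_cmeas _ qf; have [bf _] := qf.
split=> // j i; under eq_fun => x do rewrite (dot_polar _ _ (lin_bounded (bf x))).
apply: cmeasZ; apply: cmeasD; [|apply: cmeasZ]; apply: cmeasD; try exact: mQ.
- by apply: cmeasZ; exact: mQ.
- by apply: cmeasZ; exact: mQ.
Qed.

Lemma mop_lincomb n (c : 'I_n -> R[i]) (h : 'I_n -> borel X -> H -> H) :
  (forall k, mop dot e (h k)) -> mop dot e (fun x v => \sum_(k < n) c k *: h k x v).
Proof.
move=> mh; elim: (index_enum _) => [|k s IH].
  rewrite (_ : (fun x => _) = cst (cst 0)); first by apply: mop_cst; exact: bounded_cst0.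
  by apply/funext => x; apply/funext => v; rewrite big_nil.
rewrite (_ : (fun x => _) = (fun x => (c k \*: h k x) \+ (fun v => \sum_(k <- s) c k *: h k x v))).
  by apply: mopD => //; apply: mopZ => //; exact: cmeas_cst.
by apply/funext => x; apply/funext => v; rewrite big_cons.
Qed.

(** On the span the adjoint is explicit, with conjugate coefficients, and it is measurable for the
    same reason as [f]. *)
Lemma LH_adj (f : borel X -> H -> H) : LH dot e f -> mop dot e f /\
  exists2 f', mop dot e f' & forall x, adj (f x) (f' x).
Proof.
move=> [n [c [h [qh fE]]]].
have mh k : mop dot e (h k) by apply: quantum_rv_mop; case: (qh k).
have -> : f = (fun x v => \sum_(k < n) c k *: h k x v).
  by apply/funext => x; apply/funext => v.
split; first exact: mop_lincomb.
exists (fun x v => \sum_(k < n) (c k)^* *: h k x v); first exact: mop_lincomb.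
move=> x u v; rewrite /rdot linear_sumlz linear_sumr/=; congr complex.Re.
apply: eq_bigr => k _; rewrite linearZl_LR linearZr_LR/=.
have ph := (qh k).2 x.
rewrite (adj_dot (positive_bounded ph) (positive_adj ph)); congr (_ * _).
exact: esym (conjcK (c k)).
Qed.

End QuantumRandomVariables.

(** * A positive measurable version of the density *)

Section DensityOperator.
Context {R : realType} {H : completeNormedModType R[i]}.
Variable dot : {dot H for (@Num.conj R[i])}.
Hypothesis hH : hilbert_dot dot.
Variables (I : countType) (e : I -> H).
Hypothesis he : orthonormal_basis dot e.
Context {X : ptopologicalType}.
Local Notation "<< x , y >>" := (rdot dot x y).
Local Notation nsq := (nsq dot).
Local Notation nrm := (nrm dot).
Local Notation adj := (adj dot).
Local Notation positive_op := (positive_op dot).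

Lemma sqrt_op_cst0 : sqrt_op dot (cst 0) = cst 0.
Proof.
apply/funext => x; apply: (nsq_eq0 (dot := dot)).
by rewrite nsq_sqrt_op ?rdot0l//; exact: positive_cst0.
Qed.

Lemma dense_nrm (S : set H) v eps : dense S -> 0 < eps ->
  exists2 s, S s & nrm (v - s) <= eps.
Proof.
move=> dS e0; have ec : 0 < eps%:C by rewrite ltcR.
have [s [bs Ss]] : ball v eps%:C `&` S !=set0.
  apply: dS; last exact: ball_open.
  by exists v; exact: ballxx.
exists s => //; move: bs; rewrite -ball_normE /= (normE hH) ltcR.
exact: ltW.
Qed.

(** Reduces positivity to the vectors of a dense set; for a countable one it becomes a measurable
    condition on the point of [X]. *)
Lemma positive_dense (A : H -> H) (S : set H) : bounded_op A -> dense S ->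
  (forall v, S v -> 0 <= dot (A v) v) -> positive_op A.
Proof.
move=> bA dS A0; split=> // v; have lA := lin_bounded bA.
have [M0 hM] := opnorm_spec hH bA; set M := opnorm A in M0 hM.
have close eps : 0 < eps -> exists2 s, S s &
    nrm (A (v - s)) * nrm v + nrm (A s) * nrm (v - s) <= eps.
  move=> e0; have nv := nrm_ge0 dot v.
  have [del d0 dK] := small_factor e0 (mulr_ge0 M0 (addr_ge0 (mulr_ge0 (ler0n R 2) nv) ler01)).
  have d1 : 0 < Num.min del 1 by rewrite lt_min d0 ltr01.
  have [s Ss sv] := dense_nrm v dS d1; exists s => //.
  move: sv; rewrite le_min => /andP[sv1 sv2].
  have h1 := hM (v - s); have h2 := hM s.
  have h3 : nrm s <= nrm v + nrm (v - s).
    by rewrite -[s in nrm s](subKr v) (le_trans (nrmD _ _ _))// nrmN.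
  have n1 := nrm_ge0 dot (v - s); have n2 := nrm_ge0 dot s.
  apply: le_trans dK.
  have g1 : nrm (A (v - s)) * nrm v <= M * del * nrm v.
    by rewrite ler_wpM2r// (le_trans h1)// ler_wpM2l.
  have g2 : nrm (A s) * nrm (v - s) <= M * (nrm v + 1) * del.
    apply: ler_pM => //; first exact: nrm_ge0.
    by rewrite (le_trans h2)// ler_wpM2l// (le_trans h3)// lerD2l.
  lra.
have split_dot s : dot (A v) v - dot (A s) s = dot (A (v - s)) v + dot (A s) (v - s).
  by rewrite (linB lA) linearBl linearBr/= addrA subrK.
have re_close s : `|complex.Re (dot (A v) v) - complex.Re (dot (A s) s)| <=
    nrm (A (v - s)) * nrm v + nrm (A s) * nrm (v - s).
  rewrite -ReN -ReD split_dot ReD (le_trans (ler_normD _ _))//.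
  by apply: lerD; exact: Re_dot_le.
have im_close s : `|complex.Im (dot (A v) v) - complex.Im (dot (A s) s)| <=
    nrm (A (v - s)) * nrm v + nrm (A s) * nrm (v - s).
  rewrite -ImN -ImD split_dot ImD (le_trans (ler_normD _ _))//.
  by apply: lerD; exact: Im_dot_le.
rewrite lecE /=; apply/andP; split.
  rewrite -normr_le0; apply/ler_addgt0Pr => eps e0; rewrite add0r.
  have [s Ss h] := close _ e0; apply: le_trans h; apply: le_trans (im_close s).
  by have := A0 s Ss; rewrite lecE => /andP[/eqP -> _]; rewrite subr0.
apply/ler_addgt0Pr => eps e0; have [s Ss h] := close _ e0.
have := le_trans (re_close s) h; have := A0 s Ss; rewrite lecE => /andP[_ /=].
by rewrite ler_norml => ? /andP[? ?]; lra.
Qed.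

Lemma measurable_mask (B : set (borel X)) (D : borel X -> H -> H) :
    measurable B -> (forall x, B x -> bounded_op (D x)) ->
    (forall j i, cmeas (fun x => dot (D x (e j)) (e i))) ->
  mop dot e (fun x => (\1_B x : R)%:C \*: D x).
Proof.
move=> mB bD mD; split=> [x|j i].
  have [Bx|nBx] := pselect (B x); first by apply: (boundedZ hH); exact: bD.
  rewrite (_ : _ \*: _ = cst 0); first exact: bounded_cst0.
  by apply/funext => v /=; rewrite indicE memNset// scale0r.
under eq_fun do rewrite /= linearZl_LR/=.
by apply: cmeasM => //; apply: cmeas_real; exact: measurable_indic.
Qed.

Lemma measurable_nonneg (h : borel X -> R[i]) : cmeas h ->
  measurable [set x | 0 <= h x].
Proof.
move=> [m1 m2].
rewrite (_ : [set x | _] = ((fun x => complex.Im (h x)) @^-1` [set 0]) `&`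
  ((fun x => complex.Re (h x)) @^-1` `[0, +oo[%classic)).
  apply: measurableI; rewrite -[X in measurable X]setTI.
    exact: m2.
  exact: m1.
apply/seteqP; split=> x /=; rewrite lecE/= in_itv/= andbT.
  by move=> /andP[/eqP -> ->].
by move=> [-> ->]; rewrite eqxx.
Qed.

(* [D] is only a.e. bounded, and its positivity is not assumed: where it is not
   positive, [sqrt_op] returns the junk value [0], so that it can be replaced by
   the zero operator there. *)
Lemma positive_version (sepH : separable H) (mu : {measure set (borel X) -> \bar R})
    (nu : set (borel X) -> H -> H) (D : borel X -> H -> H) :
  op_RN_derivative dot e nu mu D -> exists N D1,
  [/\ measurable N, mu N = 0%E, mop dot e D1, forall x, positive_op (D1 x) &
      forall x, ~ N x -> sqrt_op dot (D x) = sqrt_op dot (D1 x)].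
Proof.
move=> [hRN [N [mN N0 hN]]]; have [S cS dS] := sepH.
have bD x : ~ N x -> bounded_op (D x).
  by move=> nx; apply: contrapT => h; apply: nx; exact: hN.
have mD j i : cmeas (fun x => dot (D x (e j)) (e i)).
  have [/integrableP[m1 _] /integrableP[m2 _] _] := hRN i j.
  by split; exact/measurable_EFinP.
(* Killing [D] on the null set makes it bounded at every point, as [mop] demands. *)
pose D0 x := (\1_(~` N) x : R)%:C \*: D x.
have mD0 : mop dot e D0.
  by apply: measurable_mask => //; exact: measurableC.
have /countable_injP[num num_inj] := cS.
(* One condition per element of the countable dense set, so that their intersection, where [D0] is
   positive, is measurable. *)
pose P n := [set x | forall v, S v -> num v = n -> 0 <= dot (D0 x v) v].
have mP : measurable (\bigcap_n P n).
  apply: bigcapT_measurable => n.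
  have [[v [Sv vn]]|none] := pselect (exists v, S v /\ num v = n).
    rewrite (_ : P n = [set x | 0 <= dot (D0 x v) v]).
      apply: measurable_nonneg; apply: (cmeas_dot hH he).
      move=> i; apply: (mop_apply hH he mD0) => j.
      exact: (cmeas_cst (dot v (e j))).
    apply/seteqP; split=> x /=; first exact.
    by move=> h w Sw wn; rewrite (num_inj w v) ?inE// wn.
  rewrite (_ : P n = setT); first exact: measurableT.
  by apply/seteqP; split=> x //= _ v Sv vn; case: none; exists v.
set B := \bigcap_n P n in mP.
have posB x : B x -> positive_op (D0 x).
  move=> Bx; apply: (positive_dense (mop_bounded x mD0) dS) => v Sv.
  exact: (Bx (num v) Logic.I v Sv erefl).
exists N, (fun x => (\1_B x : R)%:C \*: D0 x); split=> //.
- apply: measurable_mask => // [x _|j i]; first exact: (mop_bounded x mD0).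
  by have [_ m] := mD0; exact: m.
- move=> x; have [Bx|nBx] := pselect (B x).
    rewrite (_ : _ \*: _ = D0 x); first exact: posB.
    by apply/funext => v /=; rewrite indicE mem_set// scale1r.
  rewrite (_ : _ \*: _ = cst 0); first exact: positive_cst0.
  by apply/funext => v /=; rewrite indicE memNset// scale0r.
move=> x nx.
have D0E : D0 x = D x by apply/funext => v; rewrite /D0 /= indicE mem_set// scale1r.
have [Bx|nBx] := pselect (B x).
  congr (sqrt_op dot _); rewrite -D0E.
  by apply/funext => v /=; rewrite indicE mem_set// scale1r.
rewrite (_ : _ \*: _ = cst 0); last first.
  by apply/funext => v /=; rewrite indicE memNset// scale0r.
rewrite sqrt_op_cst0 sqrt_op_junk// -D0E => -[_ pD]; apply: nBx => n _ v _ _.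
exact: pD.
Qed.

End DensityOperator.

(** * The operators [W(k)] for a fixed state *)

Section SandwichedOperator.
Context {R : realType} {H : completeNormedModType R[i]}.
Variable dot : {dot H for (@Num.conj R[i])}.
Hypothesis hH : hilbert_dot dot.
Variables (I : countType) (e : I -> H).
Hypothesis he : orthonormal_basis dot e.
Context {X : ptopologicalType}.
Variables (s : H -> H) (D1 : borel X -> H -> H).
Hypotheses (hs1 : state dot e s) (mD1 : mop dot e D1).
Hypothesis pD1 : forall x, positive_op dot (D1 x).
Local Notation r := (sqrt_op dot s).
Local Notation W f := (fun x => r \o (sqrt_op dot (D1 x) \o f x \o sqrt_op dot (D1 x)) \o r).

Let br : bounded_op r.
Proof. exact: (positive_bounded (sqrt_op_positive hH s)). Qed.

Let bsD x : bounded_op (sqrt_op dot (D1 x)).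
Proof. exact: (positive_bounded (sqrt_op_positive hH (D1 x))). Qed.

Lemma mop_sandwich f : mop dot e f -> mop dot e (W f).
Proof.
move=> mf; have msD : mop dot e (fun x => sqrt_op dot (D1 x)) by exact: mop_sqrt.
have mr : mop dot e (cst r : borel X -> H -> H) by exact: mop_cst.
apply: (mop_comp hH he _ mr); apply: (mop_comp hH he mr).
by apply: (mop_comp hH he _ msD); apply: (mop_comp hH he msD).
Qed.

Lemma adj_sandwich f f' : (forall x, adj dot (f x) (f' x)) ->
  forall x, adj dot (W f x) (W f' x).
Proof.
move=> af x u v /=.
have ar := positive_adj (sqrt_op_positive hH s).
have aD := positive_adj (sqrt_op_positive hH (D1 x)).
by rewrite ar aD af aD ar.
Qed.

Lemma trace_class_sandwiched f f' : mop dot e f -> mop dot e f' ->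
  (forall x, adj dot (f x) (f' x)) ->
  forall x, (pos_trace dot e (abs_op dot (W f x)) < +oo)%E.
Proof.
move=> mf mf' af x.
apply: (trace_class_sandwich hH he (C' := sqrt_op dot (D1 x) \o f' x \o sqrt_op dot (D1 x))).
- exact: sqrt_op_positive.
- exact: state_hs.
- by apply: (bounded_comp hH) => //; apply: (bounded_comp hH) => //; exact: (mop_bounded x mf).
- by apply: (bounded_comp hH) => //; apply: (bounded_comp hH) => //; exact: (mop_bounded x mf').
move=> u v /=; have aD := positive_adj (sqrt_op_positive hH (D1 x)).
by rewrite aD af aD.
Qed.

End SandwichedOperator.

Theorem lemma4p7 (R : realType)
    (H : completeNormedModType R[i]) (dot : {dot H for (@Num.conj R[i])})
    (hH : hilbert_dot dot) (sepH : separable H)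
    (I : countType) (e : I -> H) (he : orthonormal_basis dot e)
    (X : ptopologicalType)
    (lcX : locally_compact [set: X]) (hausX : hausdorff_space X)
    (nu : set (borel X) -> H -> H) (hnu : povm dot e nu)
    (rho : H -> H) (hrho : state dot e rho) (rho_full : full_rank rho)
    (mu : {measure set (borel X) -> \bar R})
    (hmu : induced_measure dot e nu rho mu)
    (D : borel X -> H -> H) (hD : op_RN_derivative dot e nu mu D)
    (p q : R) (p_gt1 : 1 < p) (q_gt1 : 1 < q) (hpq : p^-1 + q^-1 = 1)
    (f g : borel X -> H -> H) (hf : LH dot e f) (hg : LH dot e g) :
  (ereal_sup
     [set 'N[mu]_1[(fun x =>
            schatten dot e 1
              (sqrt_op dot s \o sqrt_op dot (D x) \o f x \o sqrt_op dot (D x)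
                 \o s
                 \o sqrt_op dot (D x) \o g x \o sqrt_op dot (D x)
                 \o sqrt_op dot s))] | s in state dot e]
   <= SL_norm dot e mu D p p f * SL_norm dot e mu D q q g)%E.
Proof.
have [N [D1 [mN N0 mD1 pD1 DE]]] := positive_version hH he sepH hD.
have [mf [f' mf' af]] := LH_adj hH he hf.
have [mg [g' mg' ag]] := LH_adj hH he hg.
have p0 : 0 < p by exact: lt_trans p_gt1.
have q0 : 0 < q by exact: lt_trans q_gt1.
apply: ge_ereal_sup => _ [s hs <-].
pose W (k : borel X -> H -> H) := fun x => sqrt_op dot s \o
  (sqrt_op dot (D1 x) \o k x \o sqrt_op dot (D1 x)) \o sqrt_op dot s.
have [mWf mWf'] : mop dot e (W f) /\ mop dot e (W f') by split; exact: mop_sandwich.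
have [mWg mWg'] : mop dot e (W g) /\ mop dot e (W g') by split; exact: mop_sandwich.
have aWf : forall x, adj dot (W f x) (W f' x) by exact: adj_sandwich.
have aWg : forall x, adj dot (W g x) (W g' x) by exact: adj_sandwich.
have tf : forall x, (pos_trace dot e (abs_op dot (W f x)) < +oo)%E.
  exact: (trace_class_sandwiched hH he D1 hs mf mf' af).
have tg : forall x, (pos_trace dot e (abs_op dot (W g x)) < +oo)%E.
  exact: (trace_class_sandwiched hH he D1 hs mg mg' ag).
(* By [tf] and [tg] the Schatten norms are finite, so real-valued functions represent them in
   Hoelder's inequality for [mu]. *)
pose F x := (fine (pos_trace dot e (power_op (abs_op dot (W f x)) p))) `^ p^-1.
pose G x := (fine (pos_trace dot e (power_op (abs_op dot (W g x)) q))) `^ q^-1.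
have FE x : schatten dot e p (W f x) = (F x)%:E by exact: schatten_fin.
have GE x : schatten dot e q (W g x) = (G x)%:E by exact: schatten_fin.
have mF : measurable_fun [set: borel X] F by exact: (measurable_schatten hH he p_gt1 mWf mWf').
have mG : measurable_fun [set: borel X] G by exact: (measurable_schatten hH he q_gt1 mWg mWg').
have WE (k : borel X -> H -> H) x : ~ N x -> sqrt_op dot s \o sqrt_op dot (D x) \o k x
    \o sqrt_op dot (D x) \o sqrt_op dot s = W k x.
  by move=> /DE ->.
have F0 x : 0 <= F x by exact: powR_ge0.
have G0 x : 0 <= G x by exact: powR_ge0.
(* [F] and [G] are built from the everywhere positive version [D1]; passing back to [D] changes the
   norms only on [N]. *)
apply: (@le_trans _ _ ('N[mu]_p%:E[EFin \o F] * 'N[mu]_q%:E[EFin \o G])%E); last first.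
  apply: lee_pmul; [exact: Lnorm_ge0..| |].
    apply: (@le_trans _ _ ('N[mu]_p%:E[(fun x => schatten dot e p (sqrt_op dot s
        \o sqrt_op dot (D x) \o f x \o sqrt_op dot (D x) \o sqrt_op dot s))])%E).
      by apply: (le_Lnorm_off_null p0 mN N0) => x /(WE f) ->; rewrite FE.
    by apply: ereal_sup_ubound; exists s.
  apply: (@le_trans _ _ ('N[mu]_q%:E[(fun x => schatten dot e q (sqrt_op dot s
      \o sqrt_op dot (D x) \o g x \o sqrt_op dot (D x) \o sqrt_op dot s))])%E).
    by apply: (le_Lnorm_off_null q0 mN N0) => x /(WE g) ->; rewrite GE.
  by apply: ereal_sup_ubound; exists s.
apply: le_trans (hoelder mu mF mG p0 q0 hpq).
have bound x : (schatten dot e 1 (W f x \o W g x) <= (F x * G x)%:E)%E.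
  have := schatten_hoelder hH he p_gt1 q_gt1 hpq
    (mop_bounded x mWf) (mop_bounded x mWf') (aWf x)
    (mop_bounded x mWg) (mop_bounded x mWg') (aWg x) (tf x) (tg x).
  by rewrite FE GE.
apply: (le_Lnorm_off_null ltr01 mN N0) => x nx.
(* The middle [s] is split as [s^(1/2) s^(1/2)], one factor for each of [W f] and [W g]. *)
have -> : sqrt_op dot s \o sqrt_op dot (D x) \o f x \o sqrt_op dot (D x) \o s
    \o sqrt_op dot (D x) \o g x \o sqrt_op dot (D x) \o sqrt_op dot s = W f x \o W g x.
  by apply/funext => v; rewrite /W /= (sqrt_opK hH hs.1) (DE _ nx).
rewrite (gee0_abs (poweR_ge0 _ _)).
exact: le_trans (bound x) (lee_abs _).
Qed.
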